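(* In the $K$-tier network model described in the context with noise power $W\ge0$, let $\mathcal U_k=\mathbb E[\log_2(1+\mathrm{SINR}_k)]$ be the average achievable rate of a typical user associated with tier $k$. For $\beta>0$ and $x>0$ let $\sigma_k(\beta)=\beta W/P_k$, $\tau_{j,k}(\beta)=\beta/(M_{j,k}B_{j,k})$, $\varphi_{j,k}(0;\beta)=\frac{\delta_j\tau_{j,k}\,{}_2F_1(1,1-\delta_j;2-\delta_j;-\tau_{j,k})}{1-\delta_j}$, $\varphi_{j,k}(n;\beta)=\frac{\delta_j\tau_{j,k}^n\,{}_2F_1(n+1,n-\delta_j;n+1-\delta_j;-\tau_{j,k})}{n-\delta_j}$ for $n\ge1$ (with $\tau_{j,k}=\tau_{j,k}(\beta)$), $g_{k,n}(x;\beta)=\sum_j\mathcal A_j\lambda_j\Omega_{j,k}^{\delta_j}\varphi_{j,k}(n;\beta)x^{\delta_{j,k}}$, and let $\mathbf Q_{M_k}(x;\beta)$ be the $M_k\times M_k$ lower triangular Toeplitz matrix with zero diagonal and $(p,q)$ entry $g_{k,p-q}(x;\beta)$ for $p>q$. Then $$\mathcal U_k=\frac{1}{\ln2}\frac{\lambda_k}{\mathcal T_k}\sum_{i=0}^{M_k-1}\sum_{m=0}^{M_k-1}\sum_{n=0}^{m}\int_0^{R_k^2}\!\!\int_0^\infty\frac{\pi^{i+1}\sigma_k(\beta)^{m-n}}{(m-n)!\,i!}\frac{x^{\frac{\alpha_k}{2}(m-n)}}{1+\beta}\exp\Big(-\sigma_k(\beta)x^{\alpha_k/2}-\pi g_{k,0}(x;\beta)-\pi\sum_{j=1}^K\lambda_j\Omega_{j,k}^{\delta_j}x^{\delta_{j,k}}\Big)\mathbf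 Q^i_{M_k}(x;\beta)(n+1,1)\,d\beta\,dx,$$ where $\mathbf Q^i(p,q)$ denotes the $(p,q)$ entry of the $i$-th power.
   Context: Network model: $\mathcal K=\{1,\dots,K\}$. In $\mathbb R^2$, tier-$k$ BSs form a homogeneous PPP of intensity $\lambda_k>0$ and users a homogeneous PPP of intensity $\lambda_u>0$, all independent. Tier-$k$ BSs have transmit power $P_k>0$, $M_k\in\mathbb N$ antennas, bias $B_k>0$, path-loss exponent $\alpha_k>2$. $\Omega_k=P_kM_kB_k$, $\delta_k=2/\alpha_k$, $\mathcal V_{j,k}=\mathcal V_j/\mathcal V_k$ for $\mathcal V\in\{P,M,B,\Omega,\delta\}$. Access threshold $\epsilon>0$, $R_k=(\Omega_k/\epsilon)^{1/\alpha_k}$. Association: with $D_k$ the distance from a typical user to its nearest tier-$k$ BS, $\hat\rho_k=\Omega_kD_k^{-\alpha_k}$ if $D_k\le R_k$, else $0$; the user is associated with tier $k$ iff $\hat\rho_k>\hat\rho_j$ for all $j\ne k$, with probability $\mathcal T_k=\pi\lambda_k\int_0^{R_k^2}\exp(-\pi\sum_j\lambda_j\Omega_{j,k}^{\delta_j}r^{\delta_{j,k}})dr$. Activation probability of tier $j$: $\mathcal A_j=1-\exp\big(-\pi\lambda_u\int_0^{R_j^2}\exp(-\pi\sum_l\lambda_l\Omega_{l,j}^{\delta_l}r^{\delta_{l,j}})dr\big)$; active tier-$j$ BSs are modeled as a homogeneous PPP of intensity $\mathcal A_j\lambda_j$. SINR model: conditional on association with tier $k$, the serving distance $X_k$ has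 density $\frac{2\pi\lambda_k}{\mathcal T_k}x\exp(-\pi\sum_j\lambda_j\Omega_{j,k}^{\delta_j}x^{2\delta_{j,k}})$ on $(0,R_k]$; given $X_k$, interferers of tier $j$ are the points of independent homogeneous PPPs of intensity $\mathcal A_j\lambda_j$ outside the disk around the user of radius $\Omega_{j,k}^{1/\alpha_j}X_k^{\alpha_k/\alpha_j}$; the signal gain $\|\mathbf h\|^2\sim\mathrm{Gamma}(M_k,1)$, an interferer of tier $j$ at distance $r$ contributes $P_jVr^{-\alpha_j}$ with $V\sim\mathrm{Exp}(1)$, all fading independent of each other and of the point processes; $I_o$ is the total interference and $\mathrm{SINR}_k=P_k\|\mathbf h\|^2X_k^{-\alpha_k}/(I_o+W)$. ${}_2F_1$ is the Gauss hypergeometric function. *)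

(* Defs.v *)
From HB Require Import structures.
From mathcomp Require Import all_boot all_order all_algebra.
From mathcomp Require Import all_classical all_reals all_analysis.
From mathcomp Require Import measurable_realfun.

Set Implicit Arguments.
Unset Strict Implicit.
Unset Printing Implicit Defensive.

Import Order.TTheory GRing.Theory Num.Def Num.Theory.
Import numFieldNormedType.Exports.

Local Open Scope classical_set_scope.
Local Open Scope ring_scope.

(* Gauss hypergeometric function 2F1 on the real half-line z < 1.      *)
(* Power series on |z| < 1; for z <= -1 its analytic continuation      *)
(* given by Pfaff's transformation                                     *)
(*   2F1(a,b;c;z) = (1-z)^(-a) 2F1(a,c-b;c;z/(z-1))                    *)
(* (z/(z-1) lies in [1/2,1) there, where the series converges).        *)
(* Only values at z = -tau <= 0 are used in the statement.             *)
Section Hypergeometric.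
Context {R : realType}.

Definition rising (a : R) (n : nat) : R := \prod_(i < n) (a + i%:R).

Definition hyp2F1_series (a b c z : R) : R :=
  limn (series (fun n : nat =>
           rising a n * rising b n / (rising c n * n`!%:R) * z ^+ n)).

Definition hyp2F1 (a b c z : R) : R :=
  if `|z| < 1 then hyp2F1_series a b c z
  else if z <= -1 then (1 - z) `^ (- a) * hyp2F1_series a (c - b) c (z / (z - 1))
  else 0 (* z >= 1: not used *).

End Hypergeometric.

Section Network.
Context {R : realType}.
Variables (K : nat) (lam Pw Bb alpha : 'I_K -> R) (Mant : 'I_K -> nat)
          (lam_u eps : R).

Local Notation leb := (@lebesgue_measure R).

Definition Omega (j : 'I_K) : R := Pw j * (Mant j)%:R * Bb j.
Definition delta (j : 'I_K) : R := 2 / alpha j.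
Definition Rad (k : 'I_K) : R := (Omega k / eps) `^ (alpha k)^-1.

Definition assoc_exp (k : 'I_K) (r : R) : R :=
  expR (- (pi * \sum_(j < K) lam j * (Omega j / Omega k) `^ delta j
                               * r `^ (delta j / delta k))).

Definition assoc_int (k : 'I_K) : R :=
  \int[leb]_(r in `[0, Rad k ^+ 2]) assoc_exp k r.

Definition Tassoc (k : 'I_K) : R := pi * lam k * assoc_int k.

Definition Aact (j : 'I_K) : R := 1 - expR (- (pi * lam_u * assoc_int j)).

(* density of the serving distance X_k on (0, R_k] *)
Definition serv_dens (k : 'I_K) (x : R) : R :=
  2 * pi * lam k / Tassoc k * x *
  expR (- (pi * \sum_(j < K) lam j * (Omega j / Omega k) `^ delta j
                               * x `^ (2 * (delta j / delta k)))).

Definition sigmak (W : R) (k : 'I_K) (beta : R) : R := beta * W / Pw k.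

Definition tauf (j k : 'I_K) (beta : R) : R :=
  beta / (((Mant j)%:R / (Mant k)%:R) * (Bb j / Bb k)).

Definition phif (j k : 'I_K) (n : nat) (beta : R) : R :=
  let d := delta j in let t := tauf j k beta in
  if n == 0%N then d * t * hyp2F1 1 (1 - d) (2 - d) (- t) / (1 - d)
  else d * t ^+ n * hyp2F1 (n.+1)%:R (n%:R - d) (n.+1%:R - d) (- t) / (n%:R - d).

Definition gf (k : 'I_K) (n : nat) (x beta : R) : R :=
  \sum_(j < K) Aact j * lam j * (Omega j / Omega k) `^ delta j * phif j k n beta
               * x `^ (delta j / delta k).

(* lower triangular Toeplitz matrix Q_{M_k}(x;beta), of size M_k
   (written (M_k).-1.+1, equal to M_k since M_k >= 1);
   0-based entry (p,q) is g_{k,p-q} for p > q, and 0 otherwise *)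
Definition Qmx (k : 'I_K) (x beta : R) : 'M[R]_((Mant k).-1.+1) :=
  \matrix_(p, q) (if (q < p)%N then gf k (p - q)%N x beta else 0).

(* integrand of the rate formula; the 1-based entry (n+1,1) of Q^i
   is the 0-based entry (n,0) *)
Definition rate_integrand (W : R) (k : 'I_K) (i m n : nat) (x beta : R) : R :=
  pi ^+ i.+1 * sigmak W k beta ^+ (m - n) / ((m - n)`!%:R * i`!%:R)
  * x `^ (alpha k / 2 * (m - n)%:R) / (1 + beta)
  * expR (- sigmak W k beta * x `^ (alpha k / 2) - pi * gf k 0 x beta
          - pi * \sum_(j < K) lam j * (Omega j / Omega k) `^ delta j
                               * x `^ (delta j / delta k))
  * ((Qmx k x beta) ^+ i) (inord n) ord0.

Definition Ioc0 (r : R) : set R := `]0, r].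
Definition Ioo0inf : set R := `]0, +oo[.

Definition rate_formula (W : R) (k : 'I_K) : \bar R :=
  ((ln 2)^-1 * (lam k / Tassoc k))%:E *
  (\sum_(0 <= i < Mant k) \sum_(0 <= m < Mant k) \sum_(0 <= n < m.+1)
     \int[leb]_(x in Ioc0 (Rad k ^+ 2))
       \int[leb]_(beta in Ioo0inf) (rate_integrand W k i m n x beta)%:E)%E.

End Network.

(* Points of the marked process live in (R * R) * R : position (y1,y2) *)
(* in R^2 and fading mark v.                                           *)
Section Probabilistic.
Context {R : realType}.
Local Notation leb := (@lebesgue_measure R).
Local Notation pt := ((R * R) * R)%type.

Definition leb3 : set pt -> \bar R := ((leb \x leb) \x leb)%E.

Definition exp1_dens (v : R) : R := if 0 <= v then expR (- v) else 0.

(* mean measure of a homogeneous PPP of intensity c on R^2 with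
   i.i.d. Exp(1) marks: c * Leb_2 (x) Exp(1) *)
Definition marked_mean (c : R) (B : set pt) : \bar R :=
  (c%:E * \int[leb3]_(z in B) (exp1_dens z.2)%:E)%E.

Definition pois (m : R) (n : nat) : R := m ^+ n / n`!%:R * expR (- m).

Context d (T : measurableType d) (P : probability T R).

Definition is_PPP (N : T -> {measure set pt -> \bar R}) (mu : set pt -> \bar R) :=
  (forall B, measurable B -> measurable_fun setT (fun w => (N w B : \bar R))) /\
  (forall n (Bs : 'I_n -> set pt) (cs : 'I_n -> nat),
     (forall i, measurable (Bs i)) ->
     (forall i, (mu (Bs i) < +oo)%E) ->
     (forall i j, i != j -> Bs i `&` Bs j = set0) ->
     P [set w | forall i, N w (Bs i) = (cs i)%:R%:E] =
       (\prod_(i < n) pois (fine (mu (Bs i))) (cs i))%:E).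

Definition events_of_real (X : T -> R) : set (set T) :=
  [set E | exists2 A : set R, measurable A & E = X @^-1` A].

Definition events_of_pp (N : T -> {measure set pt -> \bar R}) : set (set T) :=
  <<s [set E | exists B : set pt, exists S : set (\bar R),
          [/\ measurable B, measurable S & E = (fun w => N w B) @^-1` S]] >>.

Definition mutually_indep (I : finType) (F : I -> set (set T)) :=
  forall E : I -> set T, (forall i, F i (E i)) ->
    fine (P (\bigcap_(i in setT) E i)) = \prod_(i : I) fine (P (E i)).

End Probabilistic.

(* X : serving distance, H : signal gain ||h||^2, N j : marked PPP of  *)
(* (potentially) interfering active tier-j BSs (positions in R^2 with  *)
(* Exp(1) fading marks); only the points outside the exclusion disk    *)
(* of radius Omega_{j,k}^{1/alpha_j} X^{alpha_k/alpha_j} interfere.    *)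
Section SINR.
Context {R : realType}.
Local Notation pt := ((R * R) * R)%type.
Variables (K : nat) (Pw Bb alpha : 'I_K -> R) (Mant : 'I_K -> nat).
Context d (T : measurableType d) (P : probability T R).

(* distance of the point (position part) to the typical user at 0 *)
Definition pdist (z : pt) : R := Num.sqrt (z.1.1 ^+ 2 + z.1.2 ^+ 2).

Definition excl_radius (j k : 'I_K) (x : R) : R :=
  (Omega Pw Bb Mant j / Omega Pw Bb Mant k) `^ (alpha j)^-1 * x `^ (alpha k / alpha j).

Definition interference (k : 'I_K) (X : T -> R)
    (N : 'I_K -> T -> {measure set pt -> \bar R}) (w : T) : \bar R :=
  (\sum_(j < K)
     \int[N j w]_(z in [set z : pt | (excl_radius j k (X w) < pdist z)%R /\ (0 <= z.2)%R])
        (Pw j * z.2 * pdist z `^ (- alpha j))%:E)%E.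

Definition SINR (W : R) (k : 'I_K) (X H : T -> R)
    (N : 'I_K -> T -> {measure set pt -> \bar R}) (w : T) : R :=
  Pw k * H w * X w `^ (- alpha k) / (fine (interference k X N w) + W).

Definition avg_rate (W : R) (k : 'I_K) (X H : T -> R)
    (N : 'I_K -> T -> {measure set pt -> \bar R}) : \bar R :=
  (\int[P]_w (ln (1 + SINR W k X H N w) / ln 2)%:E)%E.

End SINR.

(* Main.v *)
Require Import Defs.
From HB Require Import structures.
From mathcomp Require Import all_boot all_order all_algebra.
From mathcomp Require Import all_classical all_reals all_analysis.
From mathcomp Require Import measurable_realfun.
From mathcomp Require Import ring lra zify.
Set Implicit Arguments.
Unset Strict Implicit.
Unset Printing Implicit Defensive.
Import Order.TTheory GRing.Theory Num.Def Num.Theory.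
Import numFieldNormedType.Exports.
Local Open Scope classical_set_scope.
Local Open Scope ring_scope.

(** By the layer-cake formula [ln (1 + s) = \int_(b > 0) 1{b < s} / (1 + b)] and
Tonelli, the rate is an integral of the coverage probabilities [P(SINR > b)].
Conditionally on the serving distance [x] and the interference [I], the event
[SINR > b] says that a Gamma([M], 1) variable exceeds [s (I + W)] with
[s = b x^alpha / P], which has probability [\sum_(m < M) y^m / m! e^(-y)] at
[y = s (I + W)].  The binomial formula reduces its mean to the moments
[E((s I)^n / n! e^(-s I))].

The Laplace functional of the marked Poisson processes and polar coordinates give
[E(e^(-t I)) = exp(- \sum_j c_j pi \int_(u >= u_j) y / (1 + y) du)] with
[y = t P_j u^(-alpha_j / 2)].  At [t = s (1 - z)] the left-hand side generates the
moments as power series in [z]; on the right the exponent expands into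
[g_0 - \sum_p g_p z^p], where [g_p] is an integral of [y^p / (1 + y)^(p + 1)],
that is, a hypergeometric value (series for [tau < 1], integration by parts and
Pfaff's transformation in general).  Comparing coefficients up to order [M], and
reading powers of the lower triangular Toeplitz matrix as powers of the polynomial
[\sum_p g_p z^p], yields the formula; it remains to integrate over the law of the
serving distance and to substitute [x^2] for [x].

Independence enters through Fubini's theorem for a product law.  This needs the
interference to be jointly measurable in the distance and the point processes: it
depends on the distance through a monotone, right-continuous radius, hence is a
limit of its values at dyadic approximations from above. *)

(** * Integration, densities and independence *)

Lemma measurable_preimage d1 d2 (T1 : measurableType d1) (T2 : measurableType d2)
    (f : T1 -> T2) A :
  measurable_fun setT f -> measurable A -> measurable (f @^-1` A).
Proof. by move=> mf mA; rewrite -[_ @^-1` _]setTI; exact: mf. Qed.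

Lemma ae_eq_measure d (T : measurableType d) (R : realType) (m : {measure set T -> \bar R})
    (A B : set T) : measurable A -> measurable B -> {ae m, forall x, A x <-> B x} -> m A = m B.
Proof.
move=> mA mB AB; rewrite -(setIT A) -(setIT B) -!integral_indic//.
apply: ae_eq_integral => //.
- by apply/measurable_EFinP; exact: measurable_indic.
- by apply/measurable_EFinP; exact: measurable_indic.
- apply: filterS AB => x ABx _; rewrite !indicE; congr (_%:R)%:E.
  by congr nat_of_bool; apply/idP/idP; rewrite !inE => /ABx.
Qed.

Section RealIntegralSum.
Context d (T : measurableType d) (R : realType) (m : {measure set T -> \bar R}).
Variables (D : set T) (mD : measurable D).

Lemma integrable_EFinZl (c : R) (f : T -> R) : m.-integrable D (EFin \o f) ->
  m.-integrable D (EFin \o (fun x => c * f x)).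
Proof.
move=> fi; have -> : EFin \o (fun x => c * f x) = (fun x => c%:E * (EFin \o f) x)%E.
  by apply/funext => x; rewrite /= EFinM.
exact: integrableZl.
Qed.

Lemma integrable_EFinB (f g : T -> R) : m.-integrable D (EFin \o f) ->
  m.-integrable D (EFin \o g) -> m.-integrable D (EFin \o (fun x => f x - g x)).
Proof. by move=> fi gi; exact: (integrableB mD fi gi). Qed.

Lemma integrable_EFin_sum (I : Type) (s : seq I) (f : I -> T -> R) :
  (forall i, m.-integrable D (EFin \o f i)) ->
  m.-integrable D (EFin \o (fun x => \sum_(i <- s) f i x)).
Proof.
move=> fi; have -> : EFin \o (fun x => \sum_(i <- s) f i x) =
    (fun x => \sum_(i <- s) (EFin \o f i) x)%E by apply/funext => x; rewrite /= sumEFin.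
exact: integrable_sum.
Qed.

Lemma Rintegral_sum (I : Type) (s : seq I) (f : I -> T -> R) :
  (forall i, m.-integrable D (EFin \o f i)) ->
  \int[m]_(x in D) (\sum_(i <- s) f i x) = \sum_(i <- s) \int[m]_(x in D) f i x.
Proof.
move=> fi; elim: s => [|i s IH].
  by under eq_Rintegral do rewrite big_nil; rewrite big_nil Rintegral_cst// mul0r.
under eq_Rintegral do rewrite big_cons.
by rewrite RintegralD ?big_cons ?IH//; exact: integrable_EFin_sum.
Qed.

End RealIntegralSum.

Section FubiniOn.
Local Open Scope ereal_scope.
Context d1 d2 (T1 : measurableType d1) (T2 : measurableType d2) (R : realType).
Variables (m1 : {sigma_finite_measure set T1 -> \bar R})
  (m2 : {sigma_finite_measure set T2 -> \bar R}).
Variables (D1 : set T1) (D2 : set T2) (f : T1 * T2 -> \bar R).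
Hypotheses (mD1 : measurable D1) (mD2 : measurable D2).
Hypotheses (mf : measurable_fun (D1 `*` D2) f) (f_ge0 : forall x y, D1 x -> D2 y -> 0 <= f (x, y)).

Let fD := f \_ (D1 `*` D2).

Let measurable_fD : measurable_fun setT fD.
Proof. by apply/(measurable_restrictT f); [exact: measurableX|]. Qed.

Let fD_ge0 z : 0 <= fD z.
Proof. by apply: erestrict_ge0 => -[x y] [/=]; exact: f_ge0. Qed.

Let integral_fD_section1 x :
  \int[m2]_y fD (x, y) = ((fun x => \int[m2]_(y in D2) f (x, y)) \_ D1) x.
Proof.
rewrite patchE; have [Dx|Dx] := boolP (x \in D1).
  rewrite [RHS]integral_mkcond; apply: eq_integral => y _.
  by rewrite /fD !patchE in_setX Dx.
by apply: integral0_eq => y _; rewrite /fD patchE in_setX (negbTE Dx).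
Qed.

Let integral_fD_section2 y :
  \int[m1]_x fD (x, y) = ((fun y => \int[m1]_(x in D1) f (x, y)) \_ D2) y.
Proof.
rewrite patchE; have [Dy|Dy] := boolP (y \in D2).
  rewrite [RHS]integral_mkcond; apply: eq_integral => x _.
  by rewrite /fD !patchE in_setX Dy andbT.
by apply: integral0_eq => x _; rewrite /fD patchE in_setX (negbTE Dy) andbF.
Qed.

Lemma measurable_fun_section_integral : measurable_fun D1 (fun x => \int[m2]_(y in D2) f (x, y)).
Proof.
apply/(measurable_restrictT _ mD1).
apply: (eq_measurable_fun (fubini_F m2 fD)); first by move=> x _; exact: integral_fD_section1.
exact: measurable_fun_fubini_tonelli_F.
Qed.

Lemma fubini_tonelli_on : \int[m1]_(x in D1) \int[m2]_(y in D2) f (x, y) =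
  \int[m2]_(y in D2) \int[m1]_(x in D1) f (x, y).
Proof.
rewrite [LHS]integral_mkcond [RHS]integral_mkcond.
under eq_integral do rewrite -integral_fD_section1.
under [in RHS]eq_integral do rewrite -integral_fD_section2.
exact: fubini_tonelli.
Qed.

Lemma measurable_fun_section x : D1 x -> measurable_fun D2 (fun y => f (x, y)).
Proof.
move=> Dx; apply/(measurable_restrictT _ mD2).
apply: (eq_measurable_fun (fun y => fD (x, y))).
  by move=> y _; rewrite /fD !patchE in_setX mem_set.
exact: measurableT_comp measurable_fD (pair1_measurable x).
Qed.

End FubiniOn.

Lemma ge0_integral2_sum d1 d2 (T1 : measurableType d1) (T2 : measurableType d2) (R : realType)
    (m1 : {sigma_finite_measure set T1 -> \bar R}) (m2 : {sigma_finite_measure set T2 -> \bar R})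
    (D1 : set T1) (D2 : set T2) (I : Type) (s : seq I) (f : I -> T1 -> T2 -> R) :
  measurable D1 -> measurable D2 ->
  (forall i, measurable_fun (D1 `*` D2) (fun z => f i z.1 z.2)) ->
  (forall i x y, D1 x -> D2 y -> 0 <= f i x y) ->
  (\int[m1]_(x in D1) \int[m2]_(y in D2) (\sum_(i <- s) f i x y)%:E =
   \sum_(i <- s) \int[m1]_(x in D1) \int[m2]_(y in D2) (f i x y)%:E)%E.
Proof.
move=> mD1 mD2 mf f_ge0; pose g i (z : T1 * T2) := (f i z.1 z.2)%:E.
have mg i : measurable_fun (D1 `*` D2) (g i) by exact/measurable_EFinP.
have g_ge0 i x y : D1 x -> D2 y -> (0 <= g i (x, y))%E by rewrite lee_fin; exact: f_ge0.
rewrite -ge0_integral_sum//; first last.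
- by move=> i x Dx; apply: integral_ge0 => y; exact: g_ge0.
- by move=> i; exact: (measurable_fun_section_integral m2 mD1 mD2 (mg i) (g_ge0 i)).
apply: eq_integral => x /set_mem Dx; under eq_integral do rewrite -sumEFin.
rewrite ge0_integral_sum//; last by move=> i y; exact: g_ge0.
by move=> i; exact: (measurable_fun_section mD1 mD2 (mg i) Dx).
Qed.

Section DensityMeasure.
Local Open Scope ereal_scope.
Context d (T : measurableType d) (R : realType).
Variables (m : {measure set T -> \bar R}) (p : T -> R).
Hypotheses (mp : measurable_fun setT p) (p_ge0 : forall x, (0 <= p x)%R).

Definition mdensity (_ : measurable_fun setT p) (_ : forall x, (0 <= p x)%R)
  (A : set T) : \bar R := \int[m]_(x in A) (p x)%:E.

Local Notation nu := (mdensity mp p_ge0).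

Let mdensity0 : nu set0 = 0. Proof. exact: integral_set0. Qed.

Let mdensity_ge0 A : 0 <= nu A.
Proof. by apply: integral_ge0 => x _; rewrite lee_fin. Qed.

Let mdensity_sigma_additive : semi_sigma_additive nu.
Proof.
apply: semi_sigma_additive_nng_induced; first exact/measurable_EFinP.
by move=> x; rewrite lee_fin.
Qed.

HB.instance Definition _ := isMeasure.Build _ T R nu
  mdensity0 mdensity_ge0 mdensity_sigma_additive.

Import HBNNSimple.

Let integral_mdensity_nnsfun (h : {nnsfun T >-> R}) :
  \int[nu]_x (h x)%:E = \int[m]_x ((h x)%:E * (p x)%:E).
Proof.
rewrite integralT_nnsfun sintegralE.
under [RHS]eq_integral => x _.
  rewrite fimfunE -fsumEFin// ge0_mule_fsuml => [|r]; last exact: nnfun_muleindic_ge0.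
  over.
rewrite ge0_integral_fsum//=; last 2 first.
- move=> r; apply: emeasurable_funM; apply/measurable_EFinP => //.
  by apply: measurable_funM => //; exact: measurable_indic.
- by move=> r x _; rewrite mule_ge0 ?lee_fin//; exact: nnfun_muleindic_ge0.
apply: eq_fsbigr => r _.
have [r0|r0] := ltP r 0%R.
  rewrite preimage_nnfun0// measure0 mule0; apply/esym/integral0_eq => x _.
  by rewrite indic0 mulr0 mul0e.
under [RHS]eq_integral do rewrite EFinM -muleA.
rewrite ge0_integralZl//; last 2 first.
- apply: emeasurable_funM; apply/measurable_EFinP => //; exact: measurable_indic.
- by move=> x _; rewrite mule_ge0 ?lee_fin.
congr (_ * _); rewrite /mdensity integral_mkcond epatch_indic.
by apply: eq_integral => x _; rewrite muleC.
Qed.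

Lemma ge0_integral_mdensity (g : T -> \bar R) :
  measurable_fun setT g -> (forall x, 0 <= g x) ->
  \int[nu]_x g x = \int[m]_x (g x * (p x)%:E).
Proof.
move=> mg g0; pose h := nnsfun_approx measurableT mg.
have hg x : (h n x)%:E @[n --> \oo] --> g x by exact: cvg_nnsfun_approx.
have nd_h x : nondecreasing_seq (h ^~ x).
  by move=> i j ij; exact/lefP/nd_nnsfun_approx.
transitivity (limn (fun n => \int[nu]_x (h n x)%:E)).
  rewrite -monotone_convergence//=.
  - by apply: eq_integral => x _; apply/esym/cvg_lim.
  - by move=> n; exact/measurable_EFinP.
  - by move=> n x _; rewrite lee_fin.
  - by move=> x _ i j ij; rewrite lee_fin nd_h.
under eq_fun do rewrite integral_mdensity_nnsfun.
rewrite -monotone_convergence//=.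
- by apply: eq_integral => x _; apply/cvg_lim => //; exact: cvgeZr.
- by move=> n; apply: emeasurable_funM; exact/measurable_EFinP.
- by move=> n x _; rewrite mule_ge0 ?lee_fin.
- by move=> x _ i j ij; rewrite lee_wpmul2r ?lee_fin ?nd_h.
Qed.

End DensityMeasure.

Section ImageIntegral.
Local Open Scope ereal_scope.
Context d1 d2 (T : measurableType d1) (U : measurableType d2) (R : realType).

Lemma ge0_integral_image (m : {measure set T -> \bar R})
    (nu : {measure set U -> \bar R}) (f : T -> U) (g : U -> \bar R) :
  measurable_fun setT f ->
  (forall A, measurable A -> m (f @^-1` A) = nu A) ->
  measurable_fun setT g -> (forall u, 0 <= g u) ->
  \int[m]_x g (f x) = \int[nu]_u g u.
Proof.
move=> mf fm mg g0; transitivity (\int[pushforward m f]_u g u).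
  by rewrite ge0_integral_pushforward.
by apply: eq_measure_integral => A mA _; exact: fm.
Qed.

End ImageIntegral.

Section HalfLine.
Context {R : realType}.
Local Notation leb := (@lebesgue_measure R).

Lemma eq_measure_rays (q1 q2 : {measure set (measurableTypeR R) -> \bar R}) :
  (forall u, q1 `]-oo, u[%classic = q2 `]-oo, u[%classic) ->
  (forall u, q1 `]-oo, u[%classic < +oo)%E ->
  forall A, measurable A -> q1 A = q2 A.
Proof.
move=> q12 qfin; apply: (@measure_unique _ R (measurableTypeR R) (@RGenInftyO.G R)
  (fun n => `]-oo, n%:R[%classic)) => //.
- exact: RGenInftyO.measurableE.
- move=> _ _ [u ->] [v ->]; exists (Num.min u v).
  by apply/seteqP; split => x /=; rewrite !in_itv/= lt_min => /andP.
- by move=> n; exists n%:R.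
- apply/seteqP; split => // x _; exists (Num.truncn `|x|).+1 => //=.
  by rewrite in_itv/= (le_lt_trans (ler_norm x))// truncnS_gt.
- by move=> _ [u ->].
Qed.

Lemma eq_lebesgue_pos_rays (c : R) (q : {measure set (measurableTypeR R) -> \bar R}) :
  0 <= c -> (forall u, q `]-oo, u[%classic = (c * Num.max u 0)%:E) ->
  forall A, measurable A -> q A = (c%:E * leb (A `&` `]0%R, +oo[))%E.
Proof.
move=> c0 q_ray.
have mpos : measurable (`]0, +oo[ : set (measurableTypeR R)) by exact: measurable_itv.
apply: (@eq_measure_rays q (mscale (NngNum c0) (mrestr leb mpos))) => u; last by rewrite q_ray ltry.
rewrite q_ray /mscale/= /mrestr EFinM; congr (_ * _)%E.
transitivity (leb `]0, u[%classic).
  by rewrite lebesgue_measure_itv/= lte_fin; case: ltP => u0; rewrite ?sube0.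
congr (leb _); apply/seteqP; split => x /=; rewrite !in_itv/= andbT.
  by move=> /andP[].
by move=> [-> ->].
Qed.

Lemma integral_pos_rays d (T : measurableType d) (m : {measure set T -> \bar R})
    (f : T -> measurableTypeR R) (c : R) (g : R -> \bar R) :
  0 <= c -> measurable_fun setT f ->
  (forall u : R, m [set x | (f x : R) < u] = (c * Num.max u 0)%:E) ->
  measurable_fun setT g -> (forall u, 0 <= g u)%E ->
  (\int[m]_x g (f x) = c%:E * \int[leb]_(u in `]0%R, +oo[) g u)%E.
Proof.
move=> c0 mf f_ray mg g0.
have mpos : measurable (`]0, +oo[ : set (measurableTypeR R)) by exact: measurable_itv.
have mpos1 : measurable_fun setT (\1_(`]0, +oo[ : set (measurableTypeR R)) : _ -> R).
  exact: measurable_indic.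
have pos1_ge0 x : 0 <= \1_(`]0, +oo[ : set (measurableTypeR R)) x :> R by [].
rewrite (@ge0_integral_image _ _ T (measurableTypeR R) R m
  (mscale (NngNum c0) (mdensity leb mpos1 pos1_ge0)) f g mf _ mg g0).
  rewrite ge0_integral_mscale//= ge0_integral_mdensity// [in RHS]integral_mkcond.
  by rewrite epatch_indic.
move=> A mA; rewrite -[LHS]/(pushforward m f A) (eq_lebesgue_pos_rays c0)//.
transitivity (c%:E * mdensity leb mpos1 pos1_ge0 A)%E => //.
by rewrite /mdensity integral_indic// setIC.
Qed.

End HalfLine.

Section IndependentPair.
Local Open Scope ereal_scope.
Context d (T : measurableType d) (R : realType) (P : probability T R).

(* Fubini's theorem, once the joint law of X and Y is recognised as a product. *)
Lemma indep_integral_pair d1 d2 (U : measurableType d1) (V : measurableType d2)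
    (X : T -> U) (Y : T -> V) (f : U * V -> \bar R) :
  measurable_fun setT X -> measurable_fun setT Y ->
  (forall A B, measurable A -> measurable B ->
     P (X @^-1` A `&` Y @^-1` B) = P (X @^-1` A) * P (Y @^-1` B)) ->
  measurable_fun setT f -> (forall z, 0 <= f z) ->
  \int[P]_w f (X w, Y w) = \int[P]_w \int[P]_v f (X w, Y v).
Proof.
move=> mX mY XY mf f0.
pose RX : {mfun T >-> U} := HB.pack X (isMeasurableFun.Build _ _ _ _ X mX).
pose RY : {mfun T >-> V} := HB.pack Y (isMeasurableFun.Build _ _ _ _ Y mY).
have mXY : measurable_fun setT (fun w => (X w, Y w)) by exact: measurable_fun_pair.
pose RXY : {mfun T >-> (U * V)%type} := HB.pack (fun w => (X w, Y w))
  (isMeasurableFun.Build _ _ _ _ (fun w => (X w, Y w)) mXY).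
rewrite -[LHS](@ge0_integral_distribution _ _ _ _ _ P RXY)//.
rewrite (eq_measure_integral (distribution P RX \x distribution P RY)); last first.
  move=> A mA _; apply/esym; move: A mA; apply: product_measure_unique => B C mB mC.
  exact: XY.
rewrite fubini_tonelli1//= /fubini_F.
rewrite (@ge0_integral_distribution _ _ _ _ _ P RX)//.
- apply: eq_integral => w _; rewrite /comp (@ge0_integral_distribution _ _ _ _ _ P RY)//.
  by apply: measurableT_comp => //; exact: measurable_pair1.
- exact: measurable_fun_fubini_tonelli_F.
- by move=> u; exact: integral_ge0.
Qed.

Lemma indep_integralM (f g : T -> \bar R) :
  measurable_fun setT f -> (forall w, 0 <= f w) ->
  measurable_fun setT g -> (forall w, 0 <= g w) ->
  (forall A B, measurable A -> measurable B ->
     P (f @^-1` A `&` g @^-1` B) = P (f @^-1` A) * P (g @^-1` B)) ->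
  \int[P]_w (f w * g w) = \int[P]_w f w * \int[P]_w g w.
Proof.
move=> mf f0 mg g0 fg.
transitivity (\int[P]_w (`|f w| * `|g w|)).
  by apply: eq_integral => w _; rewrite !gee0_abs.
rewrite (@indep_integral_pair _ _ _ _ f g (fun z => `|z.1| * `|z.2|))//; last first.
- apply: emeasurable_funM; apply: measurableT_comp => //.
under eq_integral => w _.
  rewrite /= ge0_integralZl//; last exact: measurableT_comp.
  under eq_integral do rewrite gee0_abs//.
  rewrite gee0_abs//; over.
by rewrite ge0_integralZr//; exact: integral_ge0.
Qed.

End IndependentPair.

Section MutualIndependence.
Local Open Scope ereal_scope.
Context d (T : measurableType d) (R : realType) (P : probability T R).
Variables (I : finType) (F : I -> set (set T)).
Hypotheses (F_measurable : forall i, F i `<=` measurable)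
  (F_setT : forall i, F i setT) (F_setI : forall i, setI_closed (F i))
  (indF : mutually_indep P F).

Definition other_events (i0 : I) : set (set T) := \bigcup_(i in [set i | i != i0]) F i.

Let boxes i0 : set (set T) := [set A | exists E : I -> set T,
  [/\ forall i, F i (E i), E i0 = setT & A = \bigcap_(i in setT) E i]].

Let boxes_measurable i0 : boxes i0 `<=` measurable.
Proof.
move=> _ [E [FE _ ->]]; apply: fin_bigcap_measurable; first exact: finite_finset.
by move=> i _; exact: F_measurable.
Qed.

Let boxes_setI i0 : setI_closed (boxes i0).
Proof.
move=> _ _ [E [FE E0 ->]] [E' [FE' E'0 ->]].
exists (fun i => E i `&` E' i); split; first by move=> i; exact: F_setI.
  by rewrite E0 E'0 setIT.
by rewrite bigcapI.
Qed.

Let other_events_boxes i0 : <<s other_events i0 >> `<=` <<s boxes i0 >>.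
Proof.
apply: sub_sigma_algebra2 => A [i /= ii0 FA].
exists (fun j => if j == i then A else setT); split.
- by move=> j; case: eqP => [->|].
- by rewrite eq_sym (negbTE ii0).
- apply/seteqP; split => [x Ax j _|x /(_ i Logic.I)]; last by rewrite eqxx.
  by case: eqP.
Qed.

Let indep_box i0 E0 A : F i0 E0 -> boxes i0 A -> P (E0 `&` A) = P E0 * P A.
Proof.
move=> FE0 bA; have mA := boxes_measurable bA; have mE0 := F_measurable FE0.
move: bA mA => [E [FE EiT ->]] mA.
pose E' i := if i == i0 then E0 else E i.
have FE' i : F i (E' i) by rewrite /E'; case: eqP => [->|].
have -> : E0 `&` \bigcap_(i in setT) E i = \bigcap_(i in setT) E' i.
  apply/seteqP; split => [x [E0x Ex] i _|x E'x].
    by rewrite /E'; case: eqP => // _; exact: Ex.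
  split=> [|i _]; first by have := E'x i0 Logic.I; rewrite /E' eqxx.
  by have := E'x i Logic.I; rewrite /E'; case: eqP => // ->; rewrite EiT.
have mE' : measurable (\bigcap_(i in setT) E' i).
  apply: fin_bigcap_measurable; first exact: finite_finset.
  by move=> i _; exact: F_measurable.
rewrite -[LHS]fineK ?fin_num_measure// -[in RHS](@fineK _ (P (\bigcap_(i in setT) E i)))
  ?fin_num_measure//.
rewrite (indF FE') (indF FE) (bigD1 i0)//= [in RHS](bigD1 i0)//= EiT.
rewrite probability_setT/= mul1r {1}/E' eqxx EFinM fineK ?fin_num_measure//.
congr (_ * _%:E); apply: eq_bigr => i /negbTE ii0.
by rewrite /E' ii0.
Qed.

Lemma indep_other_events i0 E0 E : F i0 E0 -> <<s other_events i0 >> E ->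
  P (E0 `&` E) = P E0 * P E.
Proof.
move=> FE0 /other_events_boxes boxE.
have mE0 : measurable E0 by exact: F_measurable FE0.
have PE0_ge0 : (0 <= fine (P E0))%R by rewrite fine_ge0.
suff : mrestr P mE0 E = mscale (NngNum PE0_ge0) P E.
  by rewrite /mrestr /mscale/= setIC fineK// fin_num_measure.
apply: (g_sigma_algebra_measure_unique (boxes i0) _ (fun=> setT)) => //.
- by move=> _; exists (fun=> setT); split => //; apply/seteqP.
- by rewrite bigcup_const//; exists 0%N.
- move=> A bA; change (P (A `&` E0) = (fine (P E0))%:E * P A).
  by rewrite setIC (indep_box FE0)// fineK// fin_num_measure.
- by move=> k; rewrite ltey_eq fin_num_measure.
Qed.

Lemma indep_expectation_prod (Z : I -> T -> R) (z : I -> R) :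
  (forall i A, measurable A -> F i (Z i @^-1` A)) ->
  (forall i w, 0 <= Z i w)%R -> (forall i, \int[P]_w (Z i w)%:E = (z i)%:E) ->
  \int[P]_w (\prod_i Z i w)%R%:E = (\prod_i z i)%R%:E.
Proof.
move=> FZ Z0 hz.
have mZ i : measurable_fun setT (Z i).
  by move=> _ A mA; rewrite setTI; exact/F_measurable/FZ.
elim: (index_enum I) (index_enum_uniq I) => [_|i s IH /= /andP[iNs us]].
  under eq_integral do rewrite big_nil.
  by rewrite big_nil integral_cst//= probability_setT mule1.
under eq_integral do rewrite big_cons EFinM.
have mprod : measurable_fun setT (fun w => \prod_(j <- s) Z j w)%R.
  by apply: measurable_prod => j _; exact: mZ.
rewrite indep_integralM.
- by rewrite hz IH// -EFinM big_cons.
- exact/measurable_EFinP.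
- by move=> w; rewrite lee_fin.
- exact/measurable_EFinP.
- by move=> w; rewrite lee_fin prodr_ge0.
- move=> A B mA mB.
  have mE (C : set (\bar R)) : measurable C -> measurable (EFin @^-1` C).
    by move=> mC; apply: measurable_preimage mC; exact: EFin_measurable.
  apply: indep_other_events; first exact: (FZ i _ (mE A mA)).
  have mprod_others : measurable_fun [set: g_sigma_algebraType (other_events i)]
      (fun w => \prod_(j <- s) Z j w)%R.
    apply: measurable_prod => j js _ C mC; rewrite setTI; apply: sub_sigma_algebra.
    by exists j => /=; [apply: contraNneq iNs => <-|exact: FZ].
  exact: (measurable_preimage mprod_others (mE B mB)).
Qed.

Lemma mutually_indep_comp (J : finType) (h : J -> I) : injective h ->
  mutually_indep P (F \o h).
Proof.
move=> h_inj E FE.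
pose E' i := if [pick j | h j == i] is Some j then E j else setT.
have E'h j : E' (h j) = E j.
  by rewrite /E'; case: pickP => [j' /eqP/h_inj ->|/(_ j)]//; rewrite eqxx.
have FE' i : F i (E' i).
  by rewrite /E'; case: pickP => [j /eqP <-|_]; [exact: FE|exact: F_setT].
have -> : \bigcap_(j in setT) E j = \bigcap_(i in setT) E' i.
  apply/seteqP; split => [x Ex i _|x E'x j _]; last by rewrite -E'h; exact: E'x.
  by rewrite /E'; case: pickP => // j _; exact: Ex.
rewrite (indF FE') (bigID (mem (codom h)))/= [X in (_ * X)%R]big1 ?mulr1; last first.
  move=> i /negP hi; rewrite /E'; case: pickP => [j /eqP ji|_].
    by exfalso; apply: hi; rewrite -ji codom_f.
  by rewrite probability_setT.
rewrite -big_uniq ?map_inj_uniq -?enumT ?enum_uniq// big_map big_enum.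
by apply: eq_bigr => j _; rewrite E'h.
Qed.

End MutualIndependence.

Section Dyadic.
Context {R : realType}.

Definition updyadic (n : nat) (x : R) : R := (Num.truncn (x * 2 ^+ n)).+1%:R / 2 ^+ n.

Lemma updyadic_gt n x : x < updyadic n x.
Proof. by rewrite /updyadic ltr_pdivlMr ?exprn_gt0//; exact: truncnS_gt. Qed.

Lemma updyadic_le n x : 0 <= x -> updyadic n x <= x + (2 ^+ n)^-1.
Proof.
move=> x0; rewrite /updyadic ler_pdivrMr ?exprn_gt0// mulrDl mulVf ?expf_neq0//.
by rewrite -natr1 lerD2r truncn_le mulr_ge0// exprn_ge0.
Qed.

Lemma updyadicS_le n x : updyadic n.+1 x <= updyadic n x.
Proof.
have le2 (a b : R) : (a / (2 * 2 ^+ n) <= b / 2 ^+ n) = (a <= b * 2).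
  by rewrite invfM mulrA ler_pM2r ?invr_gt0 ?exprn_gt0// ler_pdivrMr.
rewrite /updyadic exprS le2 -natrM ler_nat muln2.
suff : (Num.truncn (x * (2 * 2 ^+ n)) <= (Num.truncn (x * 2 ^+ n)).*2.+1)%N by lia.
rewrite truncn_le_nat.
have -> : (Num.truncn (x * 2 ^+ n)).*2.+2 = ((Num.truncn (x * 2 ^+ n)).+1 * 2)%N by lia.
rewrite natrM mulrCA mulrC ltr_pM2r//; exact: truncnS_gt.
Qed.

Lemma updyadic_nincr x : nonincreasing_seq (updyadic ^~ x).
Proof. by apply/nonincreasing_seqP => n; exact: updyadicS_le. Qed.

Lemma cvg_updyadic x : 0 <= x -> updyadic n x @[n --> \oo] --> x.
Proof.
move=> x0; apply: (squeeze_cvgr (f := fun=> x) (h := fun n => x + (2 ^+ n)^-1)).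
- by apply: nearW => n; rewrite (ltW (updyadic_gt _ _)) updyadic_le.
- exact: cvg_cst.
- rewrite -[X in _ --> X]addr0; apply: cvgD; first exact: cvg_cst.
  under eq_fun do rewrite -exprVn.
  by apply: cvg_expr; rewrite ger0_norm ?invr_ge0// invf_lt1// ltr1n.
Qed.

Lemma measurable_truncn : measurable_fun setT (fun x : R => (Num.truncn x)%:R : R).
Proof.
by apply: nondecreasing_measurable => // x y xy; rewrite ler_nat; exact: le_truncn.
Qed.

(* Evaluating at updyadic n (X w) means choosing one of countably many functions f x,
   so that no joint measurability of f is needed. *)
Lemma measurable_fun_updyadic d d' (T : measurableType d) (V : measurableType d')
    (X : T -> R) (f : R -> T -> V) (n : nat) :
  measurable_fun setT X -> (forall x, measurable_fun setT (f x)) ->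
  measurable_fun setT (fun w => f (updyadic n (X w)) w).
Proof.
move=> mX mf.
pose E v := [set w | Num.truncn (X w * 2 ^+ n) = v].
have mE v : measurable (E v).
  rewrite (_ : E v = (fun w => (Num.truncn (X w * 2 ^+ n))%:R) @^-1` [set v%:R : R]).
    apply: measurable_preimage (measurable_set1 _).
    by apply: (measurableT_comp measurable_truncn); exact: measurable_funM.
  by apply/seteqP; split => w /= => [->//|/eqP]; rewrite eqr_nat => /eqP.
have -> : [set: T] = \bigcup_v E v.
  by apply/seteqP; split => // w _; exists (Num.truncn (X w * 2 ^+ n)).
apply/measurable_fun_bigcup => // v.
apply: (eq_measurable_fun (f (v.+1%:R / 2 ^+ n))).
  by move=> w; rewrite inE /E/= /updyadic => ->.
exact: measurable_funS (mf _).
Qed.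

Lemma measurable_fun_eval d (T : measurableType d) (X : T -> R) (f : R -> T -> \bar R) :
  measurable_fun setT X -> (forall x, measurable_fun setT (f x)) ->
  (forall w, f (updyadic n (X w)) w @[n --> \oo] --> f (X w) w) ->
  measurable_fun setT (fun w => f (X w) w).
Proof.
move=> mX mf cf.
apply: (emeasurable_fun_cvg (fun n w => f (updyadic n (X w)) w)) => // n.
exact: measurable_fun_updyadic.
Qed.

End Dyadic.

(** * The Laplace functional of a Poisson point process *)

Section ExpN.
Context {R : realType}.
Implicit Types x y : \bar R.

Definition expN y : R := fine (expeR (- y)).

Lemma expN_EFin (r : R) : expN r%:E = expR (- r).
Proof. by []. Qed.

Lemma expN_ge0 y : 0 <= expN y.
Proof. by rewrite fine_ge0// expeR_ge0. Qed.

Lemma expN_le1 y : (0 <= y)%E -> expN y <= 1.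
Proof. by case: y => [r| |]//; rewrite lee_fin => r0; rewrite expR_le1 oppr_le0. Qed.

Lemma expND x y : (0 <= x)%E -> (0 <= y)%E -> expN (x + y)%E = expN x * expN y.
Proof.
case: x => [r| |]//; case: y => [s| |]// r0 s0; rewrite ?mulr0 ?mul0r//.
by rewrite !expN_EFin opprD expRD.
Qed.

Lemma expN_sum (I : Type) (s : seq I) (Q : pred I) (F : I -> \bar R) :
  (forall i, 0 <= F i)%E ->
  expN (\sum_(i <- s | Q i) F i)%E = \prod_(i <- s | Q i) expN (F i).
Proof.
move=> F0; elim: s => [|i s IH]; first by rewrite !big_nil expN_EFin oppr0 expR0.
by rewrite !big_cons; case: ifP => // _; rewrite expND ?IH//; exact: sume_ge0.
Qed.

Lemma expN_nincr x y : (0 <= x)%E -> (x <= y)%E -> expN y <= expN x.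
Proof.
case: x => [r| |]//; case: y => [s| |]//.
- by move=> _; rewrite lee_fin ler_expR lerN2.
- by move=> _ _; exact: expR_ge0.
Qed.

Lemma measurable_expN : measurable_fun setT (@expN).
Proof.
rewrite (_ : @expN = fun y => if y \is a fin_num then expR (- fine y) else 0); last first.
  by apply/funext => -[].
apply: measurable_fun_ifT => //.
- apply: (@measurable_fun_bool _ _ _ _ true); rewrite setTI.
  rewrite (_ : _ @^-1` _ = ~` [set -oo%E] `&` ~` [set +oo%E]).
    by apply: measurableI; apply: measurableC; exact: emeasurable_set1.
  by apply/seteqP; split => -[r| |] //= [].
- by apply: measurableT_comp => //; exact: measurableT_comp.
Qed.

Lemma cvg_expN (u : (\bar R)^nat) (l : \bar R) : (forall n, 0 <= u n)%E ->
  u @ \oo --> l -> expN (u n) @[n --> \oo] --> expN l.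
Proof.
move=> u0 ul.
have l0 : (0 <= l)%E by apply: (cvge_to_ge ul); exact: nearW.
case: l l0 ul => [r| |]// r0 ul.
  have /fine_cvgP[u_fin cvg_u] := ul; rewrite expN_EFin.
  apply: (@cvg_trans _ (expR (- fine (u n)) @[n --> \oo])).
    by apply: near_eq_cvg; near=> n; rewrite -expN_EFin fineK//; near: n.
  exact: (cvg_comp _ _ (cvgN cvg_u) (@continuous_expR R (- r))).
apply/cvgrPdist_le => e e0; near=> n; rewrite /= sub0r normrN ger0_norm ?expN_ge0//.
have : ((- ln e)%:E <= u n)%E by near: n; move/cvgeyPge: ul; exact.
have := u0 n; case: (u n) => [s _| |]//; last by move=> _ _; exact: ltW.
by rewrite lee_fin expN_EFin => es; rewrite -[leRHS]lnK ?posrE// ler_expR lerNl.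
Unshelve. all: by end_near. Qed.

End ExpN.

Section PoissonSeries.
Context {R : realType}.

Lemma pois_ge0 (m : R) k : 0 <= m -> 0 <= pois m k.
Proof. by move=> m0; rewrite mulr_ge0 ?expR_ge0// divr_ge0// exprn_ge0. Qed.

Lemma pois_laplace (m a : R) : 0 <= m ->
  (\sum_(0 <= k <oo) (pois m k * expN (a%:E * k%:R%:E))%:E =
   (expR (- ((1 - expR (- a)) * m)))%:E)%E.
Proof.
move=> m0; have q0 : 0 <= m * expR (- a) by rewrite mulr_ge0// expR_ge0.
under eq_eseriesr => k _.
  have -> : pois m k * expN (a%:E * k%:R%:E) =
      expR (- m) * ((m * expR (- a)) ^+ k / k`!%:R).
    by rewrite /pois -EFinM expN_EFin exprMn -expRM_natr mulNr; ring.
  rewrite EFinM; over.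
rewrite nneseriesZl => [|k _]; last by rewrite lee_fin divr_ge0// exprn_ge0.
have -> : (\sum_(0 <= k <oo) ((m * expR (- a)) ^+ k / k`!%:R)%:E =
           (expR (m * expR (- a)))%:E)%E.
  rewrite /expR -EFin_lim; last exact: is_cvg_series_exp_coeff.
  by apply/congr_lim/funext => n; rewrite /series/= -sumEFin.
by rewrite -EFinM -expRD; congr (expR _)%:E; ring.
Qed.

Lemma pois_series (m : R) : 0 <= m -> (\sum_(0 <= k <oo) (pois m k)%:E = 1)%E.
Proof.
move=> m0; have := pois_laplace 0 m0.
rewrite oppr0 expR0 subrr mul0r oppr0 expR0 => <-.
by apply: eq_eseriesr => k _; rewrite mul0e expN_EFin oppr0 expR0 mulr1.
Qed.

End PoissonSeries.

Section PPPCounts.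
Context {R : realType}.
Local Notation pt := ((R * R) * R)%type.
Context d (T : measurableType d) (P : probability T R).
Variables (N : T -> {measure set pt -> \bar R}) (mu : set pt -> \bar R).
Hypotheses (PPP : is_PPP P N mu) (mu_ge0 : forall B, (0 <= mu B)%E).

Definition count_eq (k : nat) (y : \bar R) : R := (y == k%:R%:E)%:R.

Lemma count_eq_ge0 k y : 0 <= count_eq k y.
Proof. exact: ler0n. Qed.

Lemma measurable_count_eq k : measurable_fun setT (count_eq k).
Proof.
rewrite (_ : count_eq k = \1_[set k%:R%:E]); first exact: measurable_indic.
by apply/funext => y; rewrite indicE; congr (nat_of_bool _)%:R; apply/eqP/idP; rewrite inE.
Qed.

Local Notation count_event B k := [set w | N w B = k%:R%:E].

Let measurable_count_event B k : measurable B -> measurable (count_event B k).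
Proof.
by move=> mB; exact: (measurable_preimage (PPP.1 B mB) (emeasurable_set1 k%:R%:E)).
Qed.

Let trivIset_count_event B : trivIset setT (fun k => count_event B k).
Proof. by move=> i j _ _ [w [/= -> [/eqP]]]; rewrite eqr_nat => /eqP. Qed.

Lemma PPP_count_law B k : measurable B -> (mu B < +oo)%E ->
  P (count_event B k) = (pois (fine (mu B)) k)%:E.
Proof.
move=> mB muB.
have := PPP.2 1%N (fun=> B) (fun=> k) (fun=> mB) (fun=> muB).
rewrite big_ord1 => <-; last by move=> i j; rewrite !ord1 eqxx.
by congr (P _); apply/seteqP; split => w /= => [|/(_ ord0)].
Qed.

Lemma ae_PPP_count_nat B : measurable B -> (mu B < +oo)%E ->
  P (~` \bigcup_k count_event B k) = 0%E.
Proof.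
move=> mB muB; have mE k := measurable_count_event k mB.
rewrite probability_setC; last exact: bigcup_measurable.
rewrite measure_bigcup//.
rewrite (_ : (\sum_(0 <= k <oo | _) _)%E = 1%E) ?subee//.
rewrite -(pois_series (m := fine (mu B))) ?fine_ge0//.
under eq_eseriesl do rewrite in_setT.
by apply: eq_eseriesr => k _; exact: PPP_count_law.
Qed.

Lemma integral_PPP_count (B : set pt) (g : \bar R -> R) (f : T -> R) :
  measurable B -> (mu B < +oo)%E ->
  measurable_fun setT g -> (forall y, 0 <= g y) ->
  measurable_fun setT f -> (forall w, 0 <= f w) ->
  (\int[P]_w (g (N w B) * f w)%:E =
   \sum_(0 <= k <oo) (g k%:R%:E)%:E * \int[P]_w (count_eq k (N w B) * f w)%:E)%E.
Proof.
move=> mB muB mg g0 mf f0; have mNB := PPP.1 B mB.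
have mE k := measurable_count_event k mB.
have mUE : measurable (\bigcup_k count_event B k) by exact: bigcup_measurable.
have mgf : measurable_fun setT (fun w => (g (N w B) * f w)%:E).
  by apply/measurable_EFinP; apply: measurable_funM => //; exact: measurableT_comp.
have gf0 w : (0 <= (g (N w B) * f w)%:E)%E by rewrite lee_fin mulr_ge0.
rewrite (ge0_negligible_integral _ _ mgf _ (ae_PPP_count_nat mB muB))//; last exact: measurableC.
rewrite setDE setCK setTI ge0_integral_bigcup//; last exact: measurable_funS mgf.
apply: eq_eseriesr => k _; rewrite -ge0_integralZl//; last 3 first.
- apply/measurable_EFinP; apply: measurable_funM => //.
  exact: measurableT_comp (measurable_count_eq k) mNB.
- by move=> w _; rewrite lee_fin mulr_ge0// count_eq_ge0.
- by rewrite lee_fin.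
rewrite integral_mkcond; apply: eq_integral => w _; rewrite patchE /count_eq.
have -> : (w \in count_event B k) = (N w B == k%:R%:E) by apply/idP/eqP; rewrite inE.
by case: eqP => [->|_]; rewrite ?mul1r// mul0r mule0.
Qed.

Section DisjointRegions.
Variables (n : nat) (Bs : 'I_n -> set pt).
Hypotheses (mBs : forall i, measurable (Bs i)) (muBs : forall i, (mu (Bs i) < +oo)%E)
  (disjBs : forall i j, i != j -> Bs i `&` Bs j = set0).

Local Notation mean i := (fine (mu (Bs i))).

Let integral_prod_count_eq (ks : 'I_n -> nat) :
  (\int[P]_w (\prod_i count_eq (ks i) (N w (Bs i)))%:E = (\prod_i pois (mean i) (ks i))%:E)%E.
Proof.
rewrite -(PPP.2 n Bs ks)// -[X in P X]setIT -integral_indic//; last first.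
  rewrite (_ : [set w | _] = \bigcap_(i in [set: 'I_n]) count_event (Bs i) (ks i)).
    by apply: fin_bigcap_measurable => [|i _]; [exact: finite_finset|exact: measurable_count_event].
  by apply/seteqP; split => w /= Nw i; [move=> _|]; exact: Nw.
apply: eq_integral => w _; congr EFin; rewrite indicE.
case: (boolP (w \in _)); rewrite ?inE/= => Nw.
  by rewrite big1// => i _; rewrite /count_eq Nw eqxx.
have [i /eqP/negbTE Ni] : exists i, N w (Bs i) <> (ks i)%:R%:E.
  by apply/existsNP; move: Nw; rewrite notin_setE.
by rewrite (bigD1 i)//= /count_eq Ni mul0r.
Qed.

(* Induction on the number m of factors that are not indicators of a value. *)
Let integral_prod_counts_upto m (g : 'I_n -> \bar R -> R) (Z : 'I_n -> R) : (m <= n)%N ->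
  (forall i, measurable_fun setT (g i)) -> (forall i y, 0 <= g i y) ->
  (forall i : 'I_n, (i < m)%N ->
    (\sum_(0 <= k <oo) (pois (mean i) k * g i k%:R%:E)%:E = (Z i)%:E)%E) ->
  (forall i : 'I_n, (m <= i)%N ->
    exists k, g i = count_eq k /\ Z i = pois (mean i) k) ->
  (\int[P]_w (\prod_i g i (N w (Bs i)))%:E = (\prod_i Z i)%:E)%E.
Proof.
elim: m g Z => [|m IH] g Z mn mg g0 gZ g_eq.
  have /choice[ks gks] i : exists k, g i = count_eq k /\ Z i = pois (mean i) k by exact: g_eq.
  under [in RHS]eq_bigr do rewrite (gks _).2.
  under eq_integral do under eq_bigr do rewrite (gks _).1.
  exact: integral_prod_count_eq.
pose im := Ordinal mn.
pose g_at k i := if i == im then count_eq k else g i.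
pose Z_at k i := if i == im then pois (mean im) k else Z i.
have g_at_ge0 k i y : 0 <= g_at k i y by rewrite /g_at; case: ifP.
have measurable_g_at k i : measurable_fun setT (g_at k i).
  by rewrite /g_at; case: ifP => // _; exact: measurable_count_eq.
have integral_g_at k :
    (\int[P]_w (\prod_i g_at k i (N w (Bs i)))%:E = (\prod_i Z_at k i)%:E)%E.
  apply: IH => //; first exact: ltnW.
    move=> i im_gt; have /negbTE iNm : i != im by rewrite neq_ltn im_gt.
    by rewrite /g_at /Z_at iNm; apply: gZ; exact: ltnW.
  move=> i mi; rewrite /g_at /Z_at; case: eqP => [->|/eqP iNm]; first by exists k.
  by apply: g_eq; rewrite ltn_neqAle mi eq_sym iNm.
have mgN i : measurable_fun setT (fun w => g i (N w (Bs i))).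
  exact: measurableT_comp (mg i) (PPP.1 _ (mBs i)).
have prod_im h : \prod_i h i = h im * \prod_(i | i != im) h i :> R by rewrite (bigD1 im).
under eq_integral do rewrite prod_im.
rewrite integral_PPP_count//; last 2 first.
- under eq_fun do rewrite big_mkcond/=.
  by apply: measurable_prod => i _; case: (i != im).
- by move=> w; exact: prodr_ge0.
rewrite prod_im EFinM -gZ// muleC -nneseriesZl => [|k _]; last first.
  by rewrite lee_fin mulr_ge0// pois_ge0// fine_ge0.
apply: eq_eseriesr => k _.
have -> : (\int[P]_w (count_eq k (N w (Bs im)) *
    \prod_(i < n | i != im) g i (N w (Bs i)))%:E = (\prod_i Z_at k i)%:E)%E.
  rewrite -integral_g_at; apply: eq_integral => w _; rewrite prod_im {1}/g_at eqxx.
  by congr (_ * _)%:E; apply: eq_bigr => i /negbTE iNm; rewrite /g_at iNm.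
rewrite prod_im {1}/Z_at eqxx -!EFinM; congr EFin.
rewrite mulrCA mulrA mulrC; congr (_ * _).
by apply: eq_bigr => i /negbTE iNm; rewrite /Z_at iNm.
Qed.

Lemma PPP_indep_counts (g : 'I_n -> \bar R -> R) (Z : 'I_n -> R) :
  (forall i, measurable_fun setT (g i)) -> (forall i y, 0 <= g i y) ->
  (forall i, \sum_(0 <= k <oo) (pois (mean i) k * g i k%:R%:E)%:E = (Z i)%:E)%E ->
  (\int[P]_w (\prod_i g i (N w (Bs i)))%:E = (\prod_i Z i)%:E)%E.
Proof.
move=> mg g0 gZ; apply: (integral_prod_counts_upto (leqnn n)) => // i.
by rewrite leqNgt ltn_ord.
Qed.

End DisjointRegions.
End PPPCounts.

Section SimpleFunctionIntegral.
Context d (T : measurableType d) (R : realType).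
Import HBNNSimple.
Implicit Types h : {nnsfun T >-> R}.

Definition pos_values h : seq R := [seq r <- finmap.enum_fset (fset_set (range h)) | r != 0].

Lemma uniq_pos_values h : uniq (pos_values h).
Proof. by apply: filter_uniq; exact: finmap.fset_uniq. Qed.

Lemma mem_pos_values h z : h z != 0 -> h z \in pos_values h.
Proof. by move=> hz; rewrite mem_filter hz in_fset_set ?inE//; exists z. Qed.

Lemma pos_values_gt0 h r : r \in pos_values h -> 0 < r.
Proof.
rewrite mem_filter => /andP[r0]; rewrite in_fset_set// inE => -[z _ hz].
by rewrite lt0r r0 -hz fun_ge0.
Qed.

Lemma integral_nnsfun_comp (m : {measure set T -> \bar R}) h (phi : R -> R) :
  phi 0 = 0 -> (forall r, 0 <= r -> 0 <= phi r) ->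
  (\int[m]_z (phi (h z))%:E =
   \sum_(r <- pos_values h) (phi r)%:E * m (h @^-1` [set r]))%E.
Proof.
move=> phi0 phi_ge0.
pose piece r z := phi r * \1_(h @^-1` [set r]) z.
have piece_neq r z : r != h z -> piece r z = 0.
  move=> /eqP rhz; rewrite /piece indicE memNset ?mulr0// => /= hzr.
  exact/rhz/esym.
have piece_ge0 r z : 0 <= piece r z.
  have [->|rhz] := eqVneq r (h z); last by rewrite piece_neq.
  by rewrite /piece mulr_ge0// phi_ge0// fun_ge0.
have mpiece r : measurable_fun setT (piece r) by exact: measurable_funM.
have phiE z : phi (h z) = \sum_(r <- pos_values h) piece r z.
  have [hz0|hz0] := eqVneq (h z) 0.
    rewrite hz0 phi0 big_seq big1// => r /pos_values_gt0 r0.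
    by rewrite piece_neq// hz0 gt_eqF.
  rewrite (bigD1_seq (h z)) ?mem_pos_values ?uniq_pos_values//= big1 ?addr0.
    by rewrite /piece indicE mem_set// mulr1.
  by move=> r; exact: piece_neq.
under eq_integral do rewrite phiE -sumEFin.
rewrite ge0_integral_sum//; last 2 first.
- by move=> r; exact/measurable_EFinP.
- by move=> r z _; rewrite lee_fin.
rewrite big_seq [RHS]big_seq; apply: eq_bigr => r /pos_values_gt0 r0.
under eq_integral do rewrite EFinM.
by rewrite ge0_integralZl_EFin ?integral_indic ?setIT ?phi_ge0 ?ltW//; exact/measurable_EFinP.
Qed.

End SimpleFunctionIntegral.

Section LaplaceFunctional.
Context {R : realType}.
Local Notation pt := ((R * R) * R)%type.
Context d (T : measurableType d) (P : probability T R).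
Variables (N : T -> {measure set pt -> \bar R}) (mu : {measure set pt -> \bar R}).
Hypotheses (PPP : is_PPP P N mu) (mu_sigma_finite : sigma_finite setT mu).

Import HBNNSimple.

Let laplace_weight_ge0 (x : \bar R) : (0 <= x)%E -> 0 <= 1 - expN x.
Proof. by move=> x0; rewrite subr_ge0 expN_le1. Qed.

Let PPP_laplace_nnsfun (h : {nnsfun pt >-> R}) :
  (forall r, 0 < r -> (mu (h @^-1` [set r]) < +oo)%E) ->
  (\int[P]_w (expN (\int[N w]_z (h z)%:E))%:E =
   (expN (\int[mu]_z (1 - expN (h z)%:E)%:E))%:E)%E.
Proof.
move=> mu_level; set s := pos_values h.
pose level (i : 'I_(size s)) := h @^-1` [set s`_i].
have mlevel i : measurable (level i) by exact: measurable_funPTI.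
have s_gt0 (i : 'I_(size s)) : 0 < s`_i by apply: (@pos_values_gt0 _ _ _ h); exact: mem_nth.
have mu_level_fin i : (mu (level i) < +oo)%E by exact: mu_level.
transitivity (\int[P]_w (\prod_(i < size s) expN ((s`_i)%:E * N w (level i)))%:E)%E.
  apply: eq_integral => w _; rewrite (@integral_nnsfun_comp _ _ _ _ h idfun)//.
  rewrite (big_nth 0) big_mkord expN_sum// => i.
  by rewrite mule_ge0// lee_fin ltW//; exact: s_gt0.
pose Z (i : 'I_(size s)) := expR (- ((1 - expR (- s`_i)) * fine (mu (level i)))).
rewrite (PPP_indep_counts PPP _ mlevel mu_level_fin _
  (g := fun i y => expN ((s`_i)%:E * y)) (Z := Z))//.
- rewrite (integral_nnsfun_comp _ h (phi := fun r => 1 - expN r%:E)); last 2 first.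
  + by rewrite expN_EFin oppr0 expR0 subrr.
  + by move=> r r0; apply: laplace_weight_ge0; rewrite lee_fin.
  rewrite (big_nth 0) big_mkord expN_sum => [|i]; last first.
    by rewrite mule_ge0// lee_fin laplace_weight_ge0// lee_fin ltW.
  congr EFin; apply: eq_bigr => i _.
  by rewrite -[in RHS](@fineK _ (mu _)) ?ge0_fin_numE//; exact: mu_level_fin.
- move=> i j ij; apply/seteqP; split => // z [/= hi hj].
  move: ij; rewrite -val_eqE/= -(nth_uniq 0 (ltn_ord i) (ltn_ord j) (uniq_pos_values h)).
  by rewrite -hi -hj eqxx.
- move=> i; apply: measurableT_comp; first exact: measurable_expN.
  by apply: emeasurable_funM => //; exact: measurable_id.
- by move=> i y; exact: expN_ge0.
- by move=> i; rewrite pois_laplace// fine_ge0.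
Qed.

Lemma measurable_integral_PPP (f : pt -> \bar R) :
  measurable_fun setT f -> (forall z, 0 <= f z)%E ->
  measurable_fun setT (fun w => \int[N w]_z f z)%E.
Proof.
by move=> mf f0; apply: measurable_fun_integral_kernel => //; exact: PPP.1.
Qed.

Section Approximation.
Variables (f : pt -> \bar R) (mf : measurable_fun setT f) (f_ge0 : forall z, (0 <= f z)%E).
Variables (D : (set pt)^nat) (mD : forall n, measurable (D n))
  (D_fin : forall n, (mu (D n) < +oo)%E) (D_nd : nondecreasing_seq D)
  (D_cover : \bigcup_n D n = setT).

Let approx n : {nnsfun pt >-> R} := proj_nnsfun (nnsfun_approx measurableT mf n) (mD n).

Let approxE n z : approx n z = nnsfun_approx measurableT mf n z * \1_(D n) z.
Proof. by []. Qed.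

Let nd_approx z : nondecreasing_seq (approx ^~ z).
Proof.
move=> n m nm; rewrite !approxE; apply: ler_pM => //.
  exact/lefP/nd_nnsfun_approx.
rewrite !indicE; have [Dz|_] := boolP (z \in D n); last by rewrite ler0n.
by rewrite mem_set//; move/subsetPset: (D_nd nm); apply; rewrite inE in Dz.
Qed.

Let cvg_approx z : (approx n z)%:E @[n --> \oo] --> f z.
Proof.
have [n0 _ Dz] : (\bigcup_n D n) z by rewrite D_cover.
apply: (@cvg_trans _ ((nnsfun_approx measurableT mf n z)%:E @[n --> \oo])).
  apply: near_eq_cvg; near=> n; rewrite approxE indicE mem_set ?mulr1//.
  have /subsetPset : (D n0 <= D n)%O by apply: D_nd; near: n; exact: nbhs_infty_ge.
  exact.
exact: cvg_nnsfun_approx.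
Unshelve. all: by end_near. Qed.

Let approx_level_fin n r : 0 < r -> (mu (approx n @^-1` [set r]) < +oo)%E.
Proof.
move=> r0; apply: le_lt_trans (D_fin n); apply: le_measure; rewrite ?inE//.
move=> z; change (approx n z = r -> D n z); rewrite approxE indicE.
have [|_] := boolP (z \in D n); first by rewrite inE.
by rewrite mulr0 => r_eq; rewrite -r_eq ltxx in r0.
Qed.

Let cvg_integral_approx (m : {measure set pt -> \bar R}) :
  (\int[m]_z (approx n z)%:E @[n --> \oo] --> \int[m]_z f z)%E.
Proof.
rewrite [X in _ --> X](_ : _ = \int[m]_z (limn (fun n => (approx n z)%:E)))%E; last first.
  by apply: eq_integral => z _; apply/esym/cvg_lim.
apply: cvg_monotone_convergence => //.
- by move=> n; exact/measurable_EFinP.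
- by move=> n z _; rewrite lee_fin.
- by move=> z _ i j ij; rewrite lee_fin; exact: nd_approx.
Qed.

Let cvg_exponent_approx :
  (\int[mu]_z (1 - expN (approx n z)%:E)%:E @[n --> \oo] --> \int[mu]_z (1 - expN (f z))%:E)%E.
Proof.
have cvg_weight z : (1 - expN (approx n z)%:E)%:E @[n --> \oo] --> (1 - expN (f z))%:E.
  apply: cvg_EFin; first exact: nearW.
  apply: cvgB; first exact: cvg_cst.
  by apply: cvg_expN => // n; rewrite lee_fin.
rewrite [X in _ --> X](_ : _ =
    \int[mu]_z (limn (fun n => (1 - expN (approx n z)%:E)%:E)))%E; last first.
  by apply: eq_integral => z _; apply/esym/cvg_lim.
apply: cvg_monotone_convergence => //.
- move=> n; apply/measurable_EFinP; apply: measurable_funB => //.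
  by apply: (measurableT_comp measurable_expN); exact/measurable_EFinP.
- by move=> n z _; rewrite lee_fin laplace_weight_ge0// lee_fin.
- move=> z _ i j ij; rewrite lee_fin lerD2l lerN2 expN_nincr ?lee_fin//.
  exact: nd_approx.
Qed.

Let cvg_laplace_approx :
  (\int[P]_w (expN (\int[N w]_z (approx n z)%:E))%:E @[n --> \oo] -->
   \int[P]_w (expN (\int[N w]_z f z))%:E)%E.
Proof.
have measurable_laplace (g : pt -> \bar R) : measurable_fun setT g -> (forall z, 0 <= g z)%E ->
    measurable_fun setT (fun w => (expN (\int[N w]_z g z))%:E).
  move=> mg g0; apply/measurable_EFinP; apply: (measurableT_comp measurable_expN).
  exact: measurable_integral_PPP.
have approx_ge0 n w : (0 <= \int[N w]_z (approx n z)%:E)%E.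
  by apply: integral_ge0 => z _; rewrite lee_fin.
have [] := @dominated_convergence _ _ _ P setT measurableT
  (fun n w => (expN (\int[N w]_z (approx n z)%:E))%:E)%E
  (fun w => (expN (\int[N w]_z f z))%:E)%E (cst 1%E) => //.
- by move=> n; apply: measurable_laplace => [|z]; [exact/measurable_EFinP|rewrite lee_fin].
- exact: measurable_laplace.
- by apply: aeW => w _; apply: cvg_EFin; [exact: nearW|exact: cvg_expN].
- exact: (finite_measure_integrable_cst P 1%R).
- by apply: aeW => w n _; rewrite gee0_abs lee_fin ?expN_ge0 ?expN_le1.
Qed.

Lemma PPP_laplace_cover : (\int[P]_w (expN (\int[N w]_z f z))%:E =
  (expN (\int[mu]_z (1 - expN (f z))%:E))%:E)%E.
Proof.
apply: cvg_unique cvg_laplace_approx _ => //.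
rewrite (funext (fun n => PPP_laplace_nnsfun (@approx_level_fin n))).
apply: cvg_EFin; first exact: nearW.
apply: cvg_expN cvg_exponent_approx => n; apply: integral_ge0 => z _.
by rewrite lee_fin laplace_weight_ge0// lee_fin.
Qed.

End Approximation.

Theorem PPP_laplace (f : pt -> \bar R) :
  measurable_fun setT f -> (forall z, 0 <= f z)%E ->
  (\int[P]_w (expN (\int[N w]_z f z))%:E =
   (expN (\int[mu]_z (1 - expN (f z))%:E))%:E)%E.
Proof.
move=> mf f0; have /sigma_finiteP[D [D_cover D_nd D_fin]] := mu_sigma_finite.
apply: (@PPP_laplace_cover f mf f0 D) => // [n|n]; by have [] := D_fin n.
Qed.

End LaplaceFunctional.

(** * Integrals by primitives and in polar coordinates *)

Section IntegralOfDerivative.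
Context {R : realType}.
Local Notation leb := (@lebesgue_measure R).
Implicit Types f F : R -> R.

Lemma is_derive1_continuous F (x df : R) : is_derive x 1 F df -> {for x, continuous F}.
Proof. by move=> [dF _]; exact/differentiable_continuous/derivable1_diffP. Qed.

Lemma integral_is_derive f F (a b : R) : a < b ->
  (forall x, a <= x <= b -> is_derive x 1 F (f x)) ->
  (forall x, a <= x <= b -> {for x, continuous f}) ->
  (\int[leb]_(x in `[a, b]) (f x)%:E = (F b - F a)%:E)%E.
Proof.
move=> ab dF cf; have leab := ltW ab.
rewrite EFinB (@continuous_FTC2 _ f F)//.
- by apply: continuous_in_subspaceT => x; rewrite inE/= in_itv/=; exact: cf.
- split.
  + by move=> x /[!in_itv]/= /andP[/ltW ax /ltW xb]; have [] := dF x _; rewrite ?ax.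
  + apply: cvg_at_right_filter; apply: (is_derive1_continuous (dF a _)).
    by rewrite lexx.
  + apply: cvg_at_left_filter; apply: (is_derive1_continuous (dF b _)).
    by rewrite leab lexx.
- move=> x /[!in_itv]/= /andP[/ltW ax /ltW xb]; rewrite derive1E.
  by have [|_ ->] := dF x _; rewrite ?ax.
Qed.

Lemma ge0_integral_is_derivey f F (a l : R) :
  (forall x, a <= x -> 0 <= f x) ->
  (forall x, a <= x -> is_derive x 1 F (f x)) ->
  (forall x, a <= x -> {for x, continuous f}) ->
  F x @[x --> +oo] --> l ->
  (\int[leb]_(x in `[a, +oo[) (f x)%:E = (l - F a)%:E)%E.
Proof.
move=> f0 dF cf Fl; rewrite EFinB; apply: ge0_continuous_FTC2y => //.
- by apply: continuous_in_subspaceT => x; rewrite inE/= in_itv/= andbT; exact: cf.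
- by move=> x /ltW/dF[].
- exact: cvg_at_right_filter (is_derive1_continuous (dF a (lexx a))).
- move=> x; rewrite in_itv/= andbT => /ltW/dF[_ <-].
  by rewrite derive1E.
Qed.

Lemma is_derive_exprn f (n : nat) (x df : R) :
  is_derive x 1 f df -> is_derive x 1 (fun u => f u ^+ n.+1) (n.+1%:R * f x ^+ n * df).
Proof. by move=> df_x; have := @is_deriveX _ _ f n.+1 x 1 df df_x; rewrite exprfctE. Qed.

End IntegralOfDerivative.

Section DiskArea.
Context {R : realType}.
Local Notation leb := (@lebesgue_measure R).

Lemma integral_cos2 (c : R) :
  (\int[leb]_(t in `[(- (pi / 2))%R, (pi / 2)%R]) (2 * c * cos t ^+ 2)%:E = (pi * c)%:E)%E.
Proof.
pose F (t : R) := c * (t + sin t * cos t).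
have dF (t : R) : is_derive t 1 F (2 * c * cos t ^+ 2).
  apply: is_derive_eq; rewrite /GRing.scale/=.
  have -> : 2 * c * cos t ^+ 2 = c * (1 + cos t ^+ 2 - sin t ^+ 2).
    have -> : sin t ^+ 2 = 1 - cos t ^+ 2 by rewrite -(cos2Dsin2 t) addrC addKr.
    by ring.
  by ring.
rewrite (@integral_is_derive _ _ F)//.
- by rewrite /F sinN cosN cos_pihalf; congr EFin; field.
- by rewrite -subr_gt0 opprK -splitr pi_gt0.
- by move=> t _; apply: is_derive1_continuous; apply: ex_derive.
Qed.

(* The substitution y = sqrt u sin t. *)
Lemma integral_semicircle (u : R) : 0 < u ->
  (\int[leb]_(y in `[(- Num.sqrt u)%R, (Num.sqrt u)%R]) (2 * Num.sqrt (u - y ^+ 2))%:E =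
   (pi * u)%:E)%E.
Proof.
move=> u0; set r := Num.sqrt u.
have r0 : 0 < r by rewrite sqrtr_gt0.
have r2 : r ^+ 2 = u by rewrite sqr_sqrtr// ltW.
pose F (t : R) := r * sin t.
have dF (t : R) : is_derive t 1 F (r * cos t).
  by apply: is_derive_eq; rewrite /GRing.scale/=; ring.
have F1 : F^`()%classic = (fun t => r * cos t).
  by apply/funext => t; rewrite derive1E; have [_ ->] := dF t.
have cF t : {for t, continuous F} by exact: is_derive1_continuous (dF t).
have cF1 : continuous (fun t => r * cos t).
  by move=> t; apply: is_derive1_continuous; apply: ex_derive.
have -> : - r = F (- (pi / 2)) by rewrite /F sinN sin_pihalf mulrN1.
have -> : r = F (pi / 2) by rewrite /F sin_pihalf mulr1.
rewrite integration_by_substitution_increasing.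
- rewrite -integral_cos2; apply: eq_integral => t; rewrite inE/= in_itv/= => t_itv.
  rewrite F1; congr EFin.
  change (2 * Num.sqrt (u - (r * sin t) ^+ 2) * (r * cos t) = 2 * u * cos t ^+ 2).
  have -> : u - (r * sin t) ^+ 2 = u * cos t ^+ 2.
    by rewrite exprMn r2; have := cos2Dsin2 t; nra.
  rewrite sqrtrM ?ltW// sqrtr_sqr ger0_norm ?cos_ge0_pihalf// -/r -r2.
  by ring.
- by rewrite -subr_ge0 opprK -splitr pi_ge0.
- by move=> x y x_itv y_itv xy; rewrite /F ltr_pM2l// ltr_sin.
- by rewrite F1 => t _; exact: cF1.
- by rewrite F1; apply/cvg_ex; eexists; apply: cvg_at_right_filter; exact: cF1.
- by rewrite F1; apply/cvg_ex; eexists; apply: cvg_at_left_filter; exact: cF1.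
- split=> [t _||]; first by have [] := dF t.
    exact: cvg_at_right_filter (cF _).
  exact: cvg_at_left_filter (cF _).
- apply: continuous_subspaceT => y; apply: cvgM; first exact: cvg_cst.
  apply: (@cvg_comp _ _ _ (fun y => u - y ^+ 2) Num.sqrt _ (nbhs (u - y ^+ 2))).
    by apply: cvgB; [exact: cvg_cst|exact: exprn_continuous].
  exact: sqrt_continuous.
Qed.

Definition sqnorm2 (p : R * R) : R := p.1 ^+ 2 + p.2 ^+ 2.

Lemma sqnorm2_ge0 p : 0 <= sqnorm2 p.
Proof. by rewrite addr_ge0 ?sqr_ge0. Qed.

Lemma measurable_sqnorm2 : measurable_fun setT sqnorm2.
Proof.
by apply: measurable_funD; apply: measurable_funX;
  [exact: measurable_fst|exact: measurable_snd].
Qed.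

Lemma disk_area (u : R) :
  (leb \x leb)%E [set p | sqnorm2 p < u] = (pi * Num.max u 0)%:E.
Proof.
have xsection_disk a :
    leb (xsection [set p | sqnorm2 p < u] a) = (2 * Num.sqrt (u - a ^+ 2))%:E.
  have in_disk b : (sqnorm2 (a, b) < u) = (`|b| < Num.sqrt (u - a ^+ 2)).
    rewrite -sqrtr_sqr /sqnorm2/=; have [ua|ua] := ltP 0 (u - a ^+ 2).
      by rewrite ltr_sqrt// addrC ltrBrDr.
    by rewrite (ler0_sqrtr ua) [RHS]ltNge sqrtr_ge0; apply/negbTE; have := sqr_ge0 b; lra.
  rewrite (_ : xsection _ _ = `](- Num.sqrt (u - a ^+ 2)), (Num.sqrt (u - a ^+ 2))[%classic).
    rewrite lebesgue_measure_itv/= lte_fin; case: ltP => [_|].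
      by rewrite -EFinB; congr EFin; ring.
    by have := sqrtr_ge0 (u - a ^+ 2); move=> s0 sN; congr EFin; lra.
  by apply/seteqP; split => b; rewrite /xsection/= inE/= in_itv/= -ltr_norml in_disk.
rewrite /product_measure1/=; under eq_integral do rewrite xsection_disk.
have [u0|u0] := ltP 0 u; last first.
  rewrite mulr0; apply: integral0_eq => a _.
  by rewrite ler0_sqrtr ?mulr0//; have := sqr_ge0 a; lra.
rewrite -integral_semicircle// [RHS]integral_mkcond.
apply: eq_integral => a _; rewrite patchE; case: ifPn => //.
rewrite notin_setE/= in_itv/= -ler_norml => /negP; rewrite -ltNge => sqrt_lt.
rewrite ler0_sqrtr ?mulr0// subr_le0 -(real_normK (num_real a)).
by rewrite -[leLHS](sqr_sqrtr (ltW u0)) lerXn2r ?nnegrE ?sqrtr_ge0 ?normr_ge0 ?ltW.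
Qed.

Lemma integral_radial (g : R -> \bar R) :
  measurable_fun setT g -> (forall u, 0 <= g u)%E ->
  (\int[leb \x leb]_p g (sqnorm2 p) = pi%:E * \int[leb]_(u in `]0%R, +oo[) g u)%E.
Proof.
move=> mg g0.
exact: (integral_pos_rays (m := (leb \x leb)%E) (pi_ge0 R) measurable_sqnorm2 disk_area).
Qed.

Lemma integral_sqr_subst (g : R -> \bar R) : measurable_fun setT g -> (forall u, 0 <= g u)%E ->
  (\int[leb]_x (g (x ^+ 2)%R * (2 * Num.max x 0)%:E) = \int[leb]_(u in `]0%R, +oo[) g u)%E.
Proof.
move=> mg g0; pose weight (x : measurableTypeR R) : R := 2 * Num.max x 0.
have weight_ge0 x : 0 <= weight x by rewrite mulr_ge0// le_max lexx orbT.
have mweight : measurable_fun setT weight.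
  by apply: measurable_funM => //; exact: measurable_maxr.
have msqr : measurable_fun setT (fun x : measurableTypeR R => x ^+ 2 : measurableTypeR R).
  exact: (@measurable_funX _ (measurableTypeR R) R setT idfun 2 (@measurable_id _ _ _)).
rewrite -(@ge0_integral_mdensity _ _ _ leb weight mweight weight_ge0
  (fun x => g (x ^+ 2)))//; last first.
  exact: measurableT_comp msqr.
rewrite (integral_pos_rays (m := mdensity leb mweight weight_ge0) ler01 msqr)// ?mul1e//.
have d_sqr (x : R) : is_derive x 1 (fun x : R => x ^+ 2) (2 * x).
  by have := is_derive_exprn 1 (is_derive_id x 1); rewrite mulr1.
have lt_sqr (x u : R) : 0 < x -> (x < Num.sqrt u) = (x ^+ 2 < u).
  move=> x0; rewrite -{1}(gtr0_norm x0) -sqrtr_sqr; have [u0|u0] := ltP 0 u.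
    by rewrite ltr_sqrt.
  by rewrite (ler0_sqrtr u0) ltNge sqrtr_ge0 ltNge (le_trans u0) ?sqr_ge0.
have c_double : continuous (fun x : R => 2 * x) by move=> x; apply: cvgMr; exact: cvg_id.
move=> u; rewrite mul1r.
transitivity (\int[leb]_(x in `[0%R, (Num.sqrt u)%R[) (2 * x)%:E)%E.
  rewrite [LHS]integral_mkcond [RHS]integral_mkcond; apply: eq_integral => x _.
  rewrite !patchE /weight.
  have -> : (x \in [set x : measurableTypeR R | x ^+ 2 < u]) = (x ^+ 2 < u).
    by apply/idP/idP; rewrite inE.
  have -> : (x \in `[0, (Num.sqrt u)[%classic) = (0 <= x < Num.sqrt u).
    by apply/idP/idP; rewrite inE/= in_itv.
  have [x0|x0] := leP x 0.
    rewrite mulr0 if_same; case: ifP => // /andP[x0' _].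
    by rewrite (le_anti (x := x) (y := 0)) ?x0// mulr0.
  by rewrite ltW//= lt_sqr// (max_l (ltW x0)).
have [u0|u0] := ltP 0 u; last first.
  by rewrite ler0_sqrtr// set_itv_ge ?bnd_simp ?ltxx// integral_set0.
rewrite integral_itv_bndo_bndc; last first.
  by apply/measurable_EFinP; apply: measurable_funTS; exact: continuous_measurable_fun.
rewrite (integral_is_derive _ (fun x _ => d_sqr x) (fun x _ => c_double x)) ?sqrtr_gt0//.
by rewrite sqr_sqrtr ?ltW// expr0n subr0.
Qed.

Lemma integral_sqr_subst_Ioc0 (g : R -> \bar R) (r : R) : 0 <= r ->
  measurable_fun (Ioc0 (r ^+ 2)) g -> (forall u, Ioc0 (r ^+ 2) u -> (0 <= g u)%E) ->
  (\int[leb]_(x in Ioc0 r) (g (x ^+ 2)%R * (2 * x)%:E) = \int[leb]_(u in Ioc0 (r ^+ 2)) g u)%E.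
Proof.
move=> r0 mg g0; pose h := g \_ (Ioc0 (r ^+ 2)).
have mh : measurable_fun setT h by apply/(measurable_restrictT g (measurable_itv _)).
have h0 u : (0 <= h u)%E by exact: erestrict_ge0.
transitivity (\int[leb]_(u in `]0%R, +oo[) h u)%E; last first.
  rewrite [LHS]integral_mkcond [RHS]integral_mkcond; apply: eq_integral => u _.
  rewrite /h !patchE !mem_setE !in_itv/= andbT.
  by case: ltP.
rewrite -integral_sqr_subst// integral_mkcond; apply: eq_integral => x _.
rewrite /h !patchE !mem_setE !in_itv/=; have [x0|x0] := ltP 0 x; last by rewrite mulr0 mule0.
by rewrite exprn_gt0// ler_pXn2r ?nnegrE ?(ltW x0)//; case: ifP => _; rewrite ?mul0e.
Qed.

Lemma exp1_densE : @exp1_dens R = exponential_pdf 1.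
Proof.
apply/funext => v; rewrite /exp1_dens; case: leP => [v0|v0]; last by rewrite lt0_exponential_pdf.
by rewrite exponential_pdfE// mul1r mulN1r.
Qed.

Lemma integral_exp1_complement (y : R) : 0 <= y ->
  (\int[leb]_v ((1 - expR (- (v * y))) * exp1_dens v)%:E = (y / (1 + y))%:E)%E.
Proof.
move=> y0; have y1 : 0 < 1 + y by rewrite ltr_pwDl.
have y1_ge0 := ltW y1.
have densE v : (1 - expR (- (v * y))) * exp1_dens v =
    exponential_pdf 1 v - (1 + y)^-1 * exponential_pdf (1 + y) v.
  rewrite exp1_densE; have [v0|v0] := leP 0 v; last first.
    by rewrite !lt0_exponential_pdf// !mulr0 subrr.
  rewrite !exponential_pdfE// !mul1r mulKf ?gt_eqF// mulrBl mul1r -expRD.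
  by congr (_ - expR _); ring.
under eq_integral do rewrite densE EFinB EFinM.
have int_pdf rate : 0 < rate -> leb.-integrable setT (EFin \o exponential_pdf rate).
  by move=> rate0; exact: integrable_exponential_pdf.
rewrite integralB//; [|exact: int_pdf|]; last first.
  by apply: integrableZl => //; exact: int_pdf.
rewrite integralZl//; last exact: int_pdf.
rewrite !integral_exponential_pdf// mule1 -EFinB; congr EFin.
by field; rewrite gt_eqF.
Qed.

End DiskArea.

(** * Hypergeometric integrals *)

Section RisingFactorial.
Context {R : realType}.
Implicit Types a b : R.

Lemma rising0 a : rising a 0 = 1.
Proof. by rewrite /rising big_ord0. Qed.

Lemma risingS a n : rising a n.+1 = rising a n * (a + n%:R).
Proof. by rewrite /rising big_ord_recr. Qed.

Lemma risingSl a n : rising a n.+1 = a * rising (a + 1) n.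
Proof.
rewrite /rising big_ord_recl addr0; congr (_ * _); apply: eq_bigr => i _.
by rewrite /= /bump/= add1n -natr1 addrAC addrA.
Qed.

Lemma rising1 n : rising 1 n = n`!%:R :> R.
Proof.
elim: n => [|n IH]; first by rewrite rising0.
by rewrite risingS IH factS natrM mulrC nat1r.
Qed.

Lemma rising_gt0 a n : 0 < a -> 0 < rising a n.
Proof. by move=> a0; apply: prodr_gt0 => i _; rewrite ltr_wpDr. Qed.

Lemma rising_ge0 a n : 0 <= a -> 0 <= rising a n.
Proof. by move=> a0; apply: prodr_ge0 => i _; rewrite addr_ge0. Qed.

Lemma rising_succ_ratio a n : 0 < a -> rising a n / rising (a + 1) n = a / (a + n%:R).
Proof.
move=> a0; have a1 : rising (a + 1) n != 0 by rewrite gt_eqF// rising_gt0// addr_gt0.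
have an : a + n%:R != 0 by rewrite gt_eqF// ltr_wpDr.
by apply/eqP; rewrite eqr_div// -risingS risingSl.
Qed.

Lemma cvg0_ratio (u t : nat -> R) (w : R) :
  (forall n, 0 <= u n) -> (forall n, u n.+1 = u n * t n) -> (forall n, 0 <= t n) ->
  t @ \oo --> w -> w < 1 -> u @ \oo --> 0.
Proof.
move=> u0 ut t0 tw w1; pose r := (w + 1) / 2.
have wr : w < r by rewrite /r; lra.
have r1 : r < 1 by rewrite /r; lra.
have w0 : 0 <= w by apply: (cvgr_to_ge tw); exact: nearW.
have [N _ t_le] : \forall n \near \oo, t n <= r by apply: (cvgr_le w).
have u_le k : u (k + N)%N <= u N * r ^+ k.
  elim: k => [|k IH]; first by rewrite mulr1.
  rewrite addSn ut exprSr mulrA; apply: ler_pM => //.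
  by apply: t_le; rewrite /=; lia.
rewrite -(cvg_shiftn N).
apply: (squeeze_cvgr (f := fun=> 0) (h := fun k => u N * r ^+ k)).
- by apply: nearW => k; rewrite u0 u_le.
- exact: cvg_cst.
- by apply: cvg_geometric; rewrite ger0_norm; lra.
Qed.

Lemma cvg_shift_ratio a b : 0 < b -> (a + n%:R) / (b + n%:R) @[n --> \oo] --> (1 : R).
Proof.
move=> b0.
have cvg_diff : (a - b) * (b + n%:R)^-1 @[n --> \oo] --> (a - b) * 0.
  apply: cvgMr; apply/gtr0_cvgV0; first by apply: nearW => n; rewrite ltr_wpDr.
  apply/cvgryPge => A; near=> n; rewrite addrC -lerBlDr.
  by near: n; exact: nbhs_infty_ger.
have -> : (fun n : nat => (a + n%:R) / (b + n%:R)) = (fun n => 1 + (a - b) * (b + n%:R)^-1).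
  by apply/funext => n; field; rewrite gt_eqF// ltr_wpDr.
rewrite -[X in _ --> X](_ : 1 + (a - b) * 0 = 1); last by rewrite mulr0 addr0.
exact: (cvgD (cvg_cst (1 : R)) cvg_diff).
Unshelve. all: by end_near. Qed.

Lemma cvg_rising_geometric a b (w : R) : 0 <= a -> 0 < b -> 0 <= w < 1 ->
  rising a n / rising b n * w ^+ n @[n --> \oo] --> 0.
Proof.
move=> a0 b0 /andP[w0 w1].
apply: (cvg0_ratio (t := fun n => (a + n%:R) / (b + n%:R) * w) (w := w)) => //.
- by move=> n; rewrite mulr_ge0 ?exprn_ge0// divr_ge0 ?rising_ge0// ltW.
- move=> n; rewrite !risingS exprSr.
  have bn : b + n%:R != 0 by rewrite gt_eqF// ltr_wpDr.
  by field; rewrite bn gt_eqF// rising_gt0.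
- by move=> n; rewrite mulr_ge0// divr_ge0// addr_ge0// ltW.
- by rewrite -[X in _ --> X]mul1r; apply: cvgMl; exact: cvg_shift_ratio.
Qed.

Lemma hyp2F1_series_eq (a b c z l C : R) (S : nat -> R) : C != 0 ->
  (forall n, C * (rising a n * rising b n / (rising c n * n`!%:R) * z ^+ n) = S n) ->
  series S @ \oo --> l -> C * hyp2F1_series a b c z = l.
Proof.
move=> C0 SE cvg_S; apply: (mulfI (x := C^-1)); first by rewrite invr_eq0.
rewrite mulKf//; apply/cvg_lim => //.
rewrite (_ : series _ = fun n => C^-1 * series S n); first exact: cvgMr.
apply/funext => n; rewrite /series/= mulr_sumr; apply: eq_bigr => m _.
by rewrite -SE mulKf.
Qed.

End RisingFactorial.

Section DominatedPrimitive.
Context {R : realType}.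
Local Notation leb := (@lebesgue_measure R).
Implicit Types f F g G : R -> R.

Lemma continuous_half_line_measurable f (a : R) : (forall x, a <= x -> {for x, continuous f}) ->
  measurable_fun `[a, +oo[ f.
Proof.
move=> cf; apply: subspace_continuous_measurable_fun => //.
by apply: continuous_in_subspaceT => x; rewrite inE/= in_itv/= andbT; exact: cf.
Qed.

Lemma ge0_integrable_is_derivey f F (a l : R) :
  (forall x, a <= x -> 0 <= f x) ->
  (forall x, a <= x -> is_derive x 1 F (f x)) ->
  (forall x, a <= x -> {for x, continuous f}) ->
  F x @[x --> +oo] --> l -> leb.-integrable `[a, +oo[ (EFin \o f).
Proof.
move=> f0 dF cf Fl; apply/integrableP; split.
  by apply/measurable_EFinP; exact: continuous_half_line_measurable.
have -> : (\int[leb]_(x in `[a, +oo[) `|(EFin \o f) x| =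
    \int[leb]_(x in `[a, +oo[) (f x)%:E)%E.
  apply: eq_integral.
  by move=> x; rewrite inE/= in_itv/= andbT => ax; rewrite /= ger0_norm ?f0.
by rewrite (ge0_integral_is_derivey f0 dF cf Fl) ltry.
Qed.

(* The signed integrand is made nonnegative by adding its bound g. *)
Lemma Rintegral_is_derivey f F g G (a l m : R) :
  (forall x, a <= x -> `|f x| <= g x) ->
  (forall x, a <= x -> is_derive x 1 F (f x)) ->
  (forall x, a <= x -> is_derive x 1 G (g x)) ->
  (forall x, a <= x -> {for x, continuous f}) ->
  (forall x, a <= x -> {for x, continuous g}) ->
  F x @[x --> +oo] --> l -> G x @[x --> +oo] --> m ->
  \int[leb]_(x in `[a, +oo[) f x = l - F a.
Proof.
move=> fg dF dG cf cg Fl Gm.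
have g0 x : a <= x -> 0 <= g x by move=> /fg; apply: le_trans.
have fDg0 x : a <= x -> 0 <= f x + g x.
  by move=> /fg; rewrite ler_norml -subr_ge0 opprK => /andP[].
have dFG x : a <= x -> is_derive x 1 (fun u => F u + G u) (f x + g x).
  by move=> ax; exact: is_deriveD (dF x ax) (dG x ax).
have cfDg x : a <= x -> {for x, continuous (fun u => f u + g u)}.
  by move=> ax; apply: cvgD; [exact: cf|exact: cg].
have FGlm : F x + G x @[x --> +oo] --> l + m by exact: cvgD.
rewrite (_ : f = fun x => (f x + g x) - g x); last by apply/funext => x; rewrite addrK.
rewrite RintegralB//.
- rewrite /Rintegral (ge0_integral_is_derivey fDg0 dFG cfDg FGlm).
  by rewrite (ge0_integral_is_derivey g0 dG cg Gm)/=; ring.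
- exact: ge0_integrable_is_derivey fDg0 dFG cfDg FGlm.
- exact: ge0_integrable_is_derivey g0 dG cg Gm.
Qed.

Lemma cvg_powRN (a : R) : 0 < a -> u `^ (- a) @[u --> +oo] --> (0 : R).
Proof.
move=> a0; apply/cvgrPdist_le => e e0; near=> u.
have u0 : 0 < u by near: u; exact: nbhs_pinfty_gt.
rewrite sub0r normrN ger0_norm ?powR_ge0// powRN.
rewrite -[leRHS]invrK lef_pV2 ?posrE ?invr_gt0 ?powR_gt0//.
have e_le : (e^-1) `^ (a^-1) <= u by near: u; apply: nbhs_pinfty_ge; exact: num_real.
rewrite -[leLHS]powRr1 ?invr_ge0 ?(ltW e0)// -(mulVf (lt0r_neq0 a0)) powRrM.
by apply: ge0_ler_powR; rewrite ?nnegrE ?powR_ge0 ?(ltW a0) ?(ltW u0).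
Unshelve. all: by end_near. Qed.

End DominatedPrimitive.

Section DecayIntegral.
Context {R : realType}.
Local Notation leb := (@lebesgue_measure R).

Definition decay (al kap u : R) : R := kap * u `^ (- (al / 2)).

Definition decay_ratio (al kap : R) (p q : nat) (u : R) : R :=
  decay al kap u ^+ p / (1 + decay al kap u) ^+ q.

Definition decay_int (al kap u0 : R) (p q : nat) : R :=
  \int[leb]_(u in `[u0, +oo[) decay_ratio al kap p q u.

Variables (al kap u0 : R).
Hypotheses (al_gt2 : 2 < al) (kap_gt0 : 0 < kap) (u0_gt0 : 0 < u0).

Local Notation de := (2 / al).
Local Notation y := (decay al kap).
Local Notation ratio := (decay_ratio al kap).
Local Notation J := (decay_int al kap u0).
Local Notation tau := (decay al kap u0).
Local Notation w := (tau / (1 + tau)).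

Let al_gt0 : 0 < al. Proof. exact: lt_trans al_gt2. Qed.

Let de_gt0 : 0 < de. Proof. by rewrite divr_gt0. Qed.

Let natrB_de_gt0 p : 0 < p.+1%:R - de.
Proof. by rewrite subr_gt0 (lt_le_trans (y := 1)) ?ler1n// ltr_pdivrMr// mul1r. Qed.

Lemma decay_ge0 u : 0 <= y u.
Proof. by rewrite mulr_ge0 ?powR_ge0// ltW. Qed.

Lemma decay_gt0 u : 0 < u -> 0 < y u.
Proof. by move=> u1; rewrite mulr_gt0// powR_gt0. Qed.

Let decay1_gt0 u : 0 < 1 + y u.
Proof. by rewrite ltr_pwDl// decay_ge0. Qed.

Lemma decay_nincr u v : 0 < u -> u <= v -> y v <= y u.
Proof.
move=> u_gt0 uv; have v_gt0 := lt_le_trans u_gt0 uv.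
rewrite /decay ler_pM2l// !powRN lef_pV2 ?posrE ?powR_gt0//.
by apply: ge0_ler_powR; rewrite ?nnegrE ?divr_ge0// ltW.
Qed.

Lemma decay_ratio_ge0 p q u : 0 <= ratio p q u.
Proof. by rewrite divr_ge0// exprn_ge0 ?decay_ge0// ltW. Qed.

Lemma decay_ratio_le p q u : ratio p q u <= y u ^+ p.
Proof.
rewrite ler_pdivrMr ?exprn_gt0// ler_peMr ?exprn_ge0 ?decay_ge0//.
by rewrite exprn_ege1// lerDl decay_ge0.
Qed.

Lemma measurable_decay : measurable_fun setT y.
Proof. by apply: measurable_funM => //; exact: measurable_powR. Qed.

Lemma measurable_decay_ratio p q : measurable_fun setT (ratio p q).
Proof.
apply: measurable_funM; first by apply: measurable_funX; exact: measurable_decay.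
rewrite (_ : (fun u => _) = (fun u => (1 + y u) `^ (- q%:R))).
  apply: (measurableT_comp (measurable_powR _)).
  by apply: measurable_funD => //; exact: measurable_decay.
by apply/funext => u; rewrite powR_invn// ltW.
Qed.

Let is_derive_decay (u : R) : 0 < u -> is_derive u 1 y (- (al / 2) * y u / u).
Proof.
move=> u_gt0; have dpow := is_derive1_powR (- (al / 2)) u_gt0.
apply: is_derive_eq; rewrite /GRing.scale/= /decay powRD ?(gt_eqF u_gt0) ?implybT//.
by rewrite powR_inv1 ?ltW//; ring.
Qed.

Let continuous_decay_pow p (u : R) : 0 < u -> {for u, continuous (fun v => y v ^+ p)}.
Proof.
move=> u_gt0; case: p => [|p]; first exact: cst_continuous.
exact: is_derive1_continuous (is_derive_exprn p (is_derive_decay u_gt0)).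
Qed.

Let continuous_decay_ratio p q (u : R) : 0 < u -> {for u, continuous (ratio p q)}.
Proof.
move=> u_gt0; apply: continuousM; first exact: continuous_decay_pow.
apply: continuousV; first by rewrite expf_neq0// gt_eqF.
apply: (@continuous_comp _ _ _ (fun v => 1 + y v) (fun x => x ^+ q)).
  apply: continuousD; first exact: cst_continuous.
  exact: is_derive1_continuous (is_derive_decay u_gt0).
exact: exprn_continuous.
Qed.

Let pow_primitive p (u : R) := - (u * y u ^+ p.+1) / ((al / 2) * p.+1%:R - 1).

Let pow_primitive_coef_gt0 p : 0 < (al / 2) * p.+1%:R - 1.
Proof.
have p1 : 1 <= p.+1%:R :> R by rewrite ler1n.
by have := al_gt2; nra.
Qed.

Let is_derive_pow_primitive p (u : R) : 0 < u -> is_derive u 1 (pow_primitive p) (y u ^+ p.+1).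
Proof.
move=> u_gt0; have dpow := is_derive_exprn p (is_derive_decay u_gt0).
have := pow_primitive_coef_gt0 p.
rewrite /pow_primitive; move: (p.+1%:R) dpow => r dpow coef_gt0.
have coef_neq0 : al * r - 2 != 0 by rewrite gt_eqF//; lra.
apply: is_derive_eq; rewrite /GRing.scale/= exprS.
by field; rewrite coef_neq0 gt_eqF.
Qed.

Let cvg_pow_primitive p : pow_primitive p u @[u --> +oo] --> 0.
Proof.
rewrite -[X in _ --> X](_ : - 0 / ((al / 2) * p.+1%:R - 1) = 0); last by rewrite oppr0 mul0r.
apply: cvgMl; apply: cvgN.
rewrite -[X in _ --> X](mulr0 (kap ^+ p.+1)).
apply: (@cvg_trans _ (kap ^+ p.+1 * u `^ (- ((al / 2) * p.+1%:R - 1)) @[u --> +oo])).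
  apply: near_eq_cvg; near=> u.
  have u_gt0 : 0 < u by near: u; exact: nbhs_pinfty_gt.
  rewrite /decay exprMn -(@powR_mulrn _ (u `^ _)) ?powR_ge0// -powRrM mulrCA; congr (_ * _).
  rewrite -[X in _ = X * _](@powRr1 _ u (ltW u_gt0)) -powRD ?(gt_eqF u_gt0) ?implybT//.
  by congr powR; ring.
by apply: cvgMr; exact: cvg_powRN.
Unshelve. all: by end_near. Qed.

Let integrable_decay_pow p : leb.-integrable `[u0, +oo[ (EFin \o (fun u => y u ^+ p.+1)).
Proof.
apply: (ge0_integrable_is_derivey _ _ _ (cvg_pow_primitive p)) => u uu;
  have u_gt0 := lt_le_trans u0_gt0 uu.
- by rewrite exprn_ge0// decay_ge0.
- exact: is_derive_pow_primitive.
- exact: continuous_decay_pow.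
Qed.

Lemma integrable_decay_ratio p q : leb.-integrable `[u0, +oo[ (EFin \o ratio p.+1 q).
Proof.
apply: le_integrable (integrable_decay_pow p) => //.
  by apply/measurable_EFinP; exact: measurable_funS (measurable_decay_ratio _ _).
move=> u _; rewrite /= !ger0_norm ?lee_fin ?decay_ratio_le ?decay_ratio_ge0//.
by rewrite exprn_ge0// decay_ge0.
Qed.

Lemma integral_decay_ratio p q :
  (\int[leb]_(u in `[u0, +oo[) (ratio p.+1 q u)%:E = (J p.+1 q)%:E)%E.
Proof. by rewrite fineK// integrable_fin_num//; exact: integrable_decay_ratio. Qed.

Lemma decay_int_ge0 p q : 0 <= J p q.
Proof. by apply: Rintegral_ge0 => u _; exact: decay_ratio_ge0. Qed.

Let decay_head p := u0 * de * tau ^+ p.+1 / (p.+1%:R - de).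

Let decay_int_pow p : J p.+1 0 = decay_head p.
Proof.
rewrite /decay_int; under eq_Rintegral do rewrite /decay_ratio expr0 divr1.
rewrite (Rintegral_is_derivey (g := fun u => y u ^+ p.+1) _ _ _ _ _
  (cvg_pow_primitive p) (cvg_pow_primitive p)); first last.
- by move=> u uu; apply: continuous_decay_pow; exact: lt_le_trans uu.
- by move=> u uu; apply: continuous_decay_pow; exact: lt_le_trans uu.
- by move=> u uu; apply: is_derive_pow_primitive; exact: lt_le_trans uu.
- by move=> u uu; apply: is_derive_pow_primitive; exact: lt_le_trans uu.
- by move=> u uu; rewrite ger0_norm// exprn_ge0// decay_ge0.
rewrite /pow_primitive /decay_head; have := pow_primitive_coef_gt0 p.
move: (p.+1%:R) => r coef_gt0.
have coef_neq0 : r * al - 2 != 0 by rewrite gt_eqF//; lra.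
by field; rewrite coef_neq0 gt_eqF.
Qed.

Lemma decay_int_split p q : J p.+1 q = J p.+1 q.+1 + J p.+2 q.+1.
Proof.
rewrite -RintegralD//; [|exact: integrable_decay_ratio|exact: integrable_decay_ratio].
apply: eq_Rintegral => u _; rewrite /decay_ratio !exprS; field.
by rewrite expf_neq0 gt_eqF.
Qed.

Lemma decay_int_le_pow p q : J p.+1 q <= u0 * de * tau ^+ p.+1 / (p.+1%:R - de).
Proof.
rewrite -[leRHS]decay_int_pow.
apply: le_Rintegral => // [||u _]; [exact: integrable_decay_ratio|exact: integrable_decay_ratio|].
by rewrite /(ratio _ 0) expr0 divr1 decay_ratio_le.
Qed.

Let decay_int_shift p q : J p.+2 q.+2 <= w * J p.+1 q.+1.
Proof.
have Zratio_int : leb.-integrable `[u0, +oo[ (EFin \o (fun u => w * ratio p.+1 q.+1 u)).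
  by apply: integrable_EFinZl => //; exact: integrable_decay_ratio.
rewrite -RintegralZl//; last exact: integrable_decay_ratio.
apply: le_Rintegral => //; first exact: integrable_decay_ratio.
move=> u; rewrite /= in_itv/= andbT => uu.
have -> : ratio p.+2 q.+2 u = y u / (1 + y u) * ratio p.+1 q.+1 u.
  by rewrite /decay_ratio !exprS; field; rewrite expf_neq0 !gt_eqF.
apply: ler_wpM2r; first exact: decay_ratio_ge0.
have yu := decay_nincr u0_gt0 uu.
by rewrite ler_pdivrMr// mulrAC ler_pdivlMr// !mulrDr !mulr1 [y u * tau]mulrC lerD2r.
Qed.

Let decay_int_shiftn p q M : J (p + M).+1 (q + M).+1 <= w ^+ M * J p.+1 q.+1.
Proof.
elim: M => [|M IH]; first by rewrite !addn0 mul1r.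
rewrite !addnS exprS -mulrA; apply: le_trans (decay_int_shift _ _) _.
by rewrite ler_wpM2l// divr_ge0 ?decay_ge0// ltW.
Qed.

Let parts_primitive p q (u : R) := - (u * ratio p.+1 q.+1 u).

Let is_derive_parts_primitive p q (u : R) : 0 < u -> is_derive u 1 (parts_primitive p q)
  (((al / 2) * p.+1%:R - 1) * ratio p.+1 q.+1 u - (al / 2) * q.+1%:R * ratio p.+2 q.+2 u).
Proof.
move=> u_gt0; have dy := is_derive_decay u_gt0.
have y1_neq0 : 1 + y u != 0 by rewrite gt_eqF.
have dpow := is_derive_exprn p dy.
have dinv : is_derive u 1 (fun v => ((1 + y v) ^+ q.+1)^-1)
    (- (q.+1%:R * (1 + y u) ^+ q * (- (al / 2) * y u / u)) / ((1 + y u) ^+ q.+1) ^+ 2).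
  have dy1 : is_derive u 1 (fun v => 1 + y v) (- (al / 2) * y u / u).
    by apply: is_derive_eq; rewrite add0r mul1r.
  have := @is_deriveV _ (fun v => (1 + y v) ^+ q.+1) u
    (q.+1%:R * (1 + y u) ^+ q * (- (al / 2) * y u / u)) 1.
  rewrite /GRing.scale/= => dV; apply: is_derive_eq.
    by apply: dV (is_derive_exprn q dy1); rewrite expf_neq0.
  by ring.
rewrite /parts_primitive /decay_ratio; apply: is_derive_eq; rewrite /GRing.scale/= !exprS.
by field; rewrite expf_neq0 ?y1_neq0 ?gt_eqF.
Qed.

Let cvg_parts_primitive p q : parts_primitive p q u @[u --> +oo] --> 0.
Proof.
pose coef := (al / 2) * p.+1%:R - 1; have coef_gt0 : 0 < coef by exact: pow_primitive_coef_gt0.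
rewrite -oppr0; apply: cvgN.
apply: (squeeze_cvgr (f := fun=> 0) (h := fun u => - coef * pow_primitive p u)).
- near=> u; have u_gt0 : 0 < u by near: u; exact: nbhs_pinfty_gt.
  rewrite mulr_ge0 ?decay_ratio_ge0 ?(ltW u_gt0)//=.
  rewrite /pow_primitive -/coef mulrA mulrNN mulrAC mulfV ?gt_eqF// mul1r.
  by rewrite ler_wpM2l ?decay_ratio_le// ltW.
- exact: cvg_cst.
- by rewrite -[X in _ --> X](mulr0 (- coef)); apply: cvgMr; exact: cvg_pow_primitive.
Unshelve. all: by end_near. Qed.

(* Integration by parts. *)
Lemma decay_int_rec p q : J p.+1 q.+1 =
  de / (p.+1%:R - de) * (u0 * tau ^+ p.+1 / (1 + tau) ^+ q.+1)
  + q.+1%:R / (p.+1%:R - de) * J p.+2 q.+2.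
Proof.
pose A := (al / 2) * p.+1%:R - 1; pose B := (al / 2) * q.+1%:R.
have A_gt0 : 0 < A by exact: pow_primitive_coef_gt0.
have B_ge0 : 0 <= B by rewrite mulr_ge0// divr_ge0// ltW.
have parts : A * J p.+1 q.+1 - B * J p.+2 q.+2 = 0 - parts_primitive p q u0.
  rewrite -!RintegralZl//; try exact: integrable_decay_ratio.
  rewrite -RintegralB//; try by apply: integrable_EFinZl => //; exact: integrable_decay_ratio.
  apply: (Rintegral_is_derivey (g := fun u => (A + B) * y u ^+ p.+1)
    (G := fun u => (A + B) * pow_primitive p u) _ _ _ _ _ (cvg_parts_primitive p q)
    (cvgMr (cvg_pow_primitive p))) => u uu; have u_gt0 := lt_le_trans u0_gt0 uu.
  - have ratio2_le : ratio p.+2 q.+2 u <= y u ^+ p.+1.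
      apply: le_trans (decay_ratio_le p.+1 q.+1 u).
      rewrite /decay_ratio [y u ^+ p.+2]exprS [X in _ / X]exprS invfM mulrACA.
      by rewrite ler_piMl ?decay_ratio_ge0// ler_pdivrMr// mul1r lerDr.
    rewrite [leRHS]mulrDl; apply: le_trans (ler_normB _ _) _.
    rewrite (normrM A) (normrM B) (gtr0_norm A_gt0) (ger0_norm B_ge0).
    rewrite !(ger0_norm (decay_ratio_ge0 _ _ _)).
    by apply: lerD; apply: ler_wpM2l; rewrite ?decay_ratio_le// ltW.
  - exact: is_derive_parts_primitive.
  - have dG := is_derive_pow_primitive p u_gt0; apply: is_derive_eq.
    by rewrite /GRing.scale/=; ring.
  - by apply: cvgB; apply: cvgMr; exact: continuous_decay_ratio.
  - by apply: cvgMr; exact: continuous_decay_pow.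
have -> : p.+1%:R - de = A * de by rewrite /A; field; rewrite gt_eqF.
have -> : q.+1%:R = B * de by rewrite /B; field; rewrite gt_eqF.
rewrite sub0r opprK in parts.
apply: (mulfI (x := A)); first by rewrite gt_eqF.
rewrite -[LHS](subrK (B * J p.+2 q.+2)) parts /decay_ratio; field.
by rewrite expf_neq0 ?gt_eqF.
Qed.

Let pfaff_coef p q := u0 * de * tau ^+ p.+1 / ((p.+1%:R - de) * (1 + tau) ^+ q.+1).

Let pfaff_term p q m :=
  pfaff_coef p q * (rising q.+1%:R m / rising (p.+1%:R - de + 1) m * w ^+ m).

Let pfaff_remainder p q M :=
  rising q.+1%:R M / rising (p.+1%:R - de) M * J (p + M).+1 (q + M).+1.

Let pfaff_remainder_rec p q M :
  pfaff_remainder p q M = pfaff_term p q M + pfaff_remainder p q M.+1.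
Proof.
rewrite /pfaff_remainder /pfaff_term /pfaff_coef !addnS decay_int_rec.
set b := p.+1%:R - de; have b_gt0 : 0 < b by exact: natrB_de_gt0.
have -> : (p + M).+1%:R - de = b + M%:R by rewrite /b -addSn natrD addrAC.
have -> : (q + M).+1%:R = q.+1%:R + M%:R :> R by rewrite -natrD addSn.
have b1_neq0 : rising (b + 1) M != 0 by rewrite gt_eqF// rising_gt0// addr_gt0.
have bM_neq0 : b + M%:R != 0 by rewrite gt_eqF// ltr_wpDr.
have b_neq0 : b != 0 by rewrite gt_eqF.
have tau1_neq0 : 1 + tau != 0 by rewrite gt_eqF.
have -> : rising b M = b * rising (b + 1) M / (b + M%:R).
  by rewrite -risingSl risingS mulfK.
rewrite [rising b M.+1]risingSl [rising _ M.+1]risingS -!addSn !exprD expr_div_n.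
move: (J _ _) (tau ^+ p.+1) (rising q.+1%:R M) => J' tau_p rising_q.
have tau1q_neq0 := expf_neq0 q.+1 tau1_neq0; have tau1M_neq0 := expf_neq0 M tau1_neq0.
move: (b) (rising (b + 1) M) ((1 + tau) ^+ q.+1) b_neq0 b1_neq0 bM_neq0 tau1q_neq0.
move=> c rising_c tau1q c_neq0 rising_neq0 cM_neq0 tau1q_neq0.
by field; rewrite rising_neq0 c_neq0 cM_neq0 tau1q_neq0 tau1M_neq0 gt_eqF.
Qed.

Let decay_int_pfaff_partial p q M :
  J p.+1 q.+1 = series (pfaff_term p q) M + pfaff_remainder p q M.
Proof.
rewrite /series/=; elim: M => [|M IH].
  by rewrite big_geq// /pfaff_remainder !rising0 !addn0 divr1 mul1r add0r.
by rewrite IH pfaff_remainder_rec big_nat_recr//= addrA.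
Qed.

Let decay_frac_itv : 0 <= w < 1.
Proof. by rewrite divr_ge0 ?decay_ge0 ?ltW//= ltr_pdivrMr// mul1r ltrDr. Qed.

Let cvg_pfaff_remainder p q : pfaff_remainder p q M @[M --> \oo] --> 0.
Proof.
have b_gt0 := natrB_de_gt0 p.
have coef_ge0 M : 0 <= rising q.+1%:R M / rising (p.+1%:R - de) M.
  by rewrite divr_ge0 ?rising_ge0// ltW.
apply: (squeeze_cvgr (f := fun=> 0)
  (h := fun M => rising q.+1%:R M / rising (p.+1%:R - de) M * w ^+ M * J p.+1 q.+1)).
- apply: nearW => M; rewrite /pfaff_remainder mulr_ge0 ?decay_int_ge0//=.
  by rewrite -[leRHS]mulrA ler_wpM2l// decay_int_shiftn.
- exact: cvg_cst.
- rewrite -[X in _ --> X](mul0r (J p.+1 q.+1)); apply: cvgMl.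
  exact: cvg_rising_geometric.
Qed.

Let decay_int_pfaff_series p q : pfaff_coef p q *
  hyp2F1_series q.+1%:R 1 (p.+1%:R - de + 1) w = J p.+1 q.+1.
Proof.
apply: (hyp2F1_series_eq (S := pfaff_term p q)).
- have b_gt0 := natrB_de_gt0 p; have tau_gt0 := decay_gt0 u0_gt0; apply: lt0r_neq0.
  by rewrite divr_gt0// mulr_gt0// ?exprn_gt0// mulr_gt0.
- by move=> n; congr (_ * (_ * _)); rewrite rising1 -mulf_div divff ?mulr1.
- rewrite (_ : series _ = fun M => J p.+1 q.+1 - pfaff_remainder p q M).
    rewrite -[X in _ --> X]subr0; apply: cvgB; first exact: cvg_cst.
    exact: cvg_pfaff_remainder.
  by apply/funext => M; rewrite (decay_int_pfaff_partial p q M) addrK.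
Qed.

Let alt_coef q m : R := rising q%:R m / m`!%:R.

Let alt_coefS q m : alt_coef q.+1 m.+1 = alt_coef q m.+1 + alt_coef q.+1 m.
Proof.
rewrite /alt_coef (risingSl q%:R) natr1 risingS factS natrM.
have f0 : m`!%:R != 0 :> R by rewrite pnatr_eq0 -lt0n fact_gt0.
have m0 : m.+1%:R != 0 :> R by rewrite pnatr_eq0.
move: f0 m0; rewrite -[q.+1%:R]natr1 -[m.+1%:R]natr1 => f0 m0.
by field; rewrite f0 m0.
Qed.

Let alt_term p q m := alt_coef q m * (-1) ^+ m * decay_head (p + m).

Let alt_sum_rec M p q : series (alt_term p q.+1) M.+1 =
  series (alt_term p q) M.+1 - series (alt_term p.+1 q.+1) M.
Proof.
rewrite /series/= big_nat_recl// [in X in _ = X - _]big_nat_recl// /alt_term.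
rewrite /alt_coef !rising0 -addrA; congr (_ + _); rewrite -sumrB.
apply: eq_big_nat => m _; rewrite -!/(alt_coef _ _) alt_coefS addSnnS exprS.
by ring.
Qed.

(* The remainder of the alternating series is controlled by its first omitted
   term, because it satisfies the same two-term recursion as the integrals. *)
Let alt_remainder_bound q M p :
  0 <= (-1) ^+ M * (J p.+1 q - series (alt_term p q) M) <= alt_coef q M * decay_head (p + M).
Proof.
have bound0 p' q' : 0 <= (-1) ^+ 0 * (J p'.+1 q' - series (alt_term p' q') 0) <=
    alt_coef q' 0 * decay_head (p' + 0).
  rewrite expr0 mul1r /series/= big_geq// subr0 decay_int_ge0.
  by rewrite /alt_coef rising0 divr1 mul1r addn0; exact: decay_int_le_pow.
elim: q M p => [|q IHq] M p.
  case: M => [|M]; first exact: bound0.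
  have rising_0S m : rising (0%:R : R) m.+1 = 0 by rewrite risingSl mul0r.
  rewrite /series/= big_nat_recl// /alt_term /alt_coef rising0 divr1 !mul1r addn0.
  rewrite decay_int_pow big1; last by move=> m _; rewrite rising_0S !mul0r.
  by rewrite addr0 subrr mulr0 rising_0S !mul0r lexx.
elim: M p => [|M IHM] p; first exact: bound0.
have -> : (-1) ^+ M.+1 * (J p.+1 q.+1 - series (alt_term p q.+1) M.+1) =
    (-1) ^+ M.+1 * (J p.+1 q - series (alt_term p q) M.+1) +
    (-1) ^+ M * (J p.+2 q.+1 - series (alt_term p.+1 q.+1) M).
  by rewrite alt_sum_rec (decay_int_split p q) exprS; ring.
have /andP[rem_q_ge0 rem_q_le] := IHq M.+1 p.
have /andP[rem_M_ge0 rem_M_le] := IHM p.+1.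
rewrite addr_ge0//= alt_coefS mulrDl; apply: lerD => //.
by rewrite addSnnS in rem_M_le.
Qed.

Let decay_head_le p M : decay_head (p + M) <= decay_head p * tau ^+ M.
Proof.
rewrite /decay_head -addSn exprD [leRHS]mulrAC !mulrA; apply: ler_pM => //.
- by rewrite !mulr_ge0 ?exprn_ge0 ?decay_ge0 ?invr_ge0// ltW.
- by rewrite invr_ge0 ltW// natrB_de_gt0.
- rewrite lef_pV2 ?posrE ?natrB_de_gt0//.
  by rewrite lerD2r ler_nat leq_addr.
Qed.

Let cvg_alt_series p q : tau < 1 -> series (alt_term p q.+1) @ \oo --> J p.+1 q.+1.
Proof.
move=> tau_lt1.
have cvg_bound : decay_head p * (rising q.+1%:R M / rising 1 M * tau ^+ M) @[M --> \oo] --> 0.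
  rewrite -[X in _ --> X](mulr0 (decay_head p)); apply: cvgMr.
  by apply: cvg_rising_geometric => //; rewrite decay_ge0.
apply/cvgrPdist_le => e e0; move/cvgrPdist_le: cvg_bound => /(_ e e0); apply: filterS => M.
rewrite sub0r normrN; apply: le_trans; apply: le_trans (ler_norm _).
have /andP[rem_ge0 rem_le] := alt_remainder_bound q.+1 M p.
rewrite -[leLHS]mul1r -[X in X * _](normr_sign _ M) -normrM ger0_norm//.
apply: (le_trans rem_le); rewrite rising1 [leRHS]mulrCA; apply: ler_wpM2l => //.
by rewrite divr_ge0// rising_ge0.
Qed.

Let decay_int_alt_series p q : tau < 1 -> decay_head p *
  hyp2F1_series q.+1%:R (p.+1%:R - de) (p.+1%:R - de + 1) (- tau) = J p.+1 q.+1.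
Proof.
move=> tau_lt1; have b_gt0 := natrB_de_gt0 p; have tau_gt0 := decay_gt0 u0_gt0.
apply: (hyp2F1_series_eq (S := alt_term p q.+1)); last exact: cvg_alt_series.
  by apply: lt0r_neq0; rewrite divr_gt0// mulr_gt0 ?exprn_gt0// mulr_gt0.
move=> m; have -> : rising q.+1%:R m * rising (p.+1%:R - de) m /
    (rising (p.+1%:R - de + 1) m * m`!%:R) =
    rising q.+1%:R m / m`!%:R * ((p.+1%:R - de) / (p.+1%:R - de + m%:R)) :> R.
  by rewrite [_ * m`!%:R]mulrC -mulf_div rising_succ_ratio.
rewrite exprNn /alt_term /alt_coef /decay_head.
rewrite -addSn natrD exprD [p.+1%:R + m%:R - de]addrAC.
have bm_neq0 : p.+1%:R - de + m%:R != 0 by rewrite gt_eqF// ltr_wpDr.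
have b_neq0 : p.+1%:R - de != 0 by rewrite gt_eqF.
have f0 : m`!%:R != 0 :> R by rewrite pnatr_eq0 -lt0n fact_gt0.
move: (p.+1%:R - de) (m`!%:R) b_neq0 bm_neq0 f0 => b f b_neq0 bm_neq0 f0.
by field; rewrite b_neq0 bm_neq0 f0 gt_eqF.
Qed.

Theorem decay_int_hyp2F1 p q : J p.+1 q.+1 =
  u0 * (de * tau ^+ p.+1 * hyp2F1 q.+1%:R (p.+1%:R - de) (p.+2%:R - de) (- tau)
     / (p.+1%:R - de)).
Proof.
have tau_gt0 : 0 < tau by exact: decay_gt0.
have -> : p.+2%:R - de = p.+1%:R - de + 1 by rewrite -[p.+2%:R]natr1 addrAC.
have b_neq0 : p.+1%:R - de != 0 by rewrite gt_eqF// natrB_de_gt0.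
rewrite /hyp2F1 normrN (gtr0_norm tau_gt0); case: ifPn => [tau_lt1|].
  by rewrite -(decay_int_alt_series p q tau_lt1) /decay_head; ring.
rewrite -leNgt => tau_ge1; rewrite lerN2 tau_ge1 -(decay_int_pfaff_series p q).
rewrite [p.+1%:R - de + 1]addrC addrK addrC -opprD invrN mulrNN [tau + 1]addrC.
rewrite opprK powR_invn ?ltW// /pfaff_coef.
have tau1q_neq0 : (1 + tau) ^+ q.+1 != 0 by rewrite expf_neq0// gt_eqF.
move: (p.+1%:R - de) b_neq0 => b b_neq0.
by field; rewrite b_neq0 tau1q_neq0 gt_eqF.
Qed.

End DecayIntegral.

Section DecayIntegralParameter.
Context {R : realType}.
Local Notation leb := (@lebesgue_measure R).

Lemma measurable_funV d (T : measurableType d) (D : set T) (f : T -> R) :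
  measurable_fun D f -> measurable_fun D (fun x => (f x)^-1).
Proof.
move=> mf; rewrite (_ : (fun x => _) = fun x => f x * (f x ^+ 2) `^ (-1)); last first.
  apply/funext => x; rewrite powR_inv1 ?sqr_ge0//.
  by have [->|fx0] := eqVneq (f x) 0; [rewrite invr0 mul0r|field].
apply: measurable_funM => //; apply: (measurableT_comp (measurable_powR _)).
exact: measurable_funX.
Qed.

Lemma decay_int11_le (al kap u0 : R) : 2 < al -> 0 < kap -> 0 < u0 ->
  decay_int al kap u0 1 1 <= kap * (u0 * (2 / al) * u0 `^ (- (al / 2)) / (1 - 2 / al)).
Proof.
move=> al2 kap0 u00; apply: le_trans (decay_int_le_pow al2 kap0 u00 0 1) _.
by rewrite /decay expr1 mulrCA -!mulrA.
Qed.

Lemma decay_int11_large (al u0 L : R) : 2 < al -> 0 < u0 -> 0 < L ->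
  exists2 kap, 0 < kap & L <= decay_int al kap u0 1 1.
Proof.
move=> al2 u00 L0; pose a := u0 + 2 * L.
have a0 : 0 < a by rewrite /a; lra.
have ua : u0 < a by rewrite /a; lra.
pose kap := a `^ (al / 2); have kap0 : 0 < kap by rewrite powR_gt0.
have mratio (A : set R) : measurable_fun A (EFin \o decay_ratio al kap 1 1).
  by apply/measurable_EFinP; apply: measurable_funS (measurable_decay_ratio al kap0 1 1).
exists kap => //; rewrite -lee_fin -(integral_decay_ratio al2 kap0 u00).
have -> : L%:E = (\int[leb]_(u in `[u0, a]) (2^-1)%:E)%E.
  rewrite integral_cst//= lebesgue_measure_itv/= lte_fin ua -EFinB -EFinM.
  by congr EFin; rewrite /a; field.
apply: (@le_trans _ _ (\int[leb]_(u in `[u0, a]) (decay_ratio al kap 1 1 u)%:E)%E).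
  apply: ge0_le_integral => //; first exact: mratio.
  move=> u; rewrite /= in_itv/= => /andP[uu uA].
  have decay_ge1 : 1 <= decay al kap u.
    apply: le_trans (decay_nincr al2 kap0 (lt_le_trans u00 uu) uA).
    by rewrite /decay /kap -powRD ?subrr ?powRr0// (gt_eqF a0) implybT.
  by rewrite lee_fin /decay_ratio !expr1 ler_pdivlMr; lra.
apply: ge0_subset_integral => //; first exact: mratio.
- by move=> u _; rewrite lee_fin decay_ratio_ge0.
- by move=> u; rewrite /= !in_itv/= => /andP[->].
Qed.

Lemma measurable_decay_int (al u0 : R) p q :
  measurable_fun (`]0, +oo[ : set R) (fun kap => decay_int al kap u0 p q).
Proof.
pose D1 : set (measurableTypeR R) := `]0, +oo[%classic.
pose D2 : set (measurableTypeR R) := `[u0, +oo[%classic.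
pose f (z : measurableTypeR R * measurableTypeR R) := (decay_ratio al z.1 p q z.2)%:E.
have mdecay : measurable_fun setT
    (fun z : measurableTypeR R * measurableTypeR R => decay al z.1 z.2).
  apply: measurable_funM; first exact: measurable_fst.
  exact: (measurableT_comp (measurable_powR _) measurable_snd).
have mf : measurable_fun (D1 `*` D2) f.
  apply/measurable_funTS/measurable_EFinP; apply: measurable_funM; first exact: measurable_funX.
  by apply: measurable_funV; apply: measurable_funX; exact: measurable_funD.
have f_ge0 kap u : D1 kap -> D2 u -> (0 <= f (kap, u))%E.
  by rewrite /D1/= in_itv/= andbT => kap0 _; rewrite lee_fin decay_ratio_ge0.
apply: (measurableT_comp (f := fine)); first exact: (fine_measurable measurableT).
by apply: (measurable_fun_section_integral leb _ _ mf f_ge0); exact: measurable_itv.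
Qed.

End DecayIntegralParameter.

(** * Interference of one tier *)

Section MarkedPlane.
Context {R : realType}.
Local Notation leb := (@lebesgue_measure R).
Local Notation pt := ((R * R) * R)%type.

Let leb3_set0 : leb3 set0 = 0%E :> \bar R.
Proof. exact: (measure0 ((leb \x leb) \x leb)%E). Qed.

Let leb3_ge0 (B : set pt) : (0 <= leb3 B)%E.
Proof. exact: (measure_ge0 ((leb \x leb) \x leb)%E). Qed.

Let leb3_sigma_additive : semi_sigma_additive (leb3 : set pt -> \bar R).
Proof. exact: (@measure_semi_sigma_additive _ _ _ ((leb \x leb) \x leb)%E). Qed.

(* The display of the Borel structure on R as a realType differs from the one
   carried by Lebesgue measure, so leb3 has to be declared a measure again. *)
HB.instance Definition _ := isMeasure.Build _ pt R leb3
  leb3_set0 leb3_ge0 leb3_sigma_additive.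

Definition leb2 : set (measurableTypeR R * measurableTypeR R) -> \bar R := (leb \x leb)%E.

HB.instance Definition _ := Measure.on leb2.

Let mdisk (u : R) : measurable ([set p | sqnorm2 p < u] : set (R * R)).
Proof.
rewrite (_ : [set p | _] = sqnorm2 @^-1` `]-oo, u[).
  by apply: measurable_preimage => //; exact: measurable_sqnorm2.
by apply/seteqP; split => p /=; rewrite in_itv.
Qed.

Let leb2_sigma_finite : sigma_finite setT leb2.
Proof.
exists (fun n => [set p | sqnorm2 p < n%:R]).
  apply/seteqP; split => // p _; exists (Num.truncn (sqnorm2 p)).+1 => //=.
  exact: truncnS_gt.
by move=> n; split; [exact: mdisk|rewrite /leb2 disk_area ltry].
Qed.

HB.instance Definition _ := Measure_isSigmaFinite.Build _ _ _ leb2 leb2_sigma_finite.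

Lemma integral_leb3 (f : pt -> \bar R) : measurable_fun setT f -> (forall z, 0 <= f z)%E ->
  (\int[leb3]_z f z = \int[leb \x leb]_p \int[leb]_v f (p, v))%E.
Proof.
move=> mf f0; apply: etrans (@fubini_tonelli1 _ _ _ _ R leb2 leb f mf f0).
apply: (@ge0_integral_image _ _ pt
  (measurableTypeR R * measurableTypeR R * measurableTypeR R)%type R
  leb3 (leb2 \x leb)%E idfun f) => //.
exact: measurable_id.
Qed.

Lemma exp1_dens_ge0 (v : R) : 0 <= exp1_dens v.
Proof. by rewrite exp1_densE exponential_pdf_ge0. Qed.

Lemma measurable_exp1_dens : measurable_fun setT (@exp1_dens R).
Proof. by rewrite exp1_densE; exact: measurable_exponential_pdf. Qed.

Lemma exp1_dens_le1 (v : R) : exp1_dens v <= 1.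
Proof. by rewrite /exp1_dens; case: ifP => // v0; rewrite expR_le1 oppr_le0. Qed.

Let measurable_mark : measurable_fun setT (fun z : pt => exp1_dens z.2).
Proof. exact: (measurableT_comp measurable_exp1_dens measurable_snd). Qed.

Let mark_ge0 (z : pt) : 0 <= exp1_dens z.2. Proof. exact: exp1_dens_ge0. Qed.

Definition marked_measure (c : R) (c_ge0 : 0 <= c) : {measure set pt -> \bar R} :=
  mscale (NngNum c_ge0) (mdensity leb3 measurable_mark mark_ge0).

Lemma marked_measureE (c : R) (c_ge0 : 0 <= c) (B : set pt) :
  marked_measure c_ge0 B = marked_mean c B.
Proof. by []. Qed.

Lemma integral_marked_measure (c : R) (c_ge0 : 0 <= c) (f : pt -> \bar R) :
  measurable_fun setT f -> (forall z, 0 <= f z)%E ->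
  (\int[marked_measure c_ge0]_z f z =
   c%:E * \int[leb \x leb]_p \int[leb]_v (f (p, v) * (exp1_dens v)%:E))%E.
Proof.
move=> mf f0; rewrite ge0_integral_mscale//= ge0_integral_mdensity// integral_leb3//.
- by apply: emeasurable_funM mf _; apply/measurable_EFinP; exact: measurable_mark.
- by move=> z; rewrite mule_ge0// lee_fin.
Qed.

Lemma marked_measure_sigma_finite (c : R) (c_ge0 : 0 <= c) :
  sigma_finite setT (marked_measure c_ge0).
Proof.
pose D n : set pt := [set p | sqnorm2 p < n%:R] `*` `[- n%:R, n%:R].
exists D.
  apply/seteqP; split => // z _.
  have z_lt := truncnS_gt (sqnorm2 z.1 + `|z.2|); set n := _.+1 in z_lt.
  exists n => //; split => /=; first by apply: le_lt_trans z_lt; rewrite lerDl.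
  by rewrite in_itv/= -ler_norml ltW// (le_lt_trans _ z_lt)// lerDr sqnorm2_ge0.
move=> n; have mD : measurable (D n) by apply: measurableX => //; exact: measurable_itv.
split=> //; rewrite marked_measureE /marked_mean.
have mark_fin : (\int[leb3]_(z in D n) (exp1_dens z.2)%:E <= leb3 (D n))%E.
  rewrite -[leRHS]mul1e -integral_cst//; apply: ge0_le_integral => //.
  + by move=> z _; rewrite lee_fin.
  + by apply/measurable_EFinP; exact: measurable_funS measurable_mark.
  + by move=> z _; rewrite lee_fin exp1_dens_le1.
apply: (@le_lt_trans _ _ (c%:E * leb3 (D n))%E); first by rewrite lee_wpmul2l ?lee_fin.
pose itv : set R := `[- n%:R, n%:R]%classic.
rewrite [X in (_ * X)%E](_ : _ = (leb2 [set p | (sqnorm2 p < n%:R)%R] * leb itv)%E); last first.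
  by apply: (product_measure1E leb2 leb); [exact: mdisk|exact: measurable_itv].
rewrite /leb2 disk_area /itv lebesgue_measure_itv/=.
by case: ifP => _; rewrite -?EFinD -?EFinM ?mule0 ?ltry.
Qed.

End MarkedPlane.

Section TierInterference.
Context {R : realType}.
Local Notation leb := (@lebesgue_measure R).
Local Notation pt := ((R * R) * R)%type.
Implicit Types (pw al r : R) (m : {measure set pt -> \bar R}).

Definition outside r : set pt := [set z : pt | (r < pdist z)%R /\ (0 <= z.2)%R].

Definition contribution pw al (z : pt) : R := pw * z.2 * pdist z `^ (- al).

Definition tier_interference pw al r m : \bar R :=
  (\int[m]_(z in outside r) (contribution pw al z)%:E)%E.

Lemma measurable_pdist : measurable_fun setT (@pdist R).
Proof.
have msqnorm : measurable_fun setT (fun z : pt => sqnorm2 z.1).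
  exact: (measurableT_comp measurable_sqnorm2 measurable_fst).
apply: (measurableT_comp _ msqnorm).
by apply: continuous_measurable_fun; exact: sqrt_continuous.
Qed.

Lemma measurable_outside r : measurable (outside r).
Proof.
have -> : outside r = (@pdist R) @^-1` `]r, +oo[ `&` snd @^-1` `[0, +oo[.
  by apply/seteqP; split => z; rewrite /outside/= !in_itv/= !andbT.
by apply: measurableI; apply: measurable_preimage;
  [exact: measurable_pdist|exact: measurable_itv|exact: measurable_snd|exact: measurable_itv].
Qed.

Lemma measurable_contribution pw al : measurable_fun setT (contribution pw al).
Proof.
apply: measurable_funM; first by apply: measurable_funM => //; exact: measurable_snd.
exact: (measurableT_comp (measurable_powR _) measurable_pdist).
Qed.

Let measurable_contribution_outside pw al r :
  measurable_fun (outside r) (EFin \o contribution pw al).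
Proof. by apply/measurable_EFinP; exact: measurable_funS (measurable_contribution _ _). Qed.

Lemma contribution_ge0 pw al r z : 0 <= pw -> outside r z -> 0 <= contribution pw al z.
Proof. by move=> pw0 [_ z0]; rewrite /contribution !mulr_ge0// powR_ge0. Qed.

Lemma tier_interference_ge0 pw al r m : 0 <= pw -> (0 <= tier_interference pw al r m)%E.
Proof.
by move=> pw0; apply: integral_ge0 => z rz; rewrite lee_fin (contribution_ge0 _ pw0 rz).
Qed.

Lemma measurable_tier_interference d (T : measurableType d)
    (N : T -> {measure set pt -> \bar R}) pw al r : 0 <= pw ->
  (forall B, measurable B -> measurable_fun setT (fun w => N w B : \bar R)) ->
  measurable_fun setT (fun w => tier_interference pw al r (N w)).
Proof.
move=> pw0 mN; rewrite /tier_interference; under eq_fun do rewrite integral_mkcond.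
apply: measurable_fun_integral_kernel => //; last first.
  apply/(measurable_restrictT _ (measurable_outside r)).
  exact: measurable_contribution_outside.
move=> z; rewrite patchE; case: ifPn => // /set_mem rz.
by rewrite lee_fin (contribution_ge0 _ pw0 rz).
Qed.

Lemma tier_interference_nincr pw al r r' m : 0 <= pw -> r <= r' ->
  (tier_interference pw al r' m <= tier_interference pw al r m)%E.
Proof.
move=> pw0 rr'; apply: ge0_subset_integral.
- exact: measurable_outside.
- exact: measurable_outside.
- exact: measurable_contribution_outside.
- by move=> z rz; rewrite lee_fin (contribution_ge0 _ pw0 rz).
- by move=> z [rz z0]; split => //; exact: le_lt_trans rz.
Qed.

Lemma cvg_tier_interference pw al r (rn : R^nat) m : 0 <= pw ->
  (forall n, r <= rn n) -> nonincreasing_seq rn -> rn @ \oo --> r ->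
  tier_interference pw al (rn n) m @[n --> \oo] --> tier_interference pw al r m.
Proof.
move=> pw0 r_le nd_rn cvg_rn.
have -> : tier_interference pw al r m =
    (\int[m]_(z in \bigcup_n outside (rn n)) (contribution pw al z)%:E)%E.
  congr (integral _ _ _); apply/seteqP; split => z.
    move=> [rz z0].
    have [n _ /(_ n (leqnn n)) nz] : \forall n \near \oo, rn n < pdist z by apply: (cvgr_lt r).
    by exists n.
  by move=> [n _ [rz z0]]; split => //; exact: le_lt_trans rz.
apply: ge0_nondecreasing_set_cvg_integral.
- move=> i j ij; apply/subsetPset => z [rz z0]; split => //.
  exact: le_lt_trans (nd_rn _ _ ij) rz.
- by move=> n; exact: measurable_outside.
- by move=> n; exact: measurable_contribution_outside.
- by move=> n z rz; rewrite lee_fin (contribution_ge0 _ pw0 rz).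
Qed.

Section Laplace.
Variables (pw al r t : R).
Hypotheses (pw_gt0 : 0 < pw) (al_gt2 : 2 < al) (r_gt0 : 0 < r) (t_gt0 : 0 < t).

Local Notation y := (decay al (t * pw)).
Local Notation scaled := ((fun z : pt => (t * contribution pw al z)%:E) \_ (outside r)).

Let tpw_gt0 : 0 < t * pw. Proof. exact: mulr_gt0. Qed.

Let scaled_ge0 z : (0 <= scaled z)%E.
Proof.
rewrite patchE; case: ifPn => // /set_mem rz.
by rewrite lee_fin mulr_ge0 ?(ltW t_gt0)// (contribution_ge0 _ (ltW pw_gt0) rz).
Qed.

Let measurable_scaled : measurable_fun setT scaled.
Proof.
apply/(measurable_restrictT _ (measurable_outside r))/measurable_EFinP.
by apply: measurable_funM => //; exact: measurable_funS (measurable_contribution _ _).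
Qed.

Let outsideE p v : outside r (p, v) <-> r ^+ 2 < sqnorm2 p /\ 0 <= v.
Proof.
rewrite /outside/= /pdist/= -/(sqnorm2 p).
rewrite -[in X in _ <-> X](sqr_sqrtr (sqnorm2_ge0 p)).
by rewrite ltr_pXn2r// nnegrE ?sqrtr_ge0// ltW.
Qed.

Let scaled_contributionE p v : t * contribution pw al (p, v) = v * y (sqnorm2 p).
Proof.
rewrite /contribution /decay /pdist/= -/(sqnorm2 p) -powR12_sqrt ?sqnorm2_ge0// -powRrM.
by rewrite (_ : 2^-1 * - al = - (al / 2)); ring.
Qed.

Let integral_mark p :
  (\int[leb]_v ((1 - expN (scaled (p, v)))%:E * (exp1_dens v)%:E) =
   (if r ^+ 2 < sqnorm2 p then y (sqnorm2 p) / (1 + y (sqnorm2 p)) else 0)%:E)%E.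
Proof.
case: ifPn => rp; last first.
  apply: integral0_eq => v _; rewrite patchE memNset; last by move/outsideE => [/(negP rp)].
  by rewrite expN_EFin oppr0 expR0 subrr mul0e.
rewrite -integral_exp1_complement; last exact: decay_ge0.
apply: eq_integral => v _; rewrite patchE; have [v0|v0] := leP 0 v.
  by rewrite mem_set ?scaled_contributionE ?expN_EFin -?EFinM//; apply/outsideE.
by rewrite /exp1_dens leNgt v0 mulr0 mule0.
Qed.

Lemma tier_exponent (c : R) (c_ge0 : 0 <= c) :
  (\int[marked_measure c_ge0]_z (1 - expN (scaled z))%:E =
   (c * pi * decay_int al (t * pw) (r ^+ 2) 1 1)%:E)%E.
Proof.
have r2_gt0 : 0 < r ^+ 2 by rewrite exprn_gt0.
pose g u : \bar R := (if r ^+ 2 < u then decay_ratio al (t * pw) 1 1 u else 0)%:E.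
have mratio := measurable_decay_ratio al tpw_gt0 1 1.
have mg : measurable_fun setT g.
  apply/measurable_EFinP; apply: measurable_fun_ifT => //; exact: measurable_fun_ltr.
have g0 u : (0 <= g u)%E by rewrite lee_fin; case: ifP => // _; exact: decay_ratio_ge0.
rewrite integral_marked_measure; last 2 first.
- apply/measurable_EFinP; apply: measurable_funB => //.
  exact: (measurableT_comp measurable_expN measurable_scaled).
- by move=> z; rewrite lee_fin subr_ge0 expN_le1.
transitivity (c%:E * \int[leb \x leb]_p g (sqnorm2 p))%E.
  by congr (_ * _)%E; apply: eq_integral => p _; rewrite integral_mark /g /decay_ratio !expr1.
rewrite integral_radial// muleA EFinM -(integral_decay_ratio al_gt2 tpw_gt0 r2_gt0).
congr (_ * _)%E; rewrite -integral_itv_obnd_cbnd; last first.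
  by apply/measurable_EFinP; exact: measurable_funS mratio.
rewrite [LHS]integral_mkcond [RHS]integral_mkcond; apply: eq_integral => u _.
rewrite !patchE /g !mem_setE !in_itv/= !andbT.
have [ru|ru] := ltP (r ^+ 2) u; last by case: ifP.
by rewrite (lt_trans r2_gt0 ru).
Qed.

Lemma tier_laplace d (T : measurableType d) (P : probability T R)
    (N : T -> {measure set pt -> \bar R}) (c : R) : 0 <= c ->
  is_PPP P N (marked_mean c) ->
  (\int[P]_w (expN (t%:E * tier_interference pw al r (N w)))%:E =
   (expR (- (c * pi * decay_int al (t * pw) (r ^+ 2) 1 1)))%:E)%E.
Proof.
move=> c_ge0 PPP.
rewrite -expN_EFin -(tier_exponent c_ge0).
rewrite -(PPP_laplace (PPP : is_PPP P N (marked_measure c_ge0))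
  (marked_measure_sigma_finite c_ge0) measurable_scaled scaled_ge0).
apply: eq_integral => w _; congr (expN _)%:E.
rewrite -integral_mkcond /tier_interference -ge0_integralZl ?lee_fin ?(ltW t_gt0)//.
- exact: measurable_outside.
- exact: measurable_contribution_outside.
- by move=> z rz; rewrite lee_fin (contribution_ge0 _ (ltW pw_gt0) rz).
Qed.

End Laplace.
End TierInterference.

(** * Power series of Laplace transforms *)

Section ExpTaylor.
Context {R : realType}.

Lemma expR_taylor_le (y : R) M : 0 <= y -> \sum_(0 <= n < M) y ^+ n / n`!%:R <= expR y.
Proof.
move=> y0.
apply: (@nondecreasing_cvgn_le _ (series (exp_coeff y)) _ (is_cvg_series_exp_coeff y) M).
apply/nondecreasing_seqP => n; rewrite /series/= big_nat_recr//= lerDl.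
by rewrite /exp_coeff/= divr_ge0// exprn_ge0.
Qed.

Lemma expR_taylor_remainder (y : R) M :
  `|expR y - \sum_(0 <= n < M) y ^+ n / n`!%:R| <= `|y| ^+ M / M`!%:R * expR `|y|.
Proof.
have cvg_rem : `|series (exp_coeff y) n - \sum_(0 <= n < M) y ^+ n / n`!%:R| @[n --> \oo]
    --> `|expR y - \sum_(0 <= n < M) y ^+ n / n`!%:R|.
  apply: cvg_norm; apply: cvgB; last exact: cvg_cst.
  exact: is_cvg_series_exp_coeff.
apply: (cvgr_to_le cvg_rem); near=> n.
have Mn : (M <= n)%N by near: n; exact: nbhs_infty_ge.
rewrite /series/= (big_cat_nat (n := M))//= addrAC subrr add0r.
rewrite -{1}[M]add0n -{1}(subnK Mn) big_addn addnK.
apply: le_trans (ler_norm_sum _ _ _) _.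
apply: (@le_trans _ _ (`|y| ^+ M / M`!%:R * \sum_(0 <= k < n - M) `|y| ^+ k / k`!%:R)); last first.
  by rewrite ler_wpM2l ?expR_taylor_le// divr_ge0// exprn_ge0.
rewrite mulr_sumr; apply: ler_sum => k _.
rewrite /exp_coeff/= normrM normrX (ger0_norm (x := _^-1))// addnC exprD mulrACA.
rewrite ler_wpM2l ?mulr_ge0 ?exprn_ge0//.
rewrite -invfM lef_pV2 ?posrE ?mulr_gt0 ?ltr0n ?fact_gt0// -natrM ler_nat.
rewrite -(@bin_fact (M + k) M) ?leq_addr// addKn.
by rewrite leq_pmull// bin_gt0 leq_addr.
Unshelve. all: by end_near. Qed.

Lemma expR_sub1_le (y : R) : `|expR y - 1| <= `|y| * expR `|y|.
Proof.
have := expR_taylor_remainder y 1.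
by rewrite big_nat1 expr0 expr1 fact0 !divr1.
Qed.

Lemma pow_fact_le_expR (y : R) M : 0 <= y -> y ^+ M / M`!%:R <= expR y.
Proof.
move=> y0; apply: le_trans (expR_taylor_le M.+1 y0).
rewrite big_nat_recr//= lerDr; apply: sumr_ge0 => n _.
by rewrite divr_ge0// exprn_ge0.
Qed.

End ExpTaylor.

Section TaylorModulo.
Context {R : realType}.
Implicit Types (f : R -> R) (p q : {poly R}).

Definition taylor_mod (M : nat) f p :=
  exists C, forall z, 0 < z <= 2^-1 -> `|f z - p.[z]| <= C * z ^+ M.

Let half_le1 (z : R) : z <= 2^-1 -> z <= 1.
Proof. by move=> /le_trans; apply; rewrite invf_le1// ler1n. Qed.

Lemma norm_horner_le p (z : R) : 0 <= z <= 1 -> `|p.[z]| <= \sum_(i < size p) `|p`_i|.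
Proof.
move=> /andP[z0 z1]; rewrite horner_coef; apply: le_trans (ler_norm_sum _ _ _) _.
apply: ler_sum => i _; rewrite normrM ler_piMr// normrX exprn_ile1//.
by rewrite ger0_norm.
Qed.

Lemma horner_drop1 p (z : R) : p.[z] = p`_0 + (drop_poly 1 p).[z] * z.
Proof.
rewrite -{1}(poly_take_drop 1 p) hornerD hornerM hornerX; congr (_ + _).
by rewrite /take_poly poly_def big_ord1 expr0 alg_polyC hornerC.
Qed.

Lemma horner_sub_coef0_le p :
  exists2 K, 0 <= K & forall z, 0 < z <= 2^-1 -> `|p.[z] - p`_0| <= K * z.
Proof.
pose K := \sum_(i < size (drop_poly 1 p)) `|(drop_poly 1 p)`_i|.
exists K => [|z /andP[z0 z2]]; first exact: sumr_ge0.
rewrite horner_drop1 addrAC subrr add0r normrM (gtr0_norm z0) ler_wpM2r ?(ltW z0)//.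
by apply: norm_horner_le; rewrite (ltW z0) half_le1.
Qed.

Let taylor_mod0_coef0 M q : (0 < M)%N -> taylor_mod M (cst 0) q -> q`_0 = 0.
Proof.
move=> M0 [C qC]; have [K K0 qK] := horner_sub_coef0_le q.
apply/eqP; rewrite -normr_eq0; apply/eqP/le_anti; rewrite normr_ge0 andbT.
apply/ler_addgt0Pl => e e0; rewrite addr0.
have S0 : 0 < `|C| + K + 1 by rewrite ltr_wpDl// addr_ge0.
pose z := Num.min 2^-1 (e / (`|C| + K + 1)).
have z0 : 0 < z by rewrite lt_min invr_gt0 ltr0n divr_gt0.
have z2 : z <= 2^-1 by rewrite ge_min lexx.
have z_itv : 0 < z <= 2^-1 by rewrite z0.
have ze : z * (`|C| + K + 1) <= e by rewrite -ler_pdivlMr// ge_min lexx orbT.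
have -> : q`_0 = q.[z] - (q.[z] - q`_0) by ring.
apply: le_trans (ler_normB _ _) _.
have q_le : `|q.[z]| <= `|C| * z.
  have := qC z z_itv; rewrite sub0r normrN => /le_trans; apply.
  apply: le_trans (ler_norm _) _; rewrite normrM ler_wpM2l// normrX (gtr0_norm z0).
  by rewrite -(prednK M0) exprS ler_piMr ?(ltW z0)// exprn_ile1 ?(ltW z0)// half_le1.
have := qK z z_itv; nra.
Qed.

Let taylor_mod0_coef M q n : taylor_mod M (cst 0) q -> (n < M)%N -> q`_n = 0.
Proof.
elim: M q n => // M IH q n qM nM.
have q0 := taylor_mod0_coef0 (ltn0Sn M) qM.
case: n nM => // n nM.
have -> : q`_n.+1 = (drop_poly 1 q)`_n by rewrite coef_drop_poly addn1.
apply: IH nM; have [C qC] := qM; exists C => z z_itv; have /andP[z0 _] := z_itv.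
have := qC z z_itv.
rewrite horner_drop1 q0 !sub0r !normrN add0r normrM (gtr0_norm z0) exprSr mulrA.
by rewrite ler_pM2r.
Qed.

Lemma taylor_modB M f g p q : taylor_mod M f p -> taylor_mod M g q ->
  taylor_mod M (fun z => f z - g z) (p - q).
Proof.
move=> [C fp] [C' gq]; exists (C + C') => z z_itv; rewrite hornerD hornerN mulrDl.
have -> : f z - g z - (p.[z] - q.[z]) = (f z - p.[z]) - (g z - q.[z]) by ring.
by apply: le_trans (ler_normB _ _) _; rewrite lerD ?fp ?gq.
Qed.

Lemma taylor_mod_coef_eq M f p q n : taylor_mod M f p -> taylor_mod M f q ->
  (n < M)%N -> p`_n = q`_n.
Proof.
move=> fp fq nM; apply/eqP; rewrite -subr_eq0 -coefB; apply/eqP.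
apply: taylor_mod0_coef nM; have [C pqC] := taylor_modB fp fq.
by exists C => z /pqC; rewrite subrr.
Qed.

Lemma taylor_modZ M (c : R) f p : taylor_mod M f p -> taylor_mod M (fun z => c * f z) (c *: p).
Proof.
move=> [C fp]; exists (`|c| * C) => z z_itv.
by rewrite hornerZ -mulrBr normrM -mulrA ler_wpM2l// fp.
Qed.

Lemma taylor_mod_sum (I : Type) (s : seq I) M (f : I -> R -> R) (p : I -> {poly R}) :
  (forall i, taylor_mod M (f i) (p i)) ->
  taylor_mod M (fun z => \sum_(i <- s) f i z) (\sum_(i <- s) p i).
Proof.
move=> /choice[C fp]; exists (\sum_(i <- s) C i) => z z_itv.
rewrite horner_sum -sumrB mulr_suml; apply: le_trans (ler_norm_sum _ _ _) _.
by apply: ler_sum => i _; exact: fp.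
Qed.

Definition exp_trunc (M : nat) p : {poly R} := \sum_(i < M) i`!%:R^-1 *: p ^+ i.

Lemma horner_exp_trunc M p z : (exp_trunc M p).[z] = \sum_(0 <= i < M) p.[z] ^+ i / i`!%:R.
Proof.
rewrite horner_sum big_mkord; apply: eq_bigr => i _.
by rewrite hornerZ horner_exp mulrC.
Qed.

Let taylor_mod_expR0 M f p : p`_0 = 0 -> taylor_mod M f p ->
  taylor_mod M (fun z => expR (f z)) (exp_trunc M p).
Proof.
move=> p0 [C fp]; have [K K0 pK] := horner_sub_coef0_le p.
exists (expR K * (`|C| * expR `|C| + K ^+ M)) => z z_itv; have /andP[z0 z2] := z_itv.
have z1 := half_le1 z2; have zM0 : 0 <= z ^+ M by rewrite exprn_ge0// ltW.
have zM1 : z ^+ M <= 1 by rewrite exprn_ile1// ltW.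
have {}pK : `|p.[z]| <= K * z by have := pK z z_itv; rewrite p0 subr0.
have pz_le : `|p.[z]| <= K by apply: le_trans pK _; rewrite ler_piMr.
set rho := f z - p.[z].
have rho_le : `|rho| <= `|C| * z ^+ M.
  by apply: le_trans (fp z z_itv) _; rewrite ler_wpM2r// ler_norm.
have rho_leC : `|rho| <= `|C| by apply: le_trans rho_le _; rewrite ler_piMr.
have expR_pz : expR `|p.[z]| <= expR K by rewrite ler_expR.
rewrite horner_exp_trunc.
have -> : expR (f z) - \sum_(0 <= i < M) p.[z] ^+ i / i`!%:R = expR p.[z] * (expR rho - 1)
    + (expR p.[z] - \sum_(0 <= i < M) p.[z] ^+ i / i`!%:R).
  by rewrite mulrBr mulr1 -expRD [p.[z] + rho]addrC subrK; ring.
apply: le_trans (ler_normD _ _) _; rewrite -mulrA mulrDl mulrDr; apply: lerD.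
  rewrite normrM (ger0_norm (expR_ge0 _)); apply: ler_pM => //.
    by apply: le_trans expR_pz; rewrite ler_expR ler_norm.
  apply: le_trans (expR_sub1_le _) _; rewrite mulrAC.
  by apply: ler_pM => //; rewrite ?expR_ge0 ?ler_expR.
apply: le_trans (expR_taylor_remainder _ _) _; rewrite mulrC.
apply: ler_pM; rewrite ?expR_ge0 ?divr_ge0 ?exprn_ge0//.
rewrite -exprMn ler_pdivrMr ?ltr0n ?fact_gt0//.
apply: (@le_trans _ _ ((K * z) ^+ M)).
  by rewrite lerXn2r// nnegrE// mulr_ge0// ltW.
by rewrite ler_peMr ?exprn_ge0 ?mulr_ge0 ?(ltW z0)// ler1n fact_gt0.
Qed.

Lemma taylor_mod_expR M f p : taylor_mod M f p ->
  taylor_mod M (fun z => expR (f z)) (expR p`_0 *: exp_trunc M (p - (p`_0)%:P)).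
Proof.
move=> fp; have -> : (fun z => expR (f z)) = (fun z => expR p`_0 * expR (f z - p`_0)).
  by apply/funext => z; rewrite -expRD addrC subrK.
apply/taylor_modZ/taylor_mod_expR0; first by rewrite coefB coefC subrr.
by apply: taylor_modB => //; exists 0 => z _; rewrite hornerC subrr normr0 mul0r.
Qed.

End TaylorModulo.

Section ToeplitzSymbol.
Context {R : realType}.
Implicit Types g h : nat -> R.

Definition toeplitz_symbol (M : nat) g : {poly R} :=
  \poly_(p < M) (if p == 0%N then 0 else g p).

Definition lower_toeplitz (M : nat) g : 'M[R]_M.+1 :=
  \matrix_(p, q) (if (q < p)%N then g (p - q)%N else 0).

Lemma expr_lower_toeplitz M g i (n : 'I_M.+1) :
  (lower_toeplitz M g ^+ i) n ord0 = (toeplitz_symbol M.+1 g ^+ i)`_n.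
Proof.
elim: i n => [|i IH] n.
  by rewrite !expr0 mxE coef1 -val_eqE/=; case: eqP.
rewrite !exprS mxE coefMr.
rewrite (big_ord_widen M.+1
  (fun j => (toeplitz_symbol M.+1 g)`_(n - j) * (toeplitz_symbol M.+1 g ^+ i)`_j)) ?ltn_ord//.
rewrite [RHS]big_mkcond/=; apply: eq_bigr => q _; rewrite mxE IH ltnS coef_poly.
have -> : (n - q < M.+1)%N by have := ltn_ord n; lia.
case: (ltngtP q n) => [qn|qn|qn].
- by rewrite subn_eq0 leqNgt qn.
- by rewrite mul0r.
- by rewrite qn subnn eqxx.
Qed.

Lemma coef0_toeplitz_symbol M g : (toeplitz_symbol M g)`_0 = 0.
Proof. by rewrite coef_poly; case: ifP. Qed.

Lemma eq_toeplitz_symbol M g h : (forall p, (0 < p)%N -> g p = h p) ->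
  toeplitz_symbol M g = toeplitz_symbol M h.
Proof. by move=> gh; apply: eq_poly => p _; case: p => [|p] //=; exact: gh. Qed.

Lemma toeplitz_symbolZ M (c : R) g :
  toeplitz_symbol M (fun p => c * g p) = c *: toeplitz_symbol M g.
Proof.
apply/polyP => p; rewrite coefZ !coef_poly; case: ifP => _; last by rewrite mulr0.
by case: ifP => _; rewrite ?mulr0.
Qed.

Lemma toeplitz_symbol_sum (I : Type) (s : seq I) M (c : I -> R) (g : I -> nat -> R) :
  toeplitz_symbol M (fun p => \sum_(i <- s) c i * g i p) =
  \sum_(i <- s) c i *: toeplitz_symbol M (g i).
Proof.
apply/polyP => p; rewrite coef_sum coef_poly.
transitivity (\sum_(i <- s) c i * (if (p < M)%N then if p == 0%N then 0 else g i p else 0)).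
  by case: ifP => //; first case: ifP => //; move=> *; rewrite big1// => i _; rewrite mulr0.
by apply: eq_bigr => i _; rewrite coefZ coef_poly.
Qed.

Lemma expr_toeplitz_symbol_ge0 M g i n :
  (forall p, 0 <= g p) -> 0 <= (toeplitz_symbol M g ^+ i)`_n.
Proof.
move=> g0; elim: i n => [|i IH] n; first by rewrite expr0 coef1 ler0n.
rewrite exprS coefM; apply: sumr_ge0 => j _; rewrite mulr_ge0// coef_poly.
by case: ifP => // _; case: ifP.
Qed.

Lemma measurable_expr_toeplitz_symbol d (T : measurableType d) (D : set T) M
    (g : nat -> T -> R) i n :
  (forall p, measurable_fun D (g p)) ->
  measurable_fun D (fun w => (toeplitz_symbol M (g^~ w) ^+ i)`_n).
Proof.
move=> mg; elim: i n => [|i IH] n.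
  by under eq_fun do rewrite expr0 coef1; exact: measurable_cst.
under eq_fun do rewrite exprS coefM.
apply: measurable_sum => j; apply: measurable_funM => //.
under eq_fun do rewrite coef_poly.
case: (j < M)%N; last exact: measurable_cst.
by case: (val j == 0)%N; [exact: measurable_cst|exact: mg].
Qed.

End ToeplitzSymbol.

Section LaplaceMoments.
Context {R : realType} d (T : measurableType d) (P : probability T R).

Lemma pois_laplace_taylor (x z : R) M : 0 <= x -> 0 < z <= 2^-1 ->
  `|expR (- (x * (1 - z))) - \sum_(0 <= n < M) z ^+ n * pois x n| <= 2 ^+ M * z ^+ M.
Proof.
move=> x0 /andP[z0 z2]; have xz0 : 0 <= x * z by rewrite mulr_ge0// ltW.
have -> : expR (- (x * (1 - z))) - \sum_(0 <= n < M) z ^+ n * pois x n =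
    expR (- x) * (expR (x * z) - \sum_(0 <= n < M) (x * z) ^+ n / n`!%:R).
  rewrite [RHS]mulrBr -expRD; congr (expR _ - _); first by ring.
  by rewrite mulr_sumr; apply: eq_bigr => n _; rewrite /pois exprMn; ring.
rewrite normrM (ger0_norm (expR_ge0 _)).
apply: le_trans (ler_wpM2l (expR_ge0 _) (expR_taylor_remainder _ M)) _.
rewrite (ger0_norm xz0) mulrCA -expRD.
have expR_le : expR (- x + x * z) <= expR (- (x / 2)) by rewrite ler_expR; nra.
apply: le_trans (ler_wpM2l _ expR_le) _; first by rewrite divr_ge0// exprn_ge0.
have -> : (x * z) ^+ M = 2 ^+ M * z ^+ M * (x / 2) ^+ M.
  by rewrite -!exprMn; congr (_ ^+ M); field.
rewrite -!mulrA [leLHS]mulrA ler_piMr ?mulr_ge0 ?exprn_ge0 ?(ltW z0)//.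
rewrite mulrA expRN ler_pdivrMr ?expR_gt0// mul1r.
by rewrite pow_fact_le_expR// divr_ge0.
Qed.

Variable X : T -> R.
Hypotheses (mX : measurable_fun setT X) (X_ge0 : forall w, 0 <= X w).

Definition mixed_pois (n : nat) : R := \int[P]_w pois (X w) n.

Lemma measurable_pois n : measurable_fun setT (fun x : R => pois x n).
Proof.
apply: measurable_funM; first by apply: measurable_funM => //; exact: measurable_funX.
by apply: measurableT_comp => //; exact: measurable_funN.
Qed.

Lemma pois_le1 (x : R) n : 0 <= x -> pois x n <= 1.
Proof. by move=> x0; rewrite /pois expRN ler_pdivrMr ?expR_gt0// mul1r pow_fact_le_expR. Qed.

Let integrable_bounded (f : T -> R) (c : R) : measurable_fun setT f ->
  (forall w, `|f w| <= c) -> P.-integrable setT (EFin \o f).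
Proof.
move=> mf fc; apply: measurable_bounded_integrable => //.
  by rewrite (le_lt_trans (probability_le1 P _))// ltry.
exists c; split; first exact: num_real.
by move=> x cx w _ /=; apply: le_trans (fc w) (ltW cx).
Qed.

Let Rintegral_prob_le (f : T -> R) (c : R) : P.-integrable setT (EFin \o f) ->
  (forall w, `|f w| <= c) -> `|\int[P]_w f w| <= c.
Proof.
move=> f_int fc; rewrite -lee_fin EFin_normr_Rintegral//.
apply: le_trans (le_abse_integral P measurableT (measurable_int _ f_int)) _.
rewrite -[leRHS]mule1 -(@probability_setT _ _ _ P) -integral_cst//.
apply: ge0_le_integral => //; first by apply: measurableT_comp (measurable_int _ f_int).
by move=> w _; rewrite lee_fin.
Qed.

Let integrable_pois n : P.-integrable setT (EFin \o (fun w => pois (X w) n)).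
Proof.
apply: (@integrable_bounded _ 1) => [|w]; first exact: measurableT_comp (measurable_pois n) mX.
by rewrite ger0_norm ?pois_ge0 ?pois_le1.
Qed.

Lemma integral_pois n : (\int[P]_w (pois (X w) n)%:E = (mixed_pois n)%:E)%E.
Proof. by rewrite fineK// integrable_fin_num//; exact: integrable_pois. Qed.

Let integrable_pois_sum (z : R) M :
  P.-integrable setT (EFin \o (fun w => \sum_(0 <= n < M) z ^+ n * pois (X w) n)).
Proof. by apply: integrable_EFin_sum => // n; exact: integrable_EFinZl. Qed.

Lemma taylor_mod_laplace M :
  taylor_mod M (fun z => \int[P]_w expR (- (X w * (1 - z)))) (\poly_(n < M) mixed_pois n).
Proof.
exists (2 ^+ M) => z z_itv; have /andP[z0 z2] := z_itv.
have exp_int : P.-integrable setT (EFin \o (fun w => expR (- (X w * (1 - z))))).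
  apply: (@integrable_bounded _ 1) => [|w].
    by apply: measurableT_comp => //; apply: measurable_funN; exact: measurable_funM.
  by rewrite ger0_norm ?expR_ge0// expR_le1 oppr_le0 mulr_ge0//; lra.
have -> : (\poly_(n < M) mixed_pois n).[z] =
    \int[P]_w (\sum_(0 <= n < M) z ^+ n * pois (X w) n).
  rewrite Rintegral_sum//; last by move=> n; exact: integrable_EFinZl.
  by rewrite horner_poly big_mkord; apply: eq_bigr => n _; rewrite RintegralZl// mulrC.
rewrite -RintegralB//; apply: Rintegral_prob_le => [|w].
  exact: integrable_EFinB.
exact: pois_laplace_taylor.
Qed.

Lemma mixed_pois_expR M (h : R -> R) (p : {poly R}) n :
  (forall z, 0 < z <= 2^-1 -> \int[P]_w expR (- (X w * (1 - z))) = expR (h z)) ->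
  taylor_mod M h p -> (n < M)%N ->
  mixed_pois n = expR p`_0 * (exp_trunc M (p - (p`_0)%:P))`_n.
Proof.
move=> lap hp nM; have [C expC] := taylor_mod_expR hp.
rewrite -coefZ -(taylor_mod_coef_eq (taylor_mod_laplace M) _ nM) ?coef_poly ?nM//.
by exists C => z z_itv; rewrite lap// expC.
Qed.

End LaplaceMoments.

Section DecayTaylor.
Context {R : realType}.
Local Notation leb := (@lebesgue_measure R).
Variables (al kap u0 : R).
Hypotheses (al_gt2 : 2 < al) (kap_gt0 : 0 < kap) (u0_gt0 : 0 < u0).
Local Notation J := (decay_int al kap u0).
Local Notation y := (decay al kap).

Lemma geometric_fraction (x z : R) M : 0 <= x -> 0 < z <= 2^-1 ->
  (1 - z) * x / (1 + (1 - z) * x) = x / (1 + x)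
    - \sum_(p < M) z ^+ p.+1 * (x ^+ p.+1 / (1 + x) ^+ p.+2)
    - (x / (1 + x)) ^+ M.+1 * z ^+ M.+1 / (1 + (1 - z) * x).
Proof.
move=> x0 /andP[z0 z2].
have x1 : 1 + x != 0 by rewrite gt_eqF// ltr_pwDl.
have xz1 : 1 + (1 - z) * x != 0 by rewrite gt_eqF// ltr_pwDl// mulr_ge0//; lra.
elim: M => [|M IH].
  by rewrite big_ord0 !expr1; field; rewrite x1 xz1.
rewrite IH big_ord_recr/= [(x / _) ^+ M.+2]exprS [z ^+ M.+2]exprS expr_div_n (exprS _ M.+1).
have xM1 : (1 + x) ^+ M.+1 != 0 by rewrite expf_neq0.
by field; rewrite x1 xz1 xM1.
Qed.

Let decay_ratio_shift z u : decay_ratio al (kap * (1 - z)) 1 1 u =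
  (1 - z) * y u / (1 + (1 - z) * y u).
Proof.
rewrite /decay_ratio !expr1 /decay.
by rewrite (_ : kap * (1 - z) * _ = (1 - z) * (kap * u `^ (- (al / 2))))//; ring.
Qed.

Let decay_taylor_sum M z u := \sum_(p < M) z ^+ p.+1 * decay_ratio al kap p.+1 p.+2 u.

Let decay_taylor_remainder_le M z u : 0 < z <= 2^-1 ->
  `|decay_ratio al (kap * (1 - z)) 1 1 u - (decay_ratio al kap 1 1 u - decay_taylor_sum M z u)|
  <= z ^+ M.+1 * decay_ratio al kap 1 1 u.
Proof.
move=> z_itv; have /andP[z0 z2] := z_itv; have y0 := decay_ge0 al kap_gt0 u.
have frac_ge0 : 0 <= y u / (1 + y u) by rewrite divr_ge0// addr_ge0.
have den_ge1 : 1 <= 1 + (1 - z) * y u by rewrite lerDl mulr_ge0//; lra.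
rewrite decay_ratio_shift (geometric_fraction M y0 z_itv) /decay_taylor_sum /decay_ratio !expr1.
rewrite addrAC subrr add0r normrN ger0_norm; last first.
  by rewrite divr_ge0 ?mulr_ge0 ?exprn_ge0 ?(ltW z0)// (le_trans ler01).
rewrite ler_pdivrMr ?(lt_le_trans ltr01)// [leLHS]mulrC -[leRHS]mulrA.
rewrite ler_wpM2l ?exprn_ge0 ?(ltW z0)//.
apply: (@le_trans _ _ (y u / (1 + y u))); last by rewrite ler_peMr.
rewrite exprS ler_piMr// exprn_ile1// ler_pdivrMr ?mul1r ?lerDr//.
by rewrite ltr_pwDl.
Qed.

Let decay_taylor_sum_integral M z :
  leb.-integrable `[u0, +oo[ (EFin \o decay_taylor_sum M z) /\
  \int[leb]_(u in `[u0, +oo[) decay_taylor_sum M z u =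
  (toeplitz_symbol M.+1 (fun p => J p p.+1)).[z].
Proof.
have ratio_int p := integrable_decay_ratio al_gt2 kap_gt0 u0_gt0 p p.+2.
have term_int p : leb.-integrable `[u0, +oo[
    (EFin \o (fun u => z ^+ p.+1 * decay_ratio al kap p.+1 p.+2 u)).
  exact: integrable_EFinZl.
split; first exact: integrable_EFin_sum.
rewrite Rintegral_sum// horner_poly big_ord_recl/= mul0r add0r; apply: eq_bigr => p _.
by rewrite RintegralZl// mulrC.
Qed.

Lemma taylor_mod_decay_int M : taylor_mod M.+1
  (fun z => decay_int al (kap * (1 - z)) u0 1 1)
  ((J 1 1)%:P - toeplitz_symbol M.+1 (fun p => J p p.+1)).
Proof.
exists (J 1 1) => z z_itv; have /andP[z0 z2] := z_itv.
have kz0 : 0 < kap * (1 - z) by rewrite mulr_gt0//; lra.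
rewrite hornerD hornerN hornerC; have [sum_int <-] := decay_taylor_sum_integral M z.
have ratio_int := integrable_decay_ratio al_gt2 kap_gt0 u0_gt0 0 1.
have shift_int := integrable_decay_ratio al_gt2 kz0 u0_gt0 0 1.
have diff_int : leb.-integrable `[u0, +oo[
    (EFin \o (fun u => decay_ratio al kap 1 1 u - decay_taylor_sum M z u)).
  exact: integrable_EFinB.
rewrite -RintegralB// -RintegralB//.
have rem_int : leb.-integrable `[u0, +oo[ (EFin \o (fun u => decay_ratio al (kap * (1 - z)) 1 1 u
    - (decay_ratio al kap 1 1 u - decay_taylor_sum M z u))).
  exact: integrable_EFinB.
apply: le_trans (le_normr_Rintegral _ rem_int) _ => //.
rewrite [leRHS]mulrC -RintegralZl//; apply: le_Rintegral => // [||u _].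
- exact: integrable_norm rem_int.
- exact: integrable_EFinZl.
- exact: decay_taylor_remainder_le.
Qed.

End DecayTaylor.

(** * Tail integrals *)

Section HalfLineSets.
Context {R : realType}.

Lemma Ioo0inf_gt0 (b : R) : Ioo0inf b -> 0 < b.
Proof. by rewrite /Ioo0inf/= in_itv/= andbT. Qed.

Lemma Ioc0_gt0 (r x : R) : Ioc0 r x -> 0 < x.
Proof. by rewrite /Ioc0/= in_itv/= => /andP[]. Qed.

Lemma measurable_Ioo0inf : measurable (Ioo0inf : set (measurableTypeR R)).
Proof. exact: measurable_itv. Qed.

Lemma measurable_Ioc0 (r : R) : measurable (Ioc0 r : set (measurableTypeR R)).
Proof. exact: measurable_itv. Qed.

End HalfLineSets.

Section LayerCake.
Context {R : realType}.
Local Notation leb := (@lebesgue_measure R).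

Lemma integral_ln1p (s : R) : 0 <= s ->
  (\int[leb]_(b in Ioo0inf) (((b < s)%R%:R / (1 + b)))%:E = (ln (1 + s))%:E)%E.
Proof.
move=> s0.
have -> : (\int[leb]_(b in Ioo0inf) ((b < s)%R%:R / (1 + b))%:E =
    \int[leb]_(b in `]0%R, s[) ((1 + b)^-1)%:E)%E.
  rewrite [LHS]integral_mkcond [RHS]integral_mkcond; apply: eq_integral => b _.
  rewrite !patchE /Ioo0inf !mem_setE !in_itv/= andbT.
  by case: ltP => //= b0; case: ltP => //= bs; rewrite ?mul1r ?mul0r.
have minv (D : set R) : measurable_fun D (EFin \o (fun b : R => (1 + b)^-1)).
  by apply/measurable_EFinP/measurable_funTS/measurable_funV; exact: measurable_funD.
rewrite integral_itv_bndo_bndc// integral_itv_obnd_cbnd//.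
have [->|s_neq0] := eqVneq s 0; first by rewrite set_itv1 integral_set1 addr0 ln1.
apply: etrans (@integral_is_derive _ (fun b => (1 + b)^-1) (fun b => ln (1 + b)) 0 s _ _ _) _.
- by rewrite lt_neqAle eq_sym s_neq0.
- move=> b /andP[b0 _]; have b1 : 0 < 1 + b by rewrite ltr_pwDl.
  have d1 : is_derive b 1 (fun b : R => 1 + b) (0 + 1) by exact: is_deriveD.
  have := @is_derive1_comp _ (@ln R) _ _ _ _ (is_derive1_ln b1) d1.
  by rewrite add0r mulr1.
- move=> b /andP[b0 _]; apply: cvgV; first by rewrite gt_eqF// ltr_pwDl.
  by apply: cvgD; [exact: cvg_cst|exact: cvg_id].
- by rewrite addr0 ln1 subr0.
Qed.

Lemma layer_cake_ln1p d (T : measurableType d) (P : {sigma_finite_measure set T -> \bar R})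
    (S : T -> R) : measurable_fun setT S -> (forall w, 0 <= S w) ->
  (\int[P]_w (ln (1 + S w))%:E =
   \int[leb]_(b in Ioo0inf) (P [set w | (b < S w)%R] * ((1 + b)^-1)%:E))%E.
Proof.
move=> mS S0; pose f (z : T * measurableTypeR R) : \bar R := ((z.2 < S z.1)%R%:R / (1 + z.2))%:E.
have mlt : measurable_fun setT (fun z : T * measurableTypeR R => (z.2 < S z.1)%R).
  apply: (@measurable_fun_ltr _ _ R setT snd (fun z => S z.1)); first exact: measurable_snd.
  exact: measurableT_comp mS measurable_fst.
have mf : measurable_fun (setT `*` Ioo0inf) f.
  apply/measurable_EFinP/measurable_funTS; apply: measurable_funM.
    rewrite (_ : (fun z => _) = fun z => if (z.2 < S z.1)%R then 1 else 0).
      exact: measurable_fun_ifT.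
    by apply/funext => z; case: ifP.
  apply: (measurable_funV (f := fun z : T * measurableTypeR R => 1 + z.2)).
  apply: (@measurable_funD _ _ R setT (cst 1) snd); first exact: measurable_cst.
  exact: measurable_snd.
have f0 w b : setT w -> Ioo0inf b -> (0 <= f (w, b))%E.
  by move=> _ /Ioo0inf_gt0 b0; rewrite lee_fin divr_ge0// addr_ge0// ltW.
under eq_integral do rewrite -integral_ln1p//.
rewrite (fubini_tonelli_on _ _ measurableT measurable_Ioo0inf mf f0).
apply: eq_integral => b /set_mem bI.
have b1 : 0 <= (1 + b)^-1 by rewrite invr_ge0 addr_ge0// ltW// Ioo0inf_gt0.
have mbS : measurable [set w | (b < S w)%R].
  by have := measurable_preimage mS (measurable_itv `]b, +oo[);
    congr measurable; apply/seteqP; split => w /=; rewrite in_itv/= andbT.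
transitivity (\int[P]_w (((1 + b)^-1)%:E * (\1_[set w | b < S w] w)%:E))%E.
  apply: eq_integral => w _; rewrite /f/= EFinM muleC indicE.
  by rewrite (_ : (w \in _) = (b < S w)%R)//; apply/idP/idP => [/set_mem//|/mem_set].
rewrite ge0_integralZl_EFin//.
- by rewrite integral_indic// setIT muleC.
- by apply/measurable_EFinP; exact: measurable_indic.
Qed.

End LayerCake.

Section ErlangTail.
Context {R : realType}.
Local Notation leb := (@lebesgue_measure R).

Let fact_neq0 n : n`!%:R != 0 :> R.
Proof. by rewrite pnatr_eq0 -lt0n fact_gt0. Qed.

Definition erlang_tail (M : nat) (y : R) : R := \sum_(0 <= m < M) pois y m.

Lemma erlang_tail_ge0 M y : 0 <= y -> 0 <= erlang_tail M y.
Proof. by move=> y0; apply: sumr_ge0 => m _; exact: pois_ge0. Qed.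

Lemma is_derive_pois0 (y : R) : is_derive y 1 (fun h => pois h 0) (- pois y 0).
Proof.
have poisE : (fun h : R => pois h 0) = (fun h => expR (- h)).
  by apply/funext => h; rewrite /pois expr0 fact0 divr1 mul1r.
rewrite poisE /pois expr0 fact0 divr1 mul1r.
have dN : is_derive y 1 (fun h : R => - h) (-1) by exact: is_deriveN.
by have := @is_derive1_comp _ (@expR R) _ y _ _ (is_derive_expR _) dN; rewrite mulrN1.
Qed.

Lemma is_derive_poisS n (y : R) : is_derive y 1 (fun h => pois h n.+1) (pois y n - pois y n.+1).
Proof.
have poisE : (fun h : R => pois h n.+1) = (fun h => h ^+ n.+1 * (n.+1`!%:R^-1 * pois h 0)).
  by apply/funext => h; rewrite /pois expr0 fact0 divr1 mul1r mulrA.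
have d0 := is_derive_pois0 y.
have dX : is_derive y 1 (fun h : R => h ^+ n.+1) (n.+1%:R * y ^+ n * 1).
  by apply: is_derive_exprn; exact: is_derive_id.
rewrite poisE; apply: is_derive_eq; rewrite /GRing.scale/= /pois !expr0 fact0 factS natrM exprS.
have Sn_neq0 : n.+1%:R != 0 :> R by rewrite pnatr_eq0.
by move: (n.+1%:R) Sn_neq0 => q q0; field; rewrite fact_neq0 q0.
Qed.

Lemma is_derive_erlang_tail M (y : R) : is_derive y 1 (erlang_tail M.+1) (- pois y M).
Proof.
elim: M => [|M IH].
  rewrite (_ : erlang_tail 1 = fun h => pois h 0); first exact: is_derive_pois0.
  by apply/funext => h; rewrite /erlang_tail big_nat1.
rewrite (_ : erlang_tail M.+2 = fun h => erlang_tail M.+1 h + pois h M.+1); last first.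
  by apply/funext => h; rewrite /erlang_tail big_nat_recr.
have dS := is_derive_poisS M y.
by apply: is_derive_eq; ring.
Qed.

Lemma measurable_erlang_tail M : measurable_fun setT (erlang_tail M).
Proof. by apply: measurable_sum => m; exact: measurable_pois. Qed.

Lemma cvg_pois n : pois y n @[y --> +oo] --> (0 : R).
Proof.
apply: (@squeeze_cvgr _ _ _ _ (fun=> 0) (fun y : R => n.+1%:R * y `^ (- 1))).
- near=> y; have y0 : 0 < y by near: y; exact: nbhs_pinfty_gt.
  rewrite pois_ge0 ?(ltW y0)//= powR_inv1 ?(ltW y0)// ler_pdivlMr//.
  rewrite /pois expRN mulrAC ler_pdivrMr ?expR_gt0//.
  apply: le_trans (ler_wpM2l (ler0n _ _) (pow_fact_le_expR n.+1 (ltW y0))).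
  rewrite le_eqVlt factS natrM exprSr; apply/orP; left; apply/eqP.
  have Sn_neq0 : n.+1%:R != 0 :> R by rewrite pnatr_eq0.
  by move: (n.+1%:R) Sn_neq0 => q q0; field; rewrite fact_neq0 q0.
- exact: cvg_cst.
- by rewrite -[X in _ --> X](mulr0 n.+1%:R); apply: cvgMr; exact: cvg_powRN.
Unshelve. all: by end_near. Qed.

Lemma cvg_erlang_tail M : erlang_tail M y @[y --> +oo] --> (0 : R).
Proof.
elim: M => [|M IH].
  rewrite (_ : erlang_tail 0 = cst 0); first exact: cvg_cst.
  by apply/funext => h; rewrite /erlang_tail big_geq.
rewrite (_ : erlang_tail M.+1 = fun y => erlang_tail M y + pois y M); last first.
  by apply/funext => h; rewrite /erlang_tail big_nat_recr.
by rewrite -[0]addr0; apply: cvgD => //; exact: cvg_pois.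
Qed.

Lemma integral_pois_tail M (y : R) : 0 <= y ->
  (\int[leb]_(h in `]y, +oo[) (pois h M)%:E = (erlang_tail M.+1 y)%:E)%E.
Proof.
move=> y0; rewrite integral_itv_obnd_cbnd; last first.
  by apply/measurable_EFinP/measurable_funTS; exact: measurable_pois.
apply: etrans (@ge0_integral_is_derivey _ (pois^~ M) (fun h => - erlang_tail M.+1 h) y 0 _ _ _ _) _.
- by move=> h yh; rewrite pois_ge0// (le_trans y0).
- by move=> h _; rewrite -[pois h M]opprK; apply: is_deriveN; exact: is_derive_erlang_tail.
- move=> h _; case: M => [|n]; apply: is_derive1_continuous.
    exact: is_derive_pois0.
  exact: is_derive_poisS.
- by rewrite -oppr0; apply: cvgN; exact: cvg_erlang_tail.
- by rewrite sub0r opprK.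
Qed.

Lemma erlang_tailD M (a b : R) : erlang_tail M (a + b) =
  \sum_(0 <= m < M) \sum_(0 <= n < m.+1) pois a (m - n) * pois b n.
Proof.
apply: eq_bigr => m _; rewrite /pois exprDn opprD expRD !mulr_suml big_mkord.
apply: eq_bigr => n _; have nm : (n <= m)%N by rewrite -ltnS.
have bin_neq0 : 'C(m, n)%:R != 0 :> R by rewrite pnatr_eq0 -lt0n bin_gt0.
have -> : m`!%:R = 'C(m, n)%:R * (n`!%:R * (m - n)`!%:R) :> R.
  by rewrite -!natrM bin_fact.
by rewrite -[_ *+ 'C(m, n)]mulr_natr; field; rewrite bin_neq0 !fact_neq0.
Qed.

Lemma integral_erlang_tailD d (T : measurableType d) (P : probability T R) (a : R) (Y : T -> R) M :
  0 <= a -> measurable_fun setT Y -> (forall w, 0 <= Y w) ->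
  (\int[P]_w (erlang_tail M (a + Y w))%:E =
   (\sum_(0 <= m < M) \sum_(0 <= n < m.+1) pois a (m - n) * mixed_pois P Y n)%:E)%E.
Proof.
move=> a0 mY Y0.
have term_ge0 m n w : 0 <= pois a (m - n) * pois (Y w) n by rewrite mulr_ge0 ?pois_ge0.
have mpoisY n : measurable_fun setT (fun w => pois (Y w) n).
  exact: (measurableT_comp (measurable_pois n) mY).
have mterm m n : measurable_fun setT (fun w => pois a (m - n) * pois (Y w) n).
  exact: measurable_funM.
under eq_integral do rewrite erlang_tailD -sumEFin.
rewrite ge0_integral_sum//; first last.
- by move=> m w _; rewrite lee_fin sumr_ge0.
- by move=> m; apply/measurable_EFinP; exact: measurable_sum.
rewrite -sumEFin; apply: eq_bigr => m _; under eq_integral do rewrite -sumEFin.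
rewrite ge0_integral_sum//; first last.
- by move=> n w _; rewrite lee_fin.
- by move=> n; exact/measurable_EFinP.
rewrite -sumEFin; apply: eq_bigr => n _; under eq_integral do rewrite EFinM.
rewrite ge0_integralZl_EFin ?pois_ge0//; first by rewrite integral_pois.
- by move=> w _; rewrite lee_fin pois_ge0.
- exact/measurable_EFinP.
Qed.

End ErlangTail.

Section LaplaceAlmostSurely.
Context d (T : measurableType d) (R : realType) (P : probability T R).
Variables (Y : T -> \bar R) (L : R -> R).
Hypotheses (mY : measurable_fun setT Y) (Y_ge0 : forall w, (0 <= Y w)%E).
Hypothesis laplaceY : forall t, 0 < t ->
  (\int[P]_w (expN (t%:E * Y w))%:E = (expR (- L t))%:E)%E.

Let measurable_laplace t : measurable_fun setT (fun w => (expN (t%:E * Y w))%:E).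
Proof.
by apply/measurable_EFinP; apply: (measurableT_comp measurable_expN); exact: measurable_funeM.
Qed.

Let measurable_level (v : \bar R) : measurable [set w | Y w = v].
Proof. exact: measurable_preimage mY (emeasurable_set1 v). Qed.

Let prob_infty_le t : 0 < t -> fine (P [set w | Y w = +oo%E]) <= L t.
Proof.
move=> t0; set A := [set w | _]; have mA : measurable A by exact: measurable_level.
have : ((expR (- L t))%:E <= P (~` A))%E.
  rewrite -laplaceY// -(setIT (~` A)) -integral_indic//; last exact: measurableC.
  apply: ge0_le_integral => //.
  - by move=> w _; rewrite lee_fin expN_ge0.
  - by apply/measurable_EFinP; apply: measurable_indic; exact: measurableC.
  - move=> w _; rewrite lee_fin indicE; case: (boolP (w \in ~` A)) => [_|].
      by rewrite expN_le1// mule_ge0// lee_fin ltW.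
    by rewrite notin_setE => /contrapT ->; rewrite gt0_muley ?lte_fin.
rewrite probability_setC// -(fineK (fin_num_measure P _ mA)) -EFinB lee_fin.
have := expR_ge1Dx (- L t); lra.
Qed.

Let prob_zero_le t : 0 < t -> fine (P [set w | Y w = 0%E]) <= expR (- L t).
Proof.
move=> t0; set A := [set w | _]; have mA : measurable A by exact: measurable_level.
rewrite -lee_fin fineK ?fin_num_measure// -laplaceY// -(setIT A) -integral_indic//.
apply: ge0_le_integral => //; first by apply/measurable_EFinP; exact: measurable_indic.
move=> w _; rewrite lee_fin indicE; case: (boolP (w \in A)) => [/set_mem ->|_].
  by rewrite mule0 expN_EFin oppr0 expR0.
exact: expN_ge0.
Qed.

Let null_level v : (forall e, 0 < e -> fine (P [set w | Y w = v]) <= e) ->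
  P [set w | Y w = v] = 0%E.
Proof.
move=> Pv; have fin := fin_num_measure P _ (measurable_level v).
rewrite -(fineK fin); congr EFin; apply/le_anti; rewrite fine_ge0// andbT.
by apply/ler_addgt0Pr => e e0; rewrite add0r Pv.
Qed.

Lemma ae_fin_laplace : (exists C, forall t, 0 < t -> L t <= t * C) ->
  {ae P, forall w, (Y w < +oo)%E}.
Proof.
move=> [C LC]; exists [set w | Y w = +oo%E]; split; first exact: measurable_level.
- apply: null_level => e e0; have C1 : 0 < `|C| + 1 by rewrite ltr_wpDl.
  apply: le_trans (prob_infty_le (divr_gt0 e0 C1)) _.
  apply: le_trans (LC _ (divr_gt0 e0 C1)) _.
  rewrite mulrAC ler_pdivrMr// ler_wpM2l ?(ltW e0)//.
  by rewrite (le_trans (ler_norm C))// lerDl.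
- by move=> w /= /negP; rewrite -leNgt leye_eq => /eqP.
Qed.

Lemma ae_gt0_laplace : (forall B, exists2 t, 0 < t & B <= L t) -> {ae P, forall w, (0 < Y w)%E}.
Proof.
move=> LB; exists [set w | Y w = 0%E]; split; first exact: measurable_level.
- apply: null_level => e e0; have [t t0 Lt] := LB (- ln e).
  apply: le_trans (prob_zero_le t0) _.
  by rewrite -[leRHS](lnK (x := e)) ?posrE// ler_expR lerNl.
- by move=> w /= /negP; rewrite -leNgt => Y0; apply/eqP; rewrite eq_le Y0 Y_ge0.
Qed.

End LaplaceAlmostSurely.

(** * The network *)

Section PowerFunctions.
Context {R : realType}.

Lemma measurable_powR_sum (I : Type) (s : seq I) (a b : I -> R) :
  measurable_fun setT (fun x : R => \sum_(j <- s) a j * x `^ b j).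
Proof.
by apply: measurable_sum => j; apply: measurable_funM => //; exact: measurable_powR.
Qed.

Lemma cvg_powR_seq (b x : R) (u : R^nat) : 0 < x -> u @ \oo --> x ->
  u n `^ b @[n --> \oo] --> x `^ b.
Proof.
move=> x0 ux.
have cont : {for x, continuous (fun y : R => expR (b * ln y))}.
  apply: (@continuous_comp _ _ _ (fun y : R => b * ln y) expR); last exact: continuous_expR.
  by apply: cvgMr; exact: continuous_ln.
have := @cvg_comp _ _ _ u (fun y : R => expR (b * ln y)) _ _ _ ux cont.
rewrite [x `^ b]/powR (gt_eqF x0); apply: cvg_trans; apply: near_eq_cvg.
near=> n; rewrite /powR gt_eqF//.
by near: n; apply: (cvgr_gt x).
Unshelve. all: by end_near. Qed.

End PowerFunctions.

Section EventFamilies.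
Context {R : realType} d (T : measurableType d).
Local Notation pt := ((R * R) * R)%type.

Lemma events_of_real_measurable (X : T -> R) : measurable_fun setT X ->
  events_of_real X `<=` measurable.
Proof. by move=> mX _ [A mA ->]; exact: measurable_preimage. Qed.

Lemma events_of_real_setT (X : T -> R) : events_of_real X setT.
Proof. by exists setT; rewrite ?preimage_setT. Qed.

Lemma events_of_real_setI (X : T -> R) : setI_closed (events_of_real X).
Proof.
by move=> _ _ [A mA ->] [B mB ->]; exists (A `&` B); [exact: measurableI|rewrite preimage_setI].
Qed.

Variable N : T -> {measure set pt -> \bar R}.

Lemma events_of_pp_measurable :
  (forall B, measurable B -> measurable_fun setT (fun w => N w B : \bar R)) ->
  events_of_pp N `<=` measurable.
Proof.
move=> mN; apply: smallest_sub; first exact: sigma_algebra_measurable.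
by move=> _ [B [S [mB mS ->]]]; exact: measurable_preimage (mN B mB) mS.
Qed.

Lemma events_of_pp_setT : events_of_pp N setT.
Proof. exact: (@measurableT _ (g_sigma_algebraType _)). Qed.

Lemma events_of_pp_setI : setI_closed (events_of_pp N).
Proof. exact: (@measurableI _ (g_sigma_algebraType _)). Qed.

Lemma events_of_pp_count B S : measurable B -> measurable S ->
  events_of_pp N ((fun w => N w B) @^-1` S).
Proof. by move=> mB mS; apply: sub_sigma_algebra; exists B, S. Qed.

End EventFamilies.

Section Network.
Context {R : realType}.
Local Notation pt := ((R * R) * R)%type.
Local Notation leb := (@lebesgue_measure R).
Variables (K : nat) (lam Pw Bb alpha : 'I_K -> R) (Mant : 'I_K -> nat)
  (lam_u eps W : R) (k : 'I_K).
Hypotheses (lam_gt0 : forall j, 0 < lam j) (lam_u_gt0 : 0 < lam_u)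
  (Pw_gt0 : forall j, 0 < Pw j) (Bb_gt0 : forall j, 0 < Bb j)
  (alpha_gt2 : forall j, 2 < alpha j) (Mant_gt0 : forall j, (0 < Mant j)%N)
  (eps_gt0 : 0 < eps) (W_ge0 : 0 <= W).

Local Notation Om := (Omega Pw Bb Mant).
Local Notation de := (delta alpha).
Local Notation Rd := (Rad Pw Bb alpha Mant eps).
Local Notation excl := (excl_radius Pw Bb alpha Mant).
Local Notation assoc := (assoc_exp lam Pw Bb alpha Mant).
Local Notation Act := (Aact lam Pw Bb alpha Mant lam_u eps).
Local Notation phi := (phif Bb alpha Mant).
Local Notation tau := (tauf Bb Mant).
Local Notation gk := (gf lam Pw Bb alpha Mant lam_u eps k).

Lemma alpha_gt0 j : 0 < alpha j.
Proof. exact: lt_trans (alpha_gt2 j). Qed.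

Lemma Mant_natr_gt0 j : 0 < (Mant j)%:R :> R.
Proof. by rewrite ltr0n. Qed.

Lemma Omega_gt0 j : 0 < Om j.
Proof. by rewrite /Omega !mulr_gt0 ?Mant_natr_gt0. Qed.

Lemma Omega_ratio_gt0 i j : 0 < Om i / Om j.
Proof. by rewrite divr_gt0// Omega_gt0. Qed.

Lemma delta_gt0 j : 0 < de j.
Proof. by rewrite divr_gt0// alpha_gt0. Qed.

Lemma delta_ratio_ge0 i j : 0 <= de i / de j.
Proof. by rewrite divr_ge0// ltW// delta_gt0. Qed.

Lemma Rad_gt0 j : 0 < Rd j.
Proof. by rewrite powR_gt0// divr_gt0// Omega_gt0. Qed.

Lemma tauf_gt0 i j b : 0 < b -> 0 < tau i j b.
Proof. by move=> b0; rewrite !divr_gt0// mulr_gt0// divr_gt0// Mant_natr_gt0. Qed.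

Lemma measurable_assoc_exp j : measurable_fun setT (assoc j).
Proof.
apply: measurableT_comp => //; apply: measurable_funN; apply: measurable_funM => //.
exact: measurable_powR_sum.
Qed.

Lemma assoc_exp_le1 j x : assoc j x <= 1.
Proof.
rewrite expR_le1 oppr_le0 mulr_ge0 ?pi_ge0// sumr_ge0// => i _.
by rewrite !mulr_ge0 ?powR_ge0// ltW.
Qed.

Lemma assoc_exp_nincr j x y : 0 <= x -> x <= y -> assoc j y <= assoc j x.
Proof.
move=> x0 xy; rewrite ler_expR lerN2 ler_pM2l ?pi_gt0//; apply: ler_sum => i _.
apply: ler_wpM2l; first by rewrite mulr_ge0 ?powR_ge0// ltW.
by apply: ge0_ler_powR; rewrite ?delta_ratio_ge0 ?nnegrE// (le_trans x0).
Qed.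

Lemma assoc_int_gt0 j : 0 < assoc_int lam Pw Bb alpha Mant eps j.
Proof.
set r := Rd j ^+ 2; have r0 : 0 < r by rewrite exprn_gt0// Rad_gt0.
have integrable_bounded (f : R -> R) : measurable_fun setT f -> (forall x, `|f x| <= 1) ->
    leb.-integrable `[0, r] (EFin \o f).
  move=> mf f1; apply: measurable_bounded_integrable => //.
  - by rewrite /= lebesgue_measure_itv/= lte_fin r0 sube0 ltry.
  - exact: measurable_funTS.
  - by exists 1; split; [exact: num_real|move=> x x1 u _ /=; exact: le_trans (f1 u) (ltW x1)].
apply: (@lt_le_trans _ _ (\int[leb]_(x in `[0, r]) assoc j r)).
  by rewrite Rintegral_cst//= lebesgue_measure_itv/= lte_fin r0 sube0/= mulr_gt0// expR_gt0.
apply: le_Rintegral.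
- exact: measurable_itv.
- by apply: integrable_bounded => [//|x]; rewrite ger0_norm ?expR_ge0 ?assoc_exp_le1.
- apply: integrable_bounded => [|x]; first exact: measurable_assoc_exp.
  by rewrite ger0_norm ?expR_ge0 ?assoc_exp_le1.
- by move=> x; rewrite /= in_itv/= => /andP[]; exact: assoc_exp_nincr.
Qed.

Lemma Tassoc_gt0 j : 0 < Tassoc lam Pw Bb alpha Mant eps j.
Proof. by rewrite !mulr_gt0 ?pi_gt0// assoc_int_gt0. Qed.

Lemma Aact_gt0 j : 0 < Act j.
Proof. by rewrite /Aact subr_gt0 expR_lt1 oppr_lt0 !mulr_gt0 ?pi_gt0 ?assoc_int_gt0. Qed.

Lemma excl_radius_gt0 i j (x : R) : 0 < x -> 0 < excl i j x.
Proof. by move=> x0; rewrite mulr_gt0// powR_gt0// Omega_ratio_gt0. Qed.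

Lemma excl_radius_homo i j (x y : R) : 0 <= x -> x <= y -> excl i j x <= excl i j y.
Proof.
move=> x0 xy; rewrite ler_wpM2l ?powR_ge0//.
have ratio_ge0 : 0 <= alpha j / alpha i by rewrite divr_ge0// ltW// alpha_gt0.
by apply: ge0_ler_powR; rewrite ?nnegrE// (le_trans x0).
Qed.

Lemma cvg_excl_radius i j (x : R) : 0 < x ->
  excl i j (updyadic n x) @[n --> \oo] --> excl i j x.
Proof.
by move=> x0; apply: cvgMr; apply: cvg_powR_seq => //; apply: cvg_updyadic; rewrite ltW.
Qed.

Lemma excl_radius_lt0 i j (x : R) : x < 0 -> excl i j x = excl i j (-1).
Proof.
move=> x0; rewrite /excl_radius /powR oppr_eq0 oner_eq0 (lt_eqF x0).
by rewrite (ln0 (ltW x0)) (ln0 (lerN10 R)).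
Qed.

Lemma excl_radius_sqr i j (x : R) : 0 <= x ->
  excl i j x ^+ 2 = (Om i / Om j) `^ de i * (x ^+ 2) `^ (de i / de j).
Proof.
move=> x0.
have sqr_powR (y p : R) : (y `^ p) ^+ 2 = y `^ (p * 2).
  by rewrite -powR_mulrn ?powR_ge0// -powRrM.
rewrite exprMn !sqr_powR -[in RHS](powR_mulrn 2 x0) -[in RHS]powRrM; congr (_ `^ _ * _ `^ _).
  by rewrite mulrC.
by rewrite /delta; field; rewrite !gt_eqF// alpha_gt0.
Qed.

Definition path_gain (x b : R) : R := b * x `^ alpha k / Pw k.

Lemma path_gain_ge0 x b : 0 < b -> 0 <= path_gain x b.
Proof. by move=> b0; rewrite divr_ge0 ?(ltW (Pw_gt0 k))// mulr_ge0 ?powR_ge0// ltW. Qed.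

Lemma path_gain_gt0 x b : 0 < x -> 0 < b -> 0 < path_gain x b.
Proof. by move=> x0 b0; rewrite divr_gt0// mulr_gt0// powR_gt0. Qed.

Lemma decay_excl_radius j (x b : R) : 0 < x ->
  decay (alpha j) (path_gain x b * Pw j) (excl j k x ^+ 2) = tau j k b.
Proof.
move=> x0; rewrite excl_radius_sqr ?(ltW x0)// /decay powRM ?powR_ge0// -!powRrM.
have alpha_neq0 i : alpha i != 0 by rewrite gt_eqF// alpha_gt0.
rewrite (_ : de j * - (alpha j / 2) = -1); last by rewrite /delta; field; rewrite alpha_neq0.
rewrite -powR_mulrn ?(ltW x0)// -powRrM.
rewrite (_ : 2%:R * (de j / de k * - (alpha j / 2)) = - alpha k); last first.
  by rewrite /delta; field; rewrite !alpha_neq0.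
rewrite powR_inv1 ?(ltW (Omega_ratio_gt0 _ _))// powRN /tauf /Omega /path_gain.
have := powR_gt0 (alpha k) x0; move: (x `^ alpha k) => y y0.
by field; rewrite !gt_eqF ?Mant_natr_gt0.
Qed.

Lemma decay_int_phif j n (kap u0 b : R) : 0 < kap -> 0 < u0 ->
  decay (alpha j) kap u0 = tau j k b ->
  decay_int (alpha j) kap u0 (maxn n 1) n.+1 = u0 * phi j k n b.
Proof.
move=> kap0 u00 decayE; rewrite /phif; case: n => [|n].
  by rewrite (decay_int_hyp2F1 (alpha_gt2 j) kap0 u00 0 0) decayE.
by rewrite (maxn_idPl (ltn0Sn n)) (decay_int_hyp2F1 (alpha_gt2 j) kap0 u00 n n.+1) decayE.
Qed.

Lemma phif_decay_int j n b : 0 < b ->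
  phi j k n b = decay_int (alpha j) (tau j k b) 1 (maxn n 1) n.+1.
Proof.
move=> b0; rewrite (@decay_int_phif _ _ _ _ b) ?mul1r ?tauf_gt0//.
by rewrite /decay powR1 mulr1.
Qed.

(* The (n, n+1) decay integral, except that n = 0 stands for the (1, 1) one. *)
Lemma gf_decay_int n (x b : R) : 0 < x -> 0 < b -> pi * gk n (x ^+ 2) b =
  \sum_(j < K) Act j * lam j * pi *
    decay_int (alpha j) (path_gain x b * Pw j) (excl j k x ^+ 2) (maxn n 1) n.+1.
Proof.
move=> x0 b0; rewrite /gf mulr_sumr; apply: eq_bigr => j _.
have kap_gt0 : 0 < path_gain x b * Pw j by rewrite mulr_gt0// path_gain_gt0.
have radius_gt0 : 0 < excl j k x ^+ 2 by rewrite exprn_gt0// excl_radius_gt0.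
rewrite (decay_int_phif n kap_gt0 radius_gt0 (decay_excl_radius j b x0)).
by rewrite excl_radius_sqr ?(ltW x0)//; ring.
Qed.

Lemma phif_ge0 j n b : 0 < b -> 0 <= phi j k n b.
Proof. by move=> b0; rewrite phif_decay_int// decay_int_ge0// tauf_gt0. Qed.

Lemma gf_ge0 n y b : 0 < b -> 0 <= gk n y b.
Proof.
move=> b0; apply: sumr_ge0 => j _; rewrite mulr_ge0 ?powR_ge0// mulr_ge0 ?phif_ge0//.
by rewrite !mulr_ge0 ?powR_ge0// ltW// Aact_gt0.
Qed.

Section Interference.
Context d (T : measurableType d) (N : 'I_K -> T -> {measure set pt -> \bar R}).
Hypothesis measurable_count :
  forall j B, measurable B -> measurable_fun setT (fun w => N j w B : \bar R).
Local Notation I_ x w := (interference Pw Bb alpha Mant k (fun=> x) N w).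

Lemma interference_ge0 (X : T -> R) w : (0 <= interference Pw Bb alpha Mant k X N w)%E.
Proof. by apply: sume_ge0 => j _; exact: tier_interference_ge0 (ltW (Pw_gt0 j)). Qed.

Lemma measurable_interference_cst (x : R) : measurable_fun setT (fun w => I_ x w).
Proof.
apply: emeasurable_sum => j.
exact: (measurable_tier_interference _ _ (ltW (Pw_gt0 j)) (measurable_count j)).
Qed.

Lemma interference_nincr (x y : R) w : 0 <= x -> x <= y -> (I_ y w <= I_ x w)%E.
Proof.
move=> x0 xy; apply: lee_sum => j _.
by apply: tier_interference_nincr; [exact: ltW|exact: excl_radius_homo].
Qed.

Lemma cvg_interference (x : R) w : 0 < x -> I_ (updyadic n x) w @[n --> \oo] --> I_ x w.
Proof.
move=> x0; apply: (@cvg_nnesum _ _ _ _ _ _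
  (fun j n => tier_interference (Pw j) (alpha j) (excl j k (updyadic n x)) (N j w))) => j _.
  by apply: nearW => n; exact: tier_interference_ge0 (ltW (Pw_gt0 j)).
have up0 n : 0 <= updyadic n x by apply: ltW; exact: lt_trans (updyadic_gt _ _).
apply: cvg_tier_interference; first exact: ltW.
- by move=> n; apply: excl_radius_homo => //; rewrite ltW// updyadic_gt.
- by move=> m n mn; apply: excl_radius_homo => //; exact: updyadic_nincr.
- exact: cvg_excl_radius.
Qed.

Lemma measurable_interference (X : T -> R) : measurable_fun setT X ->
  measurable_fun setT (fun w => interference Pw Bb alpha Mant k X N w).
Proof.
move=> mX; pose X' w := if 0 < X w then X w else 1.
have mX' : measurable_fun setT X'.
  by apply: measurable_fun_ifT => //; exact: measurable_fun_ltr.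
have mI : measurable_fun setT (fun w => I_ (X' w) w).
  apply: (measurable_fun_eval mX' measurable_interference_cst) => w.
  by apply: cvg_interference; rewrite /X'; case: ifP.
rewrite (_ : (fun w => _) = fun w => if 0 < X w then I_ (X' w) w else
    if X w < 0 then I_ (-1) w else I_ 0 w).
  apply: measurable_fun_ifT => //; first exact: measurable_fun_ltr.
  apply: measurable_fun_ifT; first exact: measurable_fun_ltr.
    exact: measurable_interference_cst.
  exact: measurable_interference_cst.
apply/funext => w; rewrite /X' /interference; case: (ltgtP 0 (X w)) => [//|X0|<-//].
by apply: eq_bigr => j _; rewrite (excl_radius_lt0 _ _ X0).
Qed.

Definition fading_threshold (X : T -> R) (b : R) (w : T) : R :=
  path_gain (X w) b * (fine (interference Pw Bb alpha Mant k X N w) + W).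

Lemma fading_threshold_ge0 X b w : 0 < b -> 0 <= fading_threshold X b w.
Proof.
move=> b0; rewrite mulr_ge0 ?path_gain_ge0// addr_ge0// fine_ge0//.
exact: interference_ge0.
Qed.

Lemma measurable_fine_interference X : measurable_fun setT X ->
  measurable_fun setT (fun w => fine (interference Pw Bb alpha Mant k X N w)).
Proof.
move=> mX; apply: (measurableT_comp (f := fine)); first exact: (fine_measurable measurableT).
exact: measurable_interference.
Qed.

Lemma measurable_fading_threshold X b : measurable_fun setT X ->
  measurable_fun setT (fading_threshold X b).
Proof.
move=> mX; apply: measurable_funM; last first.
  by apply: measurable_funD => //; exact: measurable_fine_interference.
apply: measurable_funM => //; apply: measurable_funM => //.
exact: (measurableT_comp (measurable_powR _) mX).
Qed.

End Interference.

Section InterferenceLaw.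
Context d (T : measurableType d) (P : probability T R).
Variables (N : 'I_K -> T -> {measure set pt -> \bar R}) (c : 'I_K -> R).
Hypotheses (c_gt0 : forall j, 0 < c j) (N_PPP : forall j, is_PPP P (N j) (marked_mean (c j)))
  (N_indep : mutually_indep P (fun j => events_of_pp (N j))).
Local Notation I_ x w := (interference Pw Bb alpha Mant k (fun=> x) N w).

Lemma measurable_PPP_count j B : measurable B -> measurable_fun setT (fun w => N j w B : \bar R).
Proof. by case: (N_PPP j) => + _; apply. Qed.

Let measurable_I x : measurable_fun setT (fun w => I_ x w).
Proof. exact: measurable_interference_cst measurable_PPP_count x. Qed.

Definition laplace_exponent (x t : R) : R :=
  \sum_(j < K) c j * pi * decay_int (alpha j) (t * Pw j) (excl j k x ^+ 2) 1 1.

Lemma events_of_pp_tier_interference j t r (A : set R) : measurable A ->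
  events_of_pp (N j)
    ((fun w => expN (t%:E * tier_interference (Pw j) (alpha j) r (N j w))) @^-1` A).
Proof.
pose counts := [set E | exists B : set pt, exists S : set (\bar R),
  [/\ measurable B, measurable S & E = (fun w => N j w B) @^-1` S]].
have mZ : measurable_fun [set: g_sigma_algebraType counts]
    (fun w => expN (t%:E * tier_interference (Pw j) (alpha j) r (N j w))).
  apply: (measurableT_comp measurable_expN); apply: measurable_funeM.
  apply: measurable_tier_interference; first exact: ltW.
  by move=> B mB _ S mS; rewrite setTI; exact: events_of_pp_count.
by move=> mA; have := mZ measurableT A mA; rewrite setTI.
Qed.

Lemma interference_laplace (x t : R) : 0 < x -> 0 < t ->
  (\int[P]_w (expN (t%:E * I_ x w))%:E = (expR (- laplace_exponent x t))%:E)%E.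
Proof.
move=> x0 t0; have t_ge0 : (0 <= t%:E)%E by rewrite lee_fin ltW.
pose Z j w := expN (t%:E * tier_interference (Pw j) (alpha j) (excl j k x) (N j w)).
have -> : (\int[P]_w (expN (t%:E * I_ x w))%:E = \int[P]_w (\prod_j Z j w)%:E)%E.
  apply: eq_integral => w _; congr EFin; rewrite ge0_sume_distrr; last first.
    by move=> j _; exact: tier_interference_ge0 (ltW (Pw_gt0 j)).
  by apply: expN_sum => j; apply: mule_ge0 => //; exact: tier_interference_ge0 (ltW (Pw_gt0 j)).
rewrite /laplace_exponent -sumrN expR_sum; apply: (indep_expectation_prod _ _ _ N_indep).
- by move=> j; apply: events_of_pp_measurable; exact: measurable_PPP_count.
- by move=> j; exact: events_of_pp_setT.
- by move=> j; exact: events_of_pp_setI.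
- by move=> j A; exact: events_of_pp_tier_interference.
- by move=> j w; exact: expN_ge0.
- by move=> j; apply: tier_laplace; rewrite ?excl_radius_gt0// ltW.
Qed.

Let sqr_excl_radius_gt0 j x : 0 < x -> 0 < excl j k x ^+ 2.
Proof. by move=> x0; rewrite exprn_gt0// excl_radius_gt0. Qed.

Let c_pi_gt0 j : 0 < c j * pi.
Proof. by rewrite mulr_gt0// pi_gt0. Qed.

Lemma laplace_exponent_le (x : R) : 0 < x ->
  exists C, forall t, 0 < t -> laplace_exponent x t <= t * C.
Proof.
move=> x0; pose B j := excl j k x ^+ 2 * (2 / alpha j) *
  (excl j k x ^+ 2) `^ (- (alpha j / 2)) / (1 - 2 / alpha j).
exists (\sum_(j < K) c j * pi * (Pw j * B j)) => t t0.
rewrite mulr_sumr; apply: ler_sum => j _; rewrite mulrCA ler_wpM2l ?(ltW (c_pi_gt0 j))// mulrA.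
by apply: decay_int11_le => //; [exact: mulr_gt0|exact: sqr_excl_radius_gt0].
Qed.

Lemma laplace_exponent_large (x B : R) : 0 < x -> exists2 t, 0 < t & B <= laplace_exponent x t.
Proof.
move=> x0; have B1 : 0 < `|B| + 1 by rewrite ltr_wpDl.
have [kap kap0 J_large] := decay_int11_large (alpha_gt2 k) (sqr_excl_radius_gt0 k x0)
  (divr_gt0 B1 (c_pi_gt0 k)).
exists (kap / Pw k); first by rewrite divr_gt0.
have term_ge0 j : 0 <= c j * pi *
    decay_int (alpha j) (kap / Pw k * Pw j) (excl j k x ^+ 2) 1 1.
  apply: mulr_ge0; first exact: ltW.
  by apply: decay_int_ge0; rewrite mulr_gt0// divr_gt0.
rewrite /laplace_exponent (bigD1 k)//= -[leLHS]addr0 lerD ?sumr_ge0// divfK ?gt_eqF//.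
rewrite [leRHS]mulrC -ler_pdivrMr//; apply: le_trans J_large.
by rewrite ler_pM2r ?invr_gt0// (le_trans (ler_norm B))// lerDl.
Qed.

Lemma ae_interference_fin : {ae P, forall w, forall x, 0 < x -> (I_ x w < +oo)%E}.
Proof.
have : {ae P, forall w, forall n, (I_ (n.+1%:R^-1)%R w < +oo)%E}.
  apply: ae_foralln => n; have n0 : 0 < n.+1%:R^-1 :> R by rewrite invr_gt0.
  apply: (ae_fin_laplace (measurable_I _)) => [w|t t0|].
  - exact: interference_ge0.
  - exact: interference_laplace.
  - exact: laplace_exponent_le.
apply: filterS => w I_fin x x0.
have [n] := ltr_add_invr x0; rewrite add0r => nx.
apply: le_lt_trans (I_fin n).
by apply: interference_nincr => //; exact: ltW.
Qed.

Lemma ae_interference_gt0 (r : R) : 0 < r ->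
  {ae P, forall w, forall x, 0 < x <= r -> (0 < I_ x w)%E}.
Proof.
move=> r0; have : {ae P, forall w, (0 < I_ r w)%E}.
  apply: (ae_gt0_laplace (measurable_I r)) => [w|t t0|B].
  - exact: interference_ge0.
  - exact: interference_laplace.
  - exact: laplace_exponent_large.
apply: filterS => w Ir x /andP[x0 xr].
by apply: lt_le_trans Ir _; apply: interference_nincr => //; exact: ltW.
Qed.

End InterferenceLaw.

(* The summand of the rate formula without the factors coming from the law of
   the serving distance and from the layer-cake representation of the logarithm. *)
Definition cov_term (i m n : nat) (y b : R) : R :=
  pi ^+ i * sigmak Pw W k b ^+ (m - n) / ((m - n)`!%:R * i`!%:R)
  * y `^ (alpha k / 2 * (m - n)%:R)
  * expR (- sigmak Pw W k b * y `^ (alpha k / 2) - pi * gk 0 y b)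
  * (Qmx lam Pw Bb alpha Mant lam_u eps k y b ^+ i) (inord n) ord0.

Definition coverage (y b : R) : R :=
  \sum_(0 <= i < Mant k) \sum_(0 <= m < Mant k) \sum_(0 <= n < m.+1) cov_term i m n y b.

Local Notation symbol y b := (toeplitz_symbol (Mant k).-1.+1 (fun p => gk p y b)).

Lemma expr_Qmx i n y b :
  (Qmx lam Pw Bb alpha Mant lam_u eps k y b ^+ i) (inord n) ord0 =
  (symbol y b ^+ i)`_(inord n : 'I_(Mant k).-1.+1).
Proof. exact: expr_lower_toeplitz. Qed.

Section InterferenceMoments.
Context d (T : measurableType d) (P : probability T R).
Variable N : 'I_K -> T -> {measure set pt -> \bar R}.
Local Notation intensity := (fun j => Act j * lam j).
Hypotheses (N_PPP : forall j, is_PPP P (N j) (marked_mean (intensity j)))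
  (N_indep : mutually_indep P (fun j => events_of_pp (N j))).
Local Notation I_ x w := (interference Pw Bb alpha Mant k (fun=> x) N w).

Lemma intensity_gt0 j : 0 < intensity j.
Proof. by rewrite mulr_gt0// Aact_gt0. Qed.

Lemma taylor_mod_laplace_exponent (x b : R) : 0 < x -> 0 < b ->
  taylor_mod (Mant k).-1.+1 (fun z => - laplace_exponent intensity x (path_gain x b * (1 - z)))
    (pi *: symbol (x ^+ 2) b - (pi * gk 0 (x ^+ 2) b)%:P).
Proof.
move=> x0 b0; pose kap j := path_gain x b * Pw j; pose u j := excl j k x ^+ 2.
have kap_gt0 j : 0 < kap j by rewrite mulr_gt0// path_gain_gt0.
have u_gt0 j : 0 < u j by rewrite exprn_gt0// excl_radius_gt0.
pose J j := decay_int (alpha j) (kap j) (u j).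
have -> : pi *: symbol (x ^+ 2) b - (pi * gk 0 (x ^+ 2) b)%:P = \sum_(j < K)
    - (Act j * lam j * pi) *: ((J j 1 1)%:P - toeplitz_symbol (Mant k).-1.+1 (fun p => J j p p.+1)).
  rewrite -toeplitz_symbolZ gf_decay_int// rmorph_sum/=.
  rewrite (@eq_toeplitz_symbol _ _ _ (fun p => \sum_(j < K) Act j * lam j * pi * J j p p.+1)).
    rewrite toeplitz_symbol_sum -sumrB; apply: eq_bigr => j _.
    by rewrite scalerBr !scaleNr opprK addrC polyCM mul_polyC.
  by move=> p p0; rewrite gf_decay_int// (maxn_idPl p0).
rewrite (_ : (fun z => _) = fun z => \sum_(j < K)
    - (Act j * lam j * pi) * decay_int (alpha j) (kap j * (1 - z)) (u j) 1 1).
  by apply: taylor_mod_sum => j; apply: taylor_modZ; exact: taylor_mod_decay_int.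
apply/funext => z; rewrite -sumrN; apply: eq_bigr => j _.
by rewrite mulNr /kap [path_gain x b * Pw j * _]mulrAC.
Qed.

Let measurable_I x : measurable_fun setT (fun w => fine (I_ x w)).
Proof. by apply: measurable_fine_interference => // j; exact: (measurable_PPP_count N_PPP). Qed.

Let I_ge0 x w : 0 <= fine (I_ x w).
Proof. by apply: fine_ge0; exact: interference_ge0. Qed.

Lemma laplace_fine_interference (x t : R) : 0 < x -> 0 < t ->
  \int[P]_w expR (- (t * fine (I_ x w))) = expR (- laplace_exponent intensity x t).
Proof.
move=> x0 t0.
rewrite /Rintegral -[RHS]/(fine (expR (- laplace_exponent intensity x t))%:E).
congr fine; rewrite -(interference_laplace intensity_gt0 N_PPP N_indep x0 t0).
apply: ae_eq_integral => //.
- apply/measurable_EFinP; apply: measurableT_comp => //; apply: measurable_funN.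
  exact: measurable_funM.
- apply/measurable_EFinP; apply: (measurableT_comp measurable_expN); apply: measurable_funeM.
  by apply: measurable_interference_cst => j; exact: (measurable_PPP_count N_PPP).
- apply: filterS (ae_interference_fin intensity_gt0 N_PPP N_indep) => w /(_ x x0) Ifin _.
  by rewrite -[in RHS](fineK (x := I_ x w)) ?ge0_fin_numE ?interference_ge0// -EFinM expN_EFin.
Qed.

Lemma interference_moment (x b : R) n : 0 < x -> 0 < b -> (n < Mant k)%N ->
  mixed_pois P (fun w => path_gain x b * fine (I_ x w)) n =
  expR (- (pi * gk 0 (x ^+ 2) b)) * \sum_(0 <= i < Mant k)
    pi ^+ i / i`!%:R * (Qmx lam Pw Bb alpha Mant lam_u eps k (x ^+ 2) b ^+ i) (inord n) ord0.
Proof.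
move=> x0 b0; rewrite -[X in (n < X)%N](prednK (Mant_gt0 k)) => nM.
have gain_gt0 := path_gain_gt0 x0 b0.
rewrite (mixed_pois_expR _ _ _ (taylor_mod_laplace_exponent x0 b0) nM).
- rewrite coefB coefZ coef0_toeplitz_symbol mulr0 coefC sub0r polyCN opprK subrK.
  congr (_ * _); rewrite coef_sum -[X in \sum_(0 <= _ < X) _](prednK (Mant_gt0 k)) big_mkord.
  apply: eq_bigr => i _.
  by rewrite exprZn !coefZ expr_Qmx inordK// mulrA [_^-1 * _]mulrC.
- exact: measurable_funM.
- by move=> w; rewrite mulr_ge0 ?I_ge0// ltW.
- move=> z /andP[z0 z2]; rewrite -laplace_fine_interference//; last by rewrite mulr_gt0//; lra.
  by apply: eq_Rintegral => w _; rewrite mulrAC.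
Qed.

Lemma coverage_fixed_distance (x b : R) : 0 < x -> 0 < b ->
  (\int[P]_w (erlang_tail (Mant k) (path_gain x b * (fine (I_ x w) + W)))%:E =
   (coverage (x ^+ 2) b)%:E)%E.
Proof.
move=> x0 b0; have gain_ge0 := path_gain_ge0 x b0.
under eq_integral do rewrite mulrDr addrC.
rewrite integral_erlang_tailD; first last.
- by move=> w; apply: mulr_ge0.
- exact: measurable_funM.
- exact: mulr_ge0.
congr EFin; rewrite /coverage exchange_big/=; apply: eq_big_nat => m /andP[_ mM].
rewrite exchange_big/=; apply: eq_big_nat => n /andP[_ nm].
rewrite interference_moment ?(leq_ltn_trans _ mM)// mulrA mulr_sumr; apply: eq_bigr => i _.
have x2 : (x ^+ 2) `^ (alpha k / 2) = x `^ alpha k.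
  by rewrite -(powR_mulrn 2 (ltW x0)) -powRrM; congr (_ `^ _); field.
have gainE : path_gain x b * W = sigmak Pw W k b * x `^ alpha k.
  by rewrite /path_gain /sigmak; field; rewrite gt_eqF.
rewrite /cov_term powRrM powR_mulrn ?powR_ge0// x2 mulNr expRD /pois gainE exprMn.
move: (_ (inord n) ord0) (expR (- (sigmak _ _ _ _ * _))) (expR (- (pi * _))) => q e1 e2.
have fact_neq0 p : p`!%:R != 0 :> R by rewrite pnatr_eq0 -lt0n fact_gt0.
by field; rewrite !fact_neq0.
Qed.

End InterferenceMoments.

Lemma cov_term_ge0 i m n y b : 0 < b -> 0 <= cov_term i m n y b.
Proof.
move=> b0; rewrite /cov_term expr_Qmx mulr_ge0 ?expr_toeplitz_symbol_ge0//; last first.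
  by move=> p; exact: gf_ge0.
apply: mulr_ge0; last exact: expR_ge0.
apply: mulr_ge0; last exact: powR_ge0.
have sigma_ge0 : 0 <= sigmak Pw W k b by rewrite /sigmak divr_ge0 ?mulr_ge0// ltW.
by rewrite divr_ge0// mulr_ge0// exprn_ge0// pi_ge0.
Qed.

Lemma coverage_ge0 y b : 0 < b -> 0 <= coverage y b.
Proof.
by move=> b0; do 3 (apply: sumr_ge0 => ? _); exact: cov_term_ge0.
Qed.

Lemma measurable_tauf j : measurable_fun setT (tau j k).
Proof. exact: measurable_funM. Qed.

Lemma measurable_phif j n : measurable_fun Ioo0inf (phi j k n).
Proof.
apply: (eq_measurable_fun (fun b => decay_int (alpha j) (tau j k b) 1 (maxn n 1) n.+1)).
  by move=> b /set_mem/Ioo0inf_gt0 b0; rewrite phif_decay_int.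
apply: (measurable_comp _ _ (measurable_decay_int (alpha j) 1 (maxn n 1) n.+1)).
- exact: measurable_Ioo0inf.
- by move=> _ [b /Ioo0inf_gt0 b0 <-]; rewrite /= in_itv/= andbT tauf_gt0.
- exact: measurable_funTS (measurable_tauf j).
Qed.

(* The pairs (distance squared, SINR threshold). *)
Local Notation upper_half := (setT `*` Ioo0inf : set (measurableTypeR R * measurableTypeR R)).

Let measurable_upper_half : measurable upper_half.
Proof. by apply: measurableX => //; exact: measurable_Ioo0inf. Qed.

Lemma measurable_upper_half_powR (a : R) : measurable_fun upper_half (fun z => z.1 `^ a).
Proof.
by apply: measurable_funTS; exact: (measurableT_comp (measurable_powR _) measurable_fst).
Qed.

Lemma measurable_gf n : measurable_fun upper_half (fun z => gk n z.1 z.2).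
Proof.
apply: measurable_sum => j; apply: measurable_funM; last exact: measurable_upper_half_powR.
apply: measurable_funM => //; apply: (measurable_comp _ _ (measurable_phif j n)).
- exact: measurable_Ioo0inf.
- by move=> _ [[y b] [_ b0] <-].
- exact: measurable_funTS measurable_snd.
Qed.

Lemma measurable_cov_term i m n : measurable_fun upper_half (fun z => cov_term i m n z.1 z.2).
Proof.
have msigma : measurable_fun upper_half (fun z => sigmak Pw W k z.2).
  by do 2 apply: measurable_funM => //; exact: measurable_funTS measurable_snd.
rewrite /cov_term; under eq_fun do rewrite expr_Qmx.
apply: measurable_funM; last by apply: measurable_expr_toeplitz_symbol => p; exact: measurable_gf.
apply: measurable_funM; last first.
  apply: measurableT_comp => //; apply: measurable_funB.
    by apply: measurable_funM; [exact: measurable_funN|exact: measurable_upper_half_powR].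
  by apply: measurable_funM => //; exact: measurable_gf.
apply: measurable_funM; last exact: measurable_upper_half_powR.
by apply: measurable_funM => //; apply: measurable_funM => //; exact: measurable_funX.
Qed.

Lemma measurable_coverage : measurable_fun upper_half (fun z => coverage z.1 z.2).
Proof. by do 3 (apply: measurable_sum => ?); exact: measurable_cov_term. Qed.

Local Notation rate i m n y b := (rate_integrand lam Pw Bb alpha Mant lam_u eps W k i m n y b).

Lemma rate_integrandE i m n y b :
  rate i m n y b = pi * assoc k y / (1 + b) * cov_term i m n y b.
Proof.
rewrite /rate_integrand /cov_term /assoc_exp expRD exprS.
by set a := \sum_(j < K) _; set q := _ (inord n) ord0; rewrite !mulrA; ring.
Qed.

Lemma sum_rate_integrand y b :
  \sum_(0 <= i < Mant k) \sum_(0 <= m < Mant k) \sum_(0 <= n < m.+1) rate i m n y b =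
  pi * assoc k y / (1 + b) * coverage y b.
Proof.
do 3 (rewrite mulr_sumr; apply: eq_bigr => ? _); exact: rate_integrandE.
Qed.

Lemma rate_integrand_ge0 i m n y b : 0 < b -> 0 <= rate i m n y b.
Proof.
move=> b0; rewrite rate_integrandE; apply: mulr_ge0; last exact: cov_term_ge0.
apply: divr_ge0; last by rewrite addr_ge0// ltW.
by rewrite mulr_ge0 ?pi_ge0// expR_ge0.
Qed.

Lemma measurable_rate_integrand i m n : measurable_fun upper_half (fun z => rate i m n z.1 z.2).
Proof.
under eq_fun do rewrite rate_integrandE.
apply: measurable_funM; last exact: measurable_cov_term.
apply: measurable_funM; last first.
  apply: measurable_funV; apply: measurable_funD => //.
  exact: measurable_funTS measurable_snd.
apply: measurable_funM => //.
by apply: measurable_funTS; exact: (measurableT_comp (measurable_assoc_exp _) measurable_fst).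
Qed.

Lemma integral_sum_rate_integrand (D : set (measurableTypeR R)) : measurable D ->
  (\int[leb]_(y in D) \int[leb]_(b in Ioo0inf)
     (\sum_(0 <= i < Mant k) \sum_(0 <= m < Mant k) \sum_(0 <= n < m.+1) rate i m n y b)%:E =
   \sum_(0 <= i < Mant k) \sum_(0 <= m < Mant k) \sum_(0 <= n < m.+1)
     \int[leb]_(y in D) \int[leb]_(b in Ioo0inf) (rate i m n y b)%:E)%E.
Proof.
move=> mD.
have mrate i m n : measurable_fun
    (D `*` Ioo0inf : set (measurableTypeR R * measurableTypeR R)) (fun z => rate i m n z.1 z.2).
  by apply: measurable_funS (measurable_rate_integrand i m n) => // z [].
rewrite (ge0_integral2_sum _ _ _ mD measurable_Ioo0inf) => [|i|i y b _ /Ioo0inf_gt0 b0]; first last.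
- by do 2 (apply: sumr_ge0 => ? _); exact: rate_integrand_ge0.
- by do 2 (apply: measurable_sum => ?); exact: mrate.
apply: eq_bigr => i _; rewrite (ge0_integral2_sum _ _ _ mD measurable_Ioo0inf) =>
  [|m|m y b _ /Ioo0inf_gt0 b0]; first last.
- by apply: sumr_ge0 => ? _; exact: rate_integrand_ge0.
- by apply: measurable_sum => ?; exact: mrate.
apply: eq_bigr => m _.
rewrite (ge0_integral2_sum _ _ _ mD measurable_Ioo0inf) => // n y b _ /Ioo0inf_gt0.
exact: rate_integrand_ge0.
Qed.

Lemma measurable_serv_dens : measurable_fun setT (serv_dens lam Pw Bb alpha Mant eps k).
Proof.
apply: measurable_funM; first exact: measurable_funM.
apply: measurableT_comp => //; apply: measurable_funN; apply: measurable_funM => //.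
exact: measurable_powR_sum.
Qed.

Lemma serv_densE (x : R) : 0 < x -> serv_dens lam Pw Bb alpha Mant eps k x =
  pi * lam k / Tassoc lam Pw Bb alpha Mant eps k * assoc k (x ^+ 2) * (2 * x).
Proof.
move=> x0; rewrite /serv_dens /assoc_exp.
have sqr_powR j : x `^ (2 * (de j / de k)) = (x ^+ 2) `^ (de j / de k).
  by rewrite -(powR_mulrn 2 (ltW x0)) -powRrM.
by under eq_bigr do rewrite sqr_powR; ring.
Qed.

Lemma serv_dens_ge0 (x : R) : 0 < x -> 0 <= serv_dens lam Pw Bb alpha Mant eps k x.
Proof.
move=> x0; rewrite serv_densE//; apply: mulr_ge0; last by rewrite mulr_ge0// ltW.
apply: mulr_ge0; last exact: expR_ge0.
by rewrite divr_ge0 ?(ltW (Tassoc_gt0 k))// mulr_ge0 ?pi_ge0// ltW.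
Qed.

Section AverageRate.
Context d (T : measurableType d) (P : probability T R).
Variables (X H : T -> R) (N : 'I_K -> T -> {measure set pt -> \bar R}).
Local Notation dens := (serv_dens lam Pw Bb alpha Mant eps k).

Definition source_events (o : option (option 'I_K)) : set (set T) :=
  match o with
  | None => events_of_real X
  | Some None => events_of_real H
  | Some (Some j) => events_of_pp (N j)
  end.

Hypotheses (mX : measurable_fun setT X) (mH : measurable_fun setT H).
Hypothesis X_law : forall A : set R, measurable A ->
  P (X @^-1` A) = (\int[leb]_(x in A `&` Ioc0 (Rd k)) (dens x)%:E)%E.
Hypothesis H_law : forall A : set R, measurable A ->
  P (H @^-1` A) = (\int[leb]_(h in A `&` Ioo0inf)
    (h ^+ (Mant k).-1 * expR (- h) / ((Mant k).-1)`!%:R)%:E)%E.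
Hypothesis N_PPP : forall j, is_PPP P (N j) (marked_mean (Act j * lam j)).
Hypothesis sources_indep : mutually_indep P source_events.

Local Notation threshold := (fading_threshold N X).
Local Notation sinr := (SINR Pw Bb alpha Mant W k X H N).
Local Notation others o := (other_events source_events o).

Lemma source_events_measurable o : source_events o `<=` measurable.
Proof.
case: o => [[j|]|]; [|exact: events_of_real_measurable|exact: events_of_real_measurable].
by apply: events_of_pp_measurable; exact: (measurable_PPP_count N_PPP).
Qed.

Lemma source_events_setT o : source_events o setT.
Proof.
case: o => [[j|]|]; first exact: events_of_pp_setT.
  exact: events_of_real_setT.
exact: events_of_real_setT.
Qed.

Lemma source_events_setI o : setI_closed (source_events o).
Proof.
case: o => [[j|]|]; first exact: events_of_pp_setI.
  exact: events_of_real_setI.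
exact: events_of_real_setI.
Qed.

Lemma indep_source o E0 E : source_events o E0 -> <<s others o >> E ->
  P (E0 `&` E) = (P E0 * P E)%E.
Proof.
exact: (indep_other_events source_events_measurable source_events_setT source_events_setI
  sources_indep).
Qed.

Lemma indep_tiers : mutually_indep P (fun j => events_of_pp (N j)).
Proof.
apply: (mutually_indep_comp source_events_setT sources_indep (h := fun j => Some (Some j))).
by move=> i j [].
Qed.

Lemma measurable_other_count o j B : Some (Some j) != o -> measurable B ->
  measurable_fun [set: g_sigma_algebraType (others o)] (fun w => N j w B : \bar R).
Proof.
move=> jo mB _ S mS; rewrite setTI; apply: sub_sigma_algebra.
by exists (Some (Some j)) => //; exact: events_of_pp_count.
Qed.

Lemma measurable_other_distance o : None != o ->
  measurable_fun [set: g_sigma_algebraType (others o)] (X : g_sigma_algebraType (others o) -> R).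
Proof.
move=> no _ A mA; rewrite setTI; apply: sub_sigma_algebra.
by exists None => //; exists A.
Qed.

Let measurable_threshold b : measurable_fun setT (threshold b).
Proof. by apply: measurable_fading_threshold => //; exact: (measurable_PPP_count N_PPP). Qed.

Lemma gamma_tail t : 0 <= t -> P [set w | t < H w] = (erlang_tail (Mant k) t)%:E.
Proof.
move=> t0; rewrite -[in RHS](prednK (Mant_gt0 k)) -integral_pois_tail//.
rewrite (_ : [set w | _] = H @^-1` `]t, +oo[); last first.
  by apply/seteqP; split => w /=; rewrite in_itv/= andbT.
rewrite H_law// (_ : _ `&` _ = `]t, +oo[%classic).
  by apply: eq_integral => h _; rewrite /pois mulrAC.
apply/seteqP; split => h; rewrite /Ioo0inf/= !in_itv/= !andbT; first by case.
by move=> th; split => //; exact: le_lt_trans th.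
Qed.

Lemma fading_average b : 0 < b -> P [set w | threshold b w < H w] =
  (\int[P]_w (erlang_tail (Mant k) (threshold b w))%:E)%E.
Proof.
move=> b0; pose lt_pair := [set z : R * R | z.1 < z.2].
have mlt : measurable lt_pair.
  rewrite -[X in measurable X]setTI.
  exact: (@measurable_fun_ltr _ _ R setT fst snd measurable_fst measurable_snd _ [set true]).
have mthreshold_H : measurable_fun setT (fun w => (threshold b w, H w)).
  exact: measurable_fun_pair.
pose f z : \bar R := (\1_lt_pair z)%:E.
have mf : measurable_fun setT f by apply/measurable_EFinP; exact: measurable_indic.
have f_ge0 z : (0 <= f z)%E by rewrite lee_fin.
transitivity (\int[P]_w f (threshold b w, H w))%E.
  rewrite -(setIT [set w | _]) -integral_indic//.
  exact: measurable_preimage mthreshold_H mlt.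
rewrite (indep_integral_pair _ mH _ mf f_ge0)//.
  apply: eq_integral => w _; rewrite -gamma_tail ?fading_threshold_ge0//.
  rewrite -[in RHS](setIT [set w | _]) -integral_indic//.
  have mray : measurable (`]threshold b w, +oo[ : set R) by exact: measurable_itv.
  rewrite (_ : [set v | _] = H @^-1` `]threshold b w, +oo[); first exact: measurable_preimage.
  by apply/seteqP; split => v /=; rewrite in_itv/= andbT.
move=> A B mA mB; rewrite setIC muleC; apply: (indep_source (o := Some None)); first by exists B.
have mthreshold_other :
    measurable_fun [set: g_sigma_algebraType (others (Some None))] (threshold b).
  apply: measurable_fading_threshold; last exact: measurable_other_distance.
  by move=> j C; exact: measurable_other_count.
by have := mthreshold_other measurableT A mA; rewrite setTI.
Qed.

Lemma integral_serving_distance (g : R -> \bar R) :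
  measurable_fun setT g -> (forall x, 0 <= g x)%E ->
  (\int[P]_w g (X w) = \int[leb]_(x in Ioc0 (Rd k)) (g x * (dens x)%:E))%E.
Proof.
move=> mg g_ge0; pose p := dens \_ (Ioc0 (Rd k)).
have mp : measurable_fun setT p.
  apply/(measurable_restrictT dens (measurable_Ioc0 _)).
  exact: measurable_funTS measurable_serv_dens.
have p_ge0 x : 0 <= p x.
  rewrite /p patchE; case: ifPn => // /set_mem/Ioc0_gt0.
  exact: serv_dens_ge0.
have pE x : (p x)%:E = ((fun x => (dens x)%:E) \_ (Ioc0 (Rd k))) x.
  by rewrite /p !patchE; case: ifP.
rewrite (ge0_integral_image (nu := mdensity leb mp p_ge0))//.
  rewrite ge0_integral_mdensity// [RHS]integral_mkcond; apply: eq_integral => x _.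
  by rewrite pE !patchE; case: ifP => // _; rewrite mule0.
move=> A mA; apply: (etrans (X_law mA)); rewrite setIC integral_mkcondl.
by apply: eq_integral => x _; rewrite pE.
Qed.

Lemma measurable_conditional_coverage dV (V : measurableType dV)
    (NV : 'I_K -> V -> {measure set pt -> \bar R}) b :
  (forall j B, measurable B -> measurable_fun setT (fun v => NV j v B : \bar R)) ->
  measurable_fun setT (fun z : measurableTypeR R * V => (erlang_tail (Mant k)
    (path_gain z.1 b * (fine (interference Pw Bb alpha Mant k (fun=> z.1) NV z.2) + W)))%:E).
Proof.
move=> mNV; apply/measurable_EFinP; apply: (measurableT_comp (measurable_erlang_tail _)).
apply: (@measurable_fading_threshold _ _ (fun j (z : measurableTypeR R * V) => NV j z.2) _ fst b).
  by move=> j B mB; exact: measurableT_comp (mNV j B mB) measurable_snd.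
exact: measurable_fst.
Qed.

Lemma distance_average b : 0 < b ->
  (\int[P]_w (erlang_tail (Mant k) (threshold b w))%:E =
   \int[leb]_(x in Ioc0 (Rd k)) ((coverage (x ^+ 2) b)%:E * (dens x)%:E))%E.
Proof.
move=> b0; pose V := g_sigma_algebraType (others None).
pose f (z : measurableTypeR R * T) : \bar R := (erlang_tail (Mant k)
  (path_gain z.1 b * (fine (interference Pw Bb alpha Mant k (fun=> z.1) N z.2) + W)))%:E.
have f_ge0 z : (0 <= f z)%E.
  rewrite lee_fin erlang_tail_ge0// mulr_ge0 ?path_gain_ge0// addr_ge0// fine_ge0//.
  exact: interference_ge0.
have mf : measurable_fun setT f.
  by apply: measurable_conditional_coverage; exact: (measurable_PPP_count N_PPP).
have mfV : measurable_fun setT (f : measurableTypeR R * V -> \bar R).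
  apply: (measurable_conditional_coverage (V := V)) => j B.
  exact: measurable_other_count.
have others_measurable : <<s others None >> `<=` measurable.
  apply: smallest_sub; first exact: sigma_algebra_measurable.
  by move=> A [i _]; exact: source_events_measurable.
have mid : measurable_fun setT (idfun : T -> V).
  by move=> _ B mB; rewrite setTI; exact: others_measurable.
transitivity (\int[P]_w \int[P]_v f (X w, v))%E.
  apply: (indep_integral_pair (X := X : T -> measurableTypeR R) mX mid _ mfV f_ge0).
  by move=> A B mA mB; apply: (indep_source (o := None)); first by exists A.
rewrite (integral_serving_distance (g := fun x => \int[P]_v f (x, v))%E).
- apply: eq_integral => x /set_mem/Ioc0_gt0 x0; congr (_ * _)%E.
  exact: (coverage_fixed_distance N_PPP indep_tiers).
- exact: (@measurable_fun_fubini_tonelli_F _ _ _ _ R P f mf f_ge0).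
- by move=> x; exact: integral_ge0.
Qed.

Lemma measurable_sinr : measurable_fun setT sinr.
Proof.
apply: measurable_funM.
  apply: measurable_funM; first exact: measurable_funM.
  exact: (measurableT_comp (measurable_powR _) mX).
apply: measurable_funV; apply: measurable_funD => //.
by apply: measurable_fine_interference => //; exact: (measurable_PPP_count N_PPP).
Qed.

Lemma ae_serving_distance : {ae P, forall w, 0 < X w <= Rd k}.
Proof.
have mA : measurable (~` Ioc0 (Rd k)) by apply: measurableC; exact: measurable_Ioc0.
exists (X @^-1` (~` Ioc0 (Rd k))); split.
- exact: measurable_preimage.
- by rewrite X_law// setICl integral_set0.
- by move=> w /= Xw; rewrite /Ioc0/= in_itv.
Qed.

Lemma ae_signal_gain : {ae P, forall w, 0 < H w}.
Proof.
have mA : measurable (~` (Ioo0inf : set R)) by apply: measurableC; exact: measurable_Ioo0inf.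
exists (H @^-1` (~` Ioo0inf)); split.
- exact: measurable_preimage.
- by rewrite H_law// setICl integral_set0.
- by move=> w /= Hw; rewrite /Ioo0inf/= in_itv/= andbT.
Qed.

Lemma ae_sinr : {ae P, forall w, 0 <= sinr w /\
  forall b, 0 < b -> (b < sinr w) = (threshold b w < H w)}.
Proof.
have I_fin := ae_interference_fin intensity_gt0 N_PPP indep_tiers.
have I_gt0 := ae_interference_gt0 intensity_gt0 N_PPP indep_tiers (Rad_gt0 k).
apply: filterS2 (filterI ae_serving_distance ae_signal_gain) (filterI I_fin I_gt0) => w [Xw H0].
have /andP[x0 _] := Xw; move=> [/(_ _ x0) Ifin /(_ _ Xw) Ipos].
set D := fine (interference Pw Bb alpha Mant k X N w) + W.
have D0 : 0 < D by rewrite ltr_pwDl//; apply: fine_gt0; apply/andP.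
have gain0 : 0 < X w `^ alpha k by rewrite powR_gt0.
rewrite /SINR -/D powRN; split.
  by rewrite !divr_ge0 ?mulr_ge0// ltW.
move=> b b0; rewrite ltr_pdivlMr// /fading_threshold -/D /path_gain.
rewrite ltr_pdivlMr// [RHS](_ : _ = (b * X w `^ alpha k * D < H w * Pw k)).
  by rewrite [H w * _]mulrC mulrAC.
by rewrite mulrAC ltr_pdivrMr.
Qed.

Lemma coverage_probability b : 0 < b -> P [set w | b < sinr w] =
  (\int[leb]_(x in Ioc0 (Rd k)) ((coverage (x ^+ 2) b)%:E * (dens x)%:E))%E.
Proof.
move=> b0; rewrite -distance_average// -fading_average//.
have mlt (f g : T -> R) : measurable_fun setT f -> measurable_fun setT g ->
    measurable [set w | f w < g w].
  move=> mf mg; rewrite -[X in measurable X]setTI.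
  exact: (measurable_fun_ltr mf mg) measurableT [set true] _.
apply: ae_eq_measure; [exact: mlt measurable_sinr|exact: mlt|].
by apply: filterS ae_sinr => w [_ /(_ b b0)] /= ->.
Qed.

Lemma avg_rate_layer_cake : avg_rate Pw Bb alpha Mant P W k X H N = ((ln 2)^-1%:E *
  \int[leb]_(b in Ioo0inf) (P [set w | (b < sinr w)%R] * ((1 + b)^-1)%:E))%E.
Proof.
pose S w := Num.max (sinr w) 0.
have mS : measurable_fun setT S by apply: measurable_maxr => //; exact: measurable_sinr.
have S_ge0 w : 0 <= S w by rewrite le_max lexx orbT.
have mlnS : measurable_fun setT (fun w => ln (1 + S w)).
  by apply: (measurableT_comp (@measurable_ln R)); exact: measurable_funD.
have ln2_ge0 : 0 <= (ln 2)^-1 :> R by rewrite invr_ge0 ltW// ln_gt0// ltr1n.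
have -> : (\int[leb]_(b in Ioo0inf) (P [set w | (b < sinr w)%R] * ((1 + b)^-1)%:E) =
    \int[leb]_(b in Ioo0inf) (P [set w | (b < S w)%R] * ((1 + b)^-1)%:E))%E.
  apply: eq_integral => b /set_mem/Ioo0inf_gt0 b0.
  congr (P _ * _)%E; apply/seteqP; split => w /=; rewrite lt_max (ltNge b 0) (ltW b0) orbF//.
rewrite -layer_cake_ln1p// -ge0_integralZl_EFin//; last 2 first.
- by move=> w _; rewrite lee_fin ln_ge0// lerDl.
- exact/measurable_EFinP.
apply: ae_eq_integral => //.
- apply/measurable_EFinP; apply: measurable_funM => //.
  apply: (measurableT_comp (@measurable_ln R)); apply: measurable_funD => //.
  exact: measurable_sinr.
- by apply: measurable_funeM; exact/measurable_EFinP.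
- by apply: filterS ae_sinr => w [sinr_ge0 _] _; rewrite /S max_l// mulrC.
Qed.

Local Notation rate_sum y b :=
  (\sum_(0 <= i < Mant k) \sum_(0 <= m < Mant k) \sum_(0 <= n < m.+1) rate i m n y b).
Local Notation scale := (lam k / Tassoc lam Pw Bb alpha Mant eps k).

Let scale_ge0 : 0 <= scale.
Proof. by rewrite divr_ge0// ltW// Tassoc_gt0. Qed.

Lemma sum_rate_integrand_ge0 y b : 0 < b -> 0 <= rate_sum y b.
Proof. by move=> b0; do 3 (apply: sumr_ge0 => ? _); exact: rate_integrand_ge0. Qed.

Lemma measurable_sum_rate_integrand : measurable_fun upper_half (fun z => rate_sum z.1 z.2).
Proof. by do 3 (apply: measurable_sum => ?); exact: measurable_rate_integrand. Qed.

Lemma coverage_serv_dens x b : 0 < x ->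
  coverage (x ^+ 2) b * dens x * (1 + b)^-1 = scale * rate_sum (x ^+ 2) b * (2 * x).
Proof. by move=> x0; rewrite sum_rate_integrand serv_densE//; ring. Qed.

Let integral_rate y : \bar R := (\int[leb]_(b in Ioo0inf) (rate_sum y b)%:E)%E.

Lemma measurable_integral_rate : measurable_fun setT integral_rate.
Proof.
apply: (measurable_fun_section_integral leb measurableT measurable_Ioo0inf
  (f := fun z => (rate_sum z.1 z.2)%:E)).
  by apply/measurable_EFinP; exact: measurable_sum_rate_integrand.
by move=> y b _ /Ioo0inf_gt0 b0; rewrite lee_fin sum_rate_integrand_ge0.
Qed.

Lemma integral_rate_ge0 y : (0 <= integral_rate y)%E.
Proof. by apply: integral_ge0 => b /Ioo0inf_gt0 b0; rewrite lee_fin sum_rate_integrand_ge0. Qed.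

Lemma measurable_coverage_sqr b : 0 < b -> measurable_fun setT (fun x : R => coverage (x ^+ 2) b).
Proof.
move=> b0.
have mpair : measurable_fun setT (fun x : R => (x ^+ 2, b) : measurableTypeR R * measurableTypeR R).
  by apply: measurable_fun_pair => //; exact: measurable_funX.
apply: (measurable_comp measurable_upper_half _ measurable_coverage mpair).
by move=> _ [x _ <-]; split => //=; rewrite /Ioo0inf/= in_itv/= andbT.
Qed.

Let rate_density (z : measurableTypeR R * measurableTypeR R) : \bar R :=
  (scale * rate_sum (z.1 ^+ 2) z.2 * (2 * z.1))%:E.

Let rate_density_ge0 x b : Ioc0 (Rd k) x -> Ioo0inf b -> (0 <= rate_density (x, b))%E.
Proof.
move=> /Ioc0_gt0 x0 /Ioo0inf_gt0 b0; rewrite lee_fin; apply: mulr_ge0.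
  by rewrite mulr_ge0// sum_rate_integrand_ge0.
by rewrite mulr_ge0// ltW.
Qed.

Let measurable_rate_density : measurable_fun (Ioc0 (Rd k) `*` Ioo0inf) rate_density.
Proof.
apply/measurable_EFinP; apply: measurable_funM; last first.
  by apply: measurable_funM => //; exact: measurable_funTS measurable_fst.
apply: measurable_funM => //.
have msqr : measurable_fun (Ioc0 (Rd k) `*` Ioo0inf)
    (fun z : measurableTypeR R * measurableTypeR R =>
       (z.1 ^+ 2, z.2) : measurableTypeR R * measurableTypeR R).
  apply: measurable_funTS; apply: measurable_fun_pair; last exact: measurable_snd.
  exact: (@measurable_funX _ _ R setT fst 2 measurable_fst).
apply: (measurable_comp measurable_upper_half _ measurable_sum_rate_integrand msqr).
by move=> _ [z [_ z2] <-].
Qed.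

Lemma coverage_probability_rate b : 0 < b -> (P [set w | (b < sinr w)%R] * ((1 + b)^-1)%:E)%E =
  (\int[leb]_(x in Ioc0 (Rd k)) rate_density (x, b))%E.
Proof.
move=> b0; rewrite coverage_probability// muleC -ge0_integralZl_EFin.
- apply: eq_integral => x /set_mem/Ioc0_gt0 x0.
  by rewrite -!EFinM mulrC coverage_serv_dens.
- exact: measurable_Ioc0.
- by move=> x /Ioc0_gt0 x0; rewrite -EFinM lee_fin mulr_ge0 ?coverage_ge0 ?serv_dens_ge0.
- apply: emeasurable_funM; apply/measurable_EFinP/measurable_funTS.
    exact: measurable_coverage_sqr.
  exact: measurable_serv_dens.
- by rewrite invr_ge0 addr_ge0// ltW.
Qed.

Lemma integral_rate_density x : Ioc0 (Rd k) x ->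
  (\int[leb]_(b in Ioo0inf) rate_density (x, b) =
   scale%:E * integral_rate (x ^+ 2)%R * (2 * x)%:E)%E.
Proof.
move=> /Ioc0_gt0 x0; have mrate : measurable_fun Ioo0inf (fun b => (rate_sum (x ^+ 2) b)%:E).
  apply: (measurable_fun_section (f := fun z => (rate_sum z.1 z.2)%:E)
    measurableT measurable_Ioo0inf) => //.
  by apply/measurable_EFinP; exact: measurable_sum_rate_integrand.
rewrite muleAC -EFinM -ge0_integralZl_EFin//.
- by apply: eq_integral => b _; rewrite -EFinM mulrAC.
- exact: measurable_Ioo0inf.
- by move=> b /Ioo0inf_gt0 b0; rewrite lee_fin sum_rate_integrand_ge0.
- by rewrite mulr_ge0// mulr_ge0// ltW.
Qed.

Theorem avg_rate_formula : avg_rate Pw Bb alpha Mant P W k X H N =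
  rate_formula lam Pw Bb alpha Mant lam_u eps W k.
Proof.
have -> : avg_rate Pw Bb alpha Mant P W k X H N = ((ln 2)^-1%:E *
    \int[leb]_(b in Ioo0inf) \int[leb]_(x in Ioc0 (Rd k)) rate_density (x, b))%E.
  rewrite avg_rate_layer_cake; congr (_ * _)%E; apply: eq_integral => b /set_mem/Ioo0inf_gt0.
  exact: coverage_probability_rate.
rewrite -(fubini_tonelli_on leb leb (measurable_Ioc0 _) measurable_Ioo0inf
  measurable_rate_density rate_density_ge0).
have -> : (\int[leb]_(x in Ioc0 (Rd k)) \int[leb]_(b in Ioo0inf) rate_density (x, b) =
    \int[leb]_(y in Ioc0 (Rd k ^+ 2)) (scale%:E * integral_rate y))%E.
  rewrite -(integral_sqr_subst_Ioc0 (ltW (Rad_gt0 k))).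
  - by apply: eq_integral => x /set_mem; exact: integral_rate_density.
  - by apply: measurable_funeM; exact: measurable_funTS measurable_integral_rate.
  - by move=> y _; rewrite mule_ge0 ?integral_rate_ge0// lee_fin.
rewrite ge0_integralZl_EFin//.
- by rewrite (integral_sum_rate_integrand (measurable_Ioc0 _)) muleA -EFinM.
- exact: measurable_Ioc0.
- by move=> y _; exact: integral_rate_ge0.
- exact: measurable_funTS measurable_integral_rate.
Qed.

End AverageRate.

End Network.

Theorem theorem4
  (R : realType) (d : measure_display) (T : measurableType d)
  (P : probability T R)
  (K : nat) (lam Pw Bb alpha : 'I_K -> R) (Mant : 'I_K -> nat)
  (lam_u eps W : R) (k : 'I_K)
  (hlam : forall j, 0 < lam j) (hlam_u : 0 < lam_u)
  (hPw : forall j, 0 < Pw j) (hBb : forall j, 0 < Bb j)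
  (halpha : forall j, 2 < alpha j) (hMant : forall j, (0 < Mant j)%N)
  (heps : 0 < eps) (hW : 0 <= W)
  (X H : T -> R) (N : 'I_K -> T -> {measure set ((R * R) * R)%type -> \bar R})
  (* serving distance X_k : density on (0, R_k] *)
  (hXm : measurable_fun setT X)
  (hXlaw : forall A : set R, measurable A ->
     P (X @^-1` A) =
     (\int[@lebesgue_measure R]_(x in A `&` Ioc0 (Rad Pw Bb alpha Mant eps k))
        (serv_dens lam Pw Bb alpha Mant eps k x)%:E)%E)
  (* signal gain ||h||^2 ~ Gamma(M_k, 1) *)
  (hHm : measurable_fun setT H)
  (hHlaw : forall A : set R, measurable A ->
     P (H @^-1` A) =
     (\int[@lebesgue_measure R]_(h in A `&` Ioo0inf)
        (h ^+ (Mant k).-1 * expR (- h) / ((Mant k).-1)`!%:R)%:E)%E)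
  (* active tier-j BSs: homogeneous PPP of intensity A_j lam_j, Exp(1) marks *)
  (hN : forall j, is_PPP P (N j)
          (marked_mean (Aact lam Pw Bb alpha Mant lam_u eps j * lam j)))
  (* X, H, N_1, ..., N_K are mutually independent *)
  (hind : mutually_indep P (fun o : option (option 'I_K) =>
            match o with
            | None => events_of_real X
            | Some None => events_of_real H
            | Some (Some j) => events_of_pp (N j)
            end)) :
  avg_rate Pw Bb alpha Mant P W k X H N =
  rate_formula lam Pw Bb alpha Mant lam_u eps W k.
Proof.
exact: (avg_rate_formula hlam hlam_u).
Qed.
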